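(* Let $X$ be a finite 2-covered graph of spaces such that its horizontal subgraph is a disjoint union $\Gamma(X)=\Gamma_\infty\sqcup r_1\sqcup\dots\sqcup r_m$, where $\Gamma_\infty$ is a connected graph which is not homeomorphic to a circle and each $r_i$ is homeomorphic to a circle, and such that the realization of $X$ is obtained from $\Gamma(X)$ by attaching, for each $i$, the mapping cylinder $M_i$ of a $k_i$-fold covering $S^1\to r_i$ ($k_i\ge2$) along an immersion $S^1\looparrowright\Gamma_\infty$ representing the conjugacy class of an element $\gamma_i\in\pi_1(\Gamma_\infty)$, where the $M_i$ are exactly the unions of the 2-cells (products of edges of edge spaces with the interval) of $X$. Suppose $\gamma_1,\dots,\gamma_m$ are indivisible in the free group $\pi_1(\Gamma_\infty)$, pairwise non-conjugate, and $\gamma_i$ is not conjugate to $\gamma_j^{-1}$ for $i\ne j$. If $\chi(\Gamma(X))=\chi(\Gamma_U(X))$, then every edge space of $X$ is a tree.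
   Context: A 2-covered graph of spaces $X$ consists of: a finite connected graph $\Gamma_U(X)$ (the underlying graph), with oriented edges $e$, reversal $\bar e$, and terminal/initial vertices $\tau(e),\iota(e)=\tau(\bar e)$; for each vertex $v$ a finite connected graph $V$ (vertex space); for each edge $e$ a finite connected graph $E=\bar E$ (edge space, possibly a single point); and for each oriented edge $e$ a combinatorial immersion (locally injective graph map) $\tau_e\colon E\looparrowright V$ where $v=\tau(e)$; subject to the 2-covering condition: for each vertex $v$, every edge of $V$ is the image of exactly two edges of $\bigsqcup_{\tau(e)=v}E$. The realization of $X$ is $\bigsqcup V\sqcup\bigsqcup_e (E\times[0,1])$ with $E\times\{1\}$ glued via $\tau_e$ and $E\times\{0\}$ glued via $\tau_{\bar e}$. The horizontal subgraph $\Gamma(X)$ is the graph whose vertices are the vertices of all vertex spaces and with one edge $x\times[0,1]$ for each edge $e$ of $\Gamma_U(X)$ and each vertex $x$ of $E$, joining $\tau_{\bar e}(x)$ to $\tau_e(x)$ (it need not be connected). An element $g$ of a group is indivisible if $h^k=g$ implies $k=\pm1$. $\chi$ denotes Euler characteristic. *)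

(* Defs.v *)
From HB Require Import structures.
From mathcomp Require Import all_boot all_order all_algebra.
Set Implicit Arguments. Unset Strict Implicit. Unset Printing Implicit Defensive.
Import Order.TTheory GRing.Theory Num.Theory.

Section SerreGraph.
Variables (V D : eqType) (rv : D -> D) (tg : D -> V).

Definition serre : Prop := involutive rv /\ forall d, rv d != d.

Definition sg_src (d : D) : V := tg (rv d).

Fixpoint is_walk (u : V) (s : seq D) : bool :=
  if s is d :: s' then (sg_src d == u) && is_walk (tg d) s' else true.

Definition wend (u : V) (s : seq D) : V := last u (map tg s).

Definition walk_from_to (u : V) (s : seq D) (w : V) : bool :=
  is_walk u s && (wend u s == w).

Definition reducedw (s : seq D) : bool := sorted (fun a b => b != rv a) s.

(* no backtracking, cyclically (locally injective map of a circle) *)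
Definition cyc_reducedw (s : seq D) : bool :=
  (s != [::]) && cycle (fun a b => b != rv a) s.

(* graph spanned by the vertices satisfying P (P closed under adjacency) *)
Definition connected_on (P : V -> Prop) : Prop :=
  forall x y, P x -> P y -> exists s, walk_from_to x s y.

Definition acyclic_on (P : V -> Prop) : Prop :=
  forall x s, P x -> s != [::] -> reducedw s -> ~~ walk_from_to x s x.

Definition tree_on (P : V -> Prop) : Prop :=
  [/\ exists x, P x, connected_on P & acyclic_on P].

(* fundamental group pi_1(graph, v): reduced closed walks at v,
   product = concatenation followed by free reduction *)
Definition inv_walk (s : seq D) : seq D := rev (map rv s).

Definition red_cons (d : D) (s : seq D) : seq D :=
  if s is d' :: s' then (if d' == rv d then s' else d :: s) else [:: d].

Definition wreduce (s : seq D) : seq D := foldr red_cons [::] s.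

Definition loop_at (v : V) (s : seq D) : bool := reducedw s && walk_from_to v s v.

Definition pi_mul (s t : seq D) : seq D := wreduce (s ++ t).

Definition pi_pow (s : seq D) (n : int) : seq D :=
  match n with
  | Posz n' => iter n' (pi_mul s) [::]
  | Negz n' => iter n'.+1 (pi_mul (inv_walk s)) [::]
  end.

Definition pi_conj (v : V) (a b : seq D) : Prop :=
  exists c, loop_at v c /\ b = wreduce (c ++ a ++ inv_walk c).

Definition pi_indivisible (v : V) (g : seq D) : Prop :=
  forall h (n : int), loop_at v h -> pi_pow h n = g -> n = 1%R \/ n = (-1)%R.

End SerreGraph.

Definition euler_char (V D : finType) : int :=
  (#|V|%:Z - (#|D| %/ 2)%:Z)%R.

(* Finite graph of spaces.                                            *)
(*  underlying graph  (VU, DU, revU, tgtU)                            *)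
(*  disjoint union of the vertex spaces (VV, DV, revV, tgtV), the     *)
(*    vertex space of v being the fibre of pV over v                  *)
(*  disjoint union of the edge spaces E_e, e in DU (EV, ED, revE,     *)
(*    tgtE), E_e being the fibre of pE over e; flip identifies E_e    *)
(*    with E_{\bar e} (this is "E = \bar E")                          *)
(*  tau restricted to E_e is tau_e : E_e -> V_{tgtU e}; the map       *)
(*    tau_{\bar e} on the same graph is tau o flip.                   *)
Unset Implicit Arguments.
Record gos := Gos {
  VU : finType; DU : finType; revU : DU -> DU; tgtU : DU -> VU;
  VV : finType; DV : finType; revV : DV -> DV; tgtV : DV -> VV; pV : VV -> VU;
  EV : finType; ED : finType; revE : ED -> ED; tgtE : ED -> EV; pE : EV -> DU;
  flipV : EV -> EV; flipD : ED -> ED;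
  tauV : EV -> VV; tauD : ED -> DV }.

Record is_2cgos (X : gos) : Prop := {
  u_serre : serre (revU X);
  u_nonempty : exists u : VU X, True;
  u_conn : connected_on (revU X) (tgtU X) (fun _ => True);
  v_serre : serre (revV X);
  v_fiber : forall d, pV X (tgtV X d) = pV X (tgtV X (revV X d));
  v_nonempty : forall u, exists x, pV X x = u;
  v_conn : forall u, connected_on (revV X) (tgtV X) (fun x => pV X x = u);
  e_serre : serre (revE X);
  e_fiber : forall y, pE X (tgtE X y) = pE X (tgtE X (revE X y));
  e_nonempty : forall e, exists x, pE X x = e;
  e_conn : forall e, connected_on (revE X) (tgtE X) (fun x => pE X x = e);
  flipV_inv : involutive (flipV X);
  flipD_inv : involutive (flipD X);
  flip_p : forall x, pE X (flipV X x) = revU X (pE X x);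
  flip_tgt : forall y, tgtE X (flipD X y) = flipV X (tgtE X y);
  flip_rev : forall y, revE X (flipD X y) = flipD X (revE X y);
  tau_p : forall x, pV X (tauV X x) = tgtU X (pE X x);
  tau_tgt : forall y, tgtV X (tauD X y) = tauV X (tgtE X y);
  tau_rev : forall y, revV X (tauD X y) = tauD X (revE X y);
  tau_imm : forall y1 y2, tgtE X y1 = tgtE X y2 -> tauD X y1 = tauD X y2 -> y1 = y2;
  two_cover : forall d : DV X, #|[set y | tauD X y == d]| = 2 }.

(* Horizontal subgraph Gamma(X): vertices VV, one dart x for each x in EV
   (x a vertex of E_e), going from tauV (flipV x) to tauV x; reversal flipV. *)
Definition hdeg (X : gos) (x : VV X) : nat := #|[set h : EV X | tauV X h == x]|.

Definition srcE (X : gos) (y : ED X) : EV X := tgtE X (revE X y).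

Definition hcircle_on (X : gos) (P : VV X -> Prop) : Prop :=
  [/\ exists x, P x, connected_on (flipV X) (tauV X) P
    & forall x, P x -> hdeg X x = 2].

(* Gamma(X) = Gamma_oo (colour None) |_| r_1 |_| ... |_| r_m (colour Some i):
   the colour classes are exactly the connected components. *)
Record horiz_decomp (X : gos) (m : nat) (c : VV X -> option 'I_m) : Prop := {
  hd_closed : forall x : EV X, c (tauV X (flipV X x)) = c (tauV X x);
  hd_nonempty : forall o, exists x, c x = o;
  hd_conn : forall o, connected_on (flipV X) (tauV X) (fun x => c x = o);
  hd_inf : ~ hcircle_on X (fun x => c x = None);
  hd_circ : forall i, hcircle_on X (fun x => c x = Some i) }.

(* the 2-cell y x [0,1] of X (an orbit of <revE, flipD>) *)
Definition cell (X : gos) (y : ED X) : seq (ED X) :=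
  [:: y; revE X y; flipD X y; flipD X (revE X y)].

(* s i = cyclic sequence of 2-cells y_0 ... y_(L-1) (oriented from the r_i
   side srcE y_j to the Gamma_oo side tgtE y_j) forming the mapping cylinder
   M_i: consecutive 2-cells share the vertical (radial) edge
   tauD y_j = tauD (flipD y_(j+1)).  The r_i-end map S^1 -> r_i is the closed
   walk map srcE (s i), a k_i-fold covering; the other end is the closed
   walk map tgtE (s i), an immersion into Gamma_oo.  Every 2-cell of X
   occurs exactly once in exactly one M_i. *)
Record mcyl_struct (X : gos) (m : nat) (c : VV X -> option 'I_m)
    (k : 'I_m -> nat) (s : 'I_m -> seq (ED X)) : Prop := {
  mc_k : forall i, 2 <= k i;
  mc_nonempty : forall i, s i != [::];
  mc_cycle : forall i, cycle (fun y y' => tauD X y == tauD X (flipD X y')) (s i);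
  mc_side : forall i y, y \in s i ->
      c (tauV X (srcE X y)) = Some i /\ c (tauV X (tgtE X y)) = None;
  mc_cover_imm : forall i, cyc_reducedw (flipV X) (map (srcE X) (s i));
  mc_cover_deg : forall i (x : EV X), c (tauV X x) = Some i ->
      count (fun h => (h == x) || (h == flipV X x)) (map (srcE X) (s i)) = k i;
  mc_attach_imm : forall i, cyc_reducedw (flipV X) (map (tgtE X) (s i));
  mc_cells : forall y : ED X,
      \sum_(i < m) count (fun z => z \in cell X y) (s i) = 1 }.

Definition represents (X : gos) (v0 : VV X) (g gam : seq (EV X)) : Prop :=
  exists p, is_walk (flipV X) (tauV X) v0 (p ++ g ++ inv_walk (flipV X) p)
            /\ gam = wreduce (flipV X) (p ++ g ++ inv_walk (flipV X) p).

(* Main.v *)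
Require Import Defs.
From Stdlib Require Import Classical.
From HB Require Import structures.
From mathcomp Require Import all_boot all_order all_algebra.
From mathcomp Require Import ring lra zify.
Set Implicit Arguments. Unset Strict Implicit. Unset Printing Implicit Defensive.
Import Order.TTheory GRing.Theory Num.Theory.

(** Let R be the union of the circles r_i and let P be the page graph: its vertices are the edges of
    the vertex spaces and its edges are the 2-cells, so P is the disjoint union of the core circles
    of the M_i. It carries a map a to Gamma_oo and a map b to R, and all these graphs are labelled
    by Gamma_U. A 2-cell f is at the same time an edge of an edge space, joining the horizontal
    edges b(f) and a(f). Edge spaces are connected by assumption, so only cycles have to be
    excluded.

    Injectivity. Circles have Euler characteristic 0, hence chi(Gamma_oo) = chi(Gamma_U).
    Connectedness of the vertex spaces, together with sliding chains from R to Gamma_oo through the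
    pages, makes the mapping cone of Gamma_oo -> Gamma_U exact in the middle ([exact_lift]).
    Counting dimensions, H_1(Gamma_oo; Q) injects ([h1_count]), and by Stallings folding so does
    pi_1(Gamma_oo) ([pi1_inj]).

    Folding. Vertices joined by a walk with trivial label are identified, both in Gamma(X) and in P,
    so that the quotients immerse in Gamma_U. Reduced walks in edge spaces stay reduced ([aD_glob],
    [bD_glob]), so it is enough that the folded edge spaces carry no rational cycle ([cell_forest]).
    Indivisibility and nonconjugacy survive as [bar_prim] and [bar_indep].

    Order. Let [in_V] and [in_E] be the cycle spaces of the folded vertex and edge spaces. Heads and
    tails embed the latter in the former, and injectivity on H_1 makes the boundary map onto [in_V]
    ([fill]). After leaves are trimmed from the folded R, circles remain. Each vertex of P over them
    gets the word read around its circle in the direction that is positive for the Magnus bi-order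
    of the free group; darts with equal labels preserve the order of these words ([lev_transport]).
    Matching lowest terms ([pivot_VE]) lets leading terms of cycles travel along the circles, and
    canonical representatives travel as a whole ([red_step]). Hence all vertices in the support of
    such a representative read one word. Being killed by a, a nonzero one has two of them over one
    vertex of Gamma_oo, against indivisibility and nonconjugacy ([parallel_eq],
    [circle_trivial]). *)

(** * Free reduction of words *)

Section FreeReduction.
Variables (D : eqType) (rv : D -> D).
Hypotheses (rvK : involutive rv) (rvN : forall d, rv d != d).

(** Equality in the group generated by the darts in which [rv d] is inverse to [d]. It is not
    restricted to closed walks, so paths can be cut and pasted freely. *)
Definition weq (s t : seq D) := wreduce rv s = wreduce rv t.

Lemma inv_walk_cons d s : inv_walk rv (d :: s) = rcons (inv_walk rv s) (rv d).
Proof. by rewrite /inv_walk /= rev_cons. Qed.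

Lemma inv_walk_cat s t : inv_walk rv (s ++ t) = inv_walk rv t ++ inv_walk rv s.
Proof. by rewrite /inv_walk map_cat rev_cat. Qed.

Lemma inv_walkK : involutive (inv_walk rv).
Proof. by move=> s; rewrite /inv_walk map_rev revK mapK. Qed.

Lemma reducedw_cons d s :
  reducedw rv (d :: s) = (if s is d' :: _ then d' != rv d else true) && reducedw rv s.
Proof. by case: s => //= d' s; rewrite andbC. Qed.

Lemma red_cons_reduced d s : reducedw rv s -> reducedw rv (red_cons rv d s).
Proof.
case: s => // d' s rs; rewrite /red_cons; case: eqP => [_|/eqP ne].
  by move: rs; rewrite reducedw_cons => /andP[].
by rewrite reducedw_cons ne.
Qed.

Lemma wreduce_reduced s : reducedw rv (wreduce rv s).
Proof. by elim: s => //= d s IH; apply: red_cons_reduced. Qed.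

Lemma wreduce_id s : reducedw rv s -> wreduce rv s = s.
Proof.
elim: s => // d s IH; rewrite reducedw_cons => /andP[h rs] /=.
by rewrite IH // /red_cons; case: s h {IH rs} => // d' s /negPf->.
Qed.

Lemma red_consK d s : reducedw rv s -> red_cons rv (rv d) (red_cons rv d s) = s.
Proof.
case: s => [|d' s] rs /=; first by rewrite rvK eqxx.
case: eqP => [e|ne] /=; last by rewrite rvK eqxx.
subst d'; case: s rs => //= d2 s /andP[ne _].
by rewrite (negPf ne).
Qed.

(* Every congruence containing the elementary cancellations contains reduction. *)
Lemma wreduce_ind (R : seq D -> seq D -> Prop) :
  (forall s, R s s) -> (forall s t u, R s t -> R t u -> R s u) ->
  (forall d s t, R s t -> R (d :: s) (d :: t)) ->
  (forall d s, R (d :: rv d :: s) s) -> forall s, R s (wreduce rv s).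
Proof.
move=> Rr Rt Rc Rd; elim=> //= d s IH; apply: Rt (Rc _ _ _ IH) _.
rewrite /red_cons; case: (wreduce rv s) => // d' s'.
by case: eqP => [->|_].
Qed.

(** The van der Waerden argument: letters act on reduced words by invertible maps ([red_consK]), so
    the action of a word depends only on its reduction. This is what makes [weq] a congruence. *)
Lemma foldr_red r s : reducedw rv r ->
  foldr (red_cons rv) r (wreduce rv s) = foldr (red_cons rv) r s.
Proof.
move=> rr.
have rf t : reducedw rv (foldr (red_cons rv) r t).
  by elim: t => //= d t; apply: red_cons_reduced.
elim: s => //= d s IH; rewrite -{}IH.
case: (wreduce rv s) => // d' t /=; case: eqP => // ->.
by rewrite -{1}[d]rvK red_consK.
Qed.

Lemma wreduce_cat s t :
  wreduce rv (s ++ t) = foldr (red_cons rv) (wreduce rv t) s.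
Proof. by rewrite /wreduce foldr_cat. Qed.

Lemma weq_refl s : weq s s. Proof. by []. Qed.
Lemma weq_sym s t : weq s t -> weq t s. Proof. by []. Qed.
Lemma weq_trans t s u : weq s t -> weq t u -> weq s u.
Proof. by move=> h1 h2; rewrite /weq h1. Qed.

Lemma weq_red s : weq (wreduce rv s) s.
Proof. by rewrite /weq wreduce_id ?wreduce_reduced. Qed.

Lemma weq_cat s s' t t' : weq s s' -> weq t t' -> weq (s ++ t) (s' ++ t').
Proof.
rewrite /weq !wreduce_cat => e1 ->.
by rewrite -foldr_red ?wreduce_reduced // e1 foldr_red ?wreduce_reduced.
Qed.

Lemma weq_catl s t t' : weq t t' -> weq (s ++ t) (s ++ t').
Proof. exact: weq_cat. Qed.
Lemma weq_catr s s' t : weq s s' -> weq (s ++ t) (s' ++ t).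
Proof. by move=> h; apply: weq_cat. Qed.

Lemma weq_cons d s t : weq s t -> weq (d :: s) (d :: t).
Proof. exact: (@weq_catl [:: d]). Qed.

Lemma weq_cancel d s : weq (d :: rv d :: s) s.
Proof.
rewrite /weq /= -{1}[d]rvK red_consK //; exact: wreduce_reduced.
Qed.

Lemma weq_invr s : weq (s ++ inv_walk rv s) [::].
Proof.
elim: s => //= d s IH; rewrite inv_walk_cons -rcons_cat -cats1.
apply: weq_trans (weq_cons d (weq_catr _ IH)) _; exact: weq_cancel.
Qed.

Lemma weq_invl s : weq (inv_walk rv s ++ s) [::].
Proof. by rewrite -{2}[s]inv_walkK; apply: weq_invr. Qed.

Lemma weq_inv s t : weq s t -> weq (inv_walk rv s) (inv_walk rv t).
Proof.
move=> e; have h1 : weq (inv_walk rv s ++ t) [::].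
  by apply: weq_trans (weq_catl _ (weq_sym e)) (weq_invl s).
apply: (@weq_trans (inv_walk rv s ++ (t ++ inv_walk rv t))).
  by rewrite -{1}[inv_walk rv s]cats0; apply: weq_catl; apply: weq_sym; apply: weq_invr.
by rewrite catA; apply: weq_catr h1.
Qed.

Lemma weq_catIl r s t : weq (r ++ s) (r ++ t) -> weq s t.
Proof.
have h u : weq (inv_walk rv r ++ r ++ u) u by rewrite catA; apply: (weq_catr u (weq_invl r)).
move=> e; apply: weq_trans (weq_sym (h s)) _; apply: weq_trans (weq_catl _ e) (h t).
Qed.

Lemma weq_catIr r s t : weq (s ++ r) (t ++ r) -> weq s t.
Proof.
have h u : weq ((u ++ r) ++ inv_walk rv r) u.
  by rewrite -catA -{2}[u]cats0; apply: weq_catl (weq_invr r).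
move=> e; apply: weq_trans (weq_sym (h s)) _; apply: weq_trans (weq_catr _ e) (h t).
Qed.

Definition wpow (s : seq D) n := flatten (nseq n s).

Lemma wpowS s n : wpow s n.+1 = s ++ wpow s n. Proof. by []. Qed.

Lemma wpowD s m n : wpow s (m + n) = wpow s m ++ wpow s n.
Proof. by rewrite /wpow nseqD flatten_cat. Qed.

Lemma wpowSr s n : wpow s n.+1 = wpow s n ++ s.
Proof. by rewrite -addn1 wpowD /wpow /= cats0. Qed.

Lemma weq_pow s t n : weq s t -> weq (wpow s n) (wpow t n).
Proof. by move=> e; elim: n => // n IH; rewrite !wpowS; apply: weq_cat. Qed.

Lemma weq_conj_pow c s n :
  weq (wpow (c ++ s ++ inv_walk rv c) n) (c ++ wpow s n ++ inv_walk rv c).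
Proof.
elim: n => [|n IH]; first by apply: weq_sym; apply: weq_invr.
rewrite !wpowS; apply: weq_trans (weq_catl _ IH) _.
rewrite -!catA; do 2!apply: weq_catl.
by rewrite !catA; apply: (weq_catr _ (weq_catr _ (weq_invl c))).
Qed.

Lemma inv_wpow s n : inv_walk rv (wpow s n) = wpow (inv_walk rv s) n.
Proof. by elim: n => // n IH; rewrite wpowS inv_walk_cat IH wpowSr. Qed.

Definition wzpow (s : seq D) (n : int) :=
  match n with Posz k => wpow s k | Negz k => wpow (inv_walk rv s) k.+1 end.

Lemma weq_pi_pow s n : weq (pi_pow rv s n) (wzpow s n).
Proof.
have h t k : weq (iter k (Defs.pi_mul rv t) [::]) (wpow t k).
  elim: k => // k IH; rewrite iterS wpowS /Defs.pi_mul.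
  by apply: weq_trans (weq_red _) (weq_catl _ IH).
by case: n => k; rewrite /pi_pow /wzpow; apply: h.
Qed.

Lemma pi_pow_reduced s n : reducedw rv (pi_pow rv s n).
Proof. by case: n => [[|k]|k] //=; apply: wreduce_reduced. Qed.

End FreeReduction.

(* Words are mapped letterwise to words; inverse letters to inverse words. *)
Lemma weq_hom (D D' : eqType) (rv : D -> D) (rv' : D' -> D') (rvK : involutive rv)
    (rvK' : involutive rv') (f : D -> seq D') s t :
  (forall d, weq rv' (f (rv d)) (inv_walk rv' (f d))) ->
  weq rv s t -> weq rv' (flatten (map f s)) (flatten (map f t)).
Proof.
move=> hf e.
have h u : weq rv' (flatten (map f u)) (flatten (map f (wreduce rv u))).
  apply: (@wreduce_ind _ _
    (fun u v => weq rv' (flatten (map f u)) (flatten (map f v))))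
    => {u}[u|u v w|d u v|d u] //=.
  - exact: weq_trans.
  - exact: weq_catl.
  rewrite catA; apply: (@weq_catr _ _ rvK' _ [::]).
  by apply: weq_trans (weq_catl rvK' _ (hf d)) (weq_invr rvK' _).
by apply: weq_trans (h s) _; rewrite e; apply: weq_sym; apply: h.
Qed.

Lemma weq_map (D D' : eqType) (rv : D -> D) (rv' : D' -> D') (rvK : involutive rv)
    (rvK' : involutive rv') (f : D -> D') s t :
  {morph f : d / rv d >-> rv' d} ->
  weq rv s t -> weq rv' (map f s) (map f t).
Proof.
move=> hf e; have h u : map f u = flatten (map (fun d => [:: f d]) u).
  by elim: u => //= d u ->.
rewrite !h; apply: (weq_hom rvK rvK') e => d; by rewrite hf.
Qed.

Lemma inv_walk_map (D D' : eqType) (rv : D -> D) (rv' : D' -> D') (f : D -> D') s :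
  {morph f : d / rv d >-> rv' d} -> map f (inv_walk rv s) = inv_walk rv' (map f s).
Proof.
by move=> hf; rewrite /inv_walk map_rev -!map_comp; congr rev; apply: eq_map => d /=.
Qed.

Lemma wpow_map (D D' : eqType) (f : D -> D') s n : map f (wpow s n) = wpow (map f s) n.
Proof. by elim: n => // n IH; rewrite !wpowS map_cat IH. Qed.

(** * Walks in Serre graphs *)

Section Walks.
Variables (V D : eqType) (rv : D -> D) (tg : D -> V).
Hypothesis (rvK : involutive rv).
Local Notation walk := (walk_from_to rv tg).

Lemma walk0 u v : walk u [::] v = (u == v).
Proof. by []. Qed.

Lemma walk_cons u d s v : walk u (d :: s) v = (tg (rv d) == u) && walk (tg d) s v.
Proof. by rewrite /walk_from_to /= andbA. Qed.

Lemma walk_cat u s t w :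
  walk u (s ++ t) w = walk u s (wend tg u s) && walk (wend tg u s) t w.
Proof.
elim: s u => [|d s IH] u; first by rewrite walk0 eqxx.
by rewrite cat_cons !walk_cons IH /wend /= andbA.
Qed.

Lemma walk_wend u s v : walk u s v -> wend tg u s = v.
Proof. by case/andP => _ /eqP. Qed.

Lemma walk_catI u s v t w : walk u s v -> walk v t w -> walk u (s ++ t) w.
Proof. by move=> hs ht; rewrite walk_cat (walk_wend hs) hs. Qed.

Lemma walk_catP u s t w : walk u (s ++ t) w -> exists2 v, walk u s v & walk v t w.
Proof. by rewrite walk_cat => /andP[h1 h2]; exists (wend tg u s). Qed.

Lemma walk1 d : walk (tg (rv d)) [:: d] (tg d).
Proof. by rewrite walk_cons walk0 !eqxx. Qed.

Lemma walk_inv u s v : walk u s v -> walk v (inv_walk rv s) u.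
Proof.
elim: s u => [|d s IH] u; first by rewrite !walk0 eq_sym.
rewrite walk_cons => /andP[/eqP<- /IH h]; rewrite inv_walk_cons -cats1.
by apply: walk_catI h _; rewrite -{1}[d]rvK walk1.
Qed.

Lemma walk_pow u s n : walk u s u -> walk u (wpow s n) u.
Proof.
by move=> h; elim: n => [|n IH]; [rewrite walk0 | rewrite wpowS (walk_catI h)].
Qed.

Lemma walk_zpow u s n : walk u s u -> walk u (wzpow rv s n) u.
Proof. by move=> h; case: n => n; apply: walk_pow => //; apply: walk_inv. Qed.

Lemma walk_red u s v : walk u s v -> walk u (wreduce rv s) v.
Proof.
elim: s u => //= d s IH u; rewrite walk_cons => /andP[/eqP<- /IH {IH}].
case: (wreduce rv s) => [|d' t]; first by rewrite walk0 => /eqP<-; apply: walk1.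
rewrite /red_cons; case: eqP => [->|_]; rewrite walk_cons ?rvK.
  by case/andP.
by move=> h; rewrite walk_cons eqxx walk_cons.
Qed.

End Walks.

Lemma walk_map (V D V' D' : eqType) (rv : D -> D) (tg : D -> V) (rv' : D' -> D')
    (tg' : D' -> V') (f : D -> D') (g : V -> V') u s v :
  {morph f : d / rv d >-> rv' d} -> (forall d, tg' (f d) = g (tg d)) ->
  walk_from_to rv tg u s v -> walk_from_to rv' tg' (g u) (map f s) (g v).
Proof.
move=> hr ht; elim: s u => [|d s IH] u; first by rewrite !walk0 => /eqP->.
by rewrite /= !walk_cons -hr !ht => /andP[/eqP-> /IH->]; rewrite eqxx.
Qed.

(** * Rational chains and their pushforwards *)

Section Push.
Local Open Scope ring_scope.

Definition delta (T : eqType) (a : T) : T -> rat := fun x => (a == x)%:R.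

(** Pushforward of chains. Along the target map, on a function on darts that is odd under reversal,
    it is the boundary operator: the two darts of an edge contribute with opposite signs. *)
Definition push (A B : finType) (f : A -> B) (w : A -> rat) : B -> rat :=
  fun b => \sum_(a | f a == b) w a.

Lemma push_ext (A B : finType) (f : A -> B) w w' : w =1 w' -> push f w =1 push f w'.
Proof. by move=> e b; apply: eq_bigr => a _. Qed.

Lemma push_comp (A B C : finType) (f : A -> B) (g : B -> C) w :
  push g (push f w) =1 push (g \o f) w.
Proof.
move=> c; rewrite /push (partition_big f (fun b => g b == c)) //=.
apply: eq_bigr => b /eqP gb; apply: eq_bigl => a.
by case: eqP => [->|]; rewrite ?gb ?eqxx ?andbF.
Qed.

Lemma push_fun (A B : finType) (f g : A -> B) w : f =1 g -> push f w =1 push g w.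
Proof. by move=> e b; apply: eq_bigl => a; rewrite e. Qed.

Lemma pushD (A B : finType) (f : A -> B) w w' b :
  push f (fun a => w a + w' a) b = push f w b + push f w' b.
Proof. exact: big_split. Qed.

Lemma pushN (A B : finType) (f : A -> B) w b : push f (fun a => - w a) b = - push f w b.
Proof. exact: sumrN. Qed.

Lemma pushZ (A B : finType) (f : A -> B) c w b :
  push f (fun a => c * w a) b = c * push f w b.
Proof. by rewrite /push mulr_sumr. Qed.

Lemma push0 (A B : finType) (f : A -> B) w b :
  (forall a, f a = b -> w a = 0) -> push f w b = 0.
Proof. by move=> h; apply: big1 => a /eqP; apply: h. Qed.

Lemma push_sum (A B I : finType) (f : A -> B) (c : I -> rat) (w : I -> A -> rat) b :
  push f (fun a => \sum_i c i * w i a) b = \sum_i c i * push f (w i) b.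
Proof.
rewrite /push exchange_big /=; apply: eq_bigr => i _; by rewrite mulr_sumr.
Qed.

Lemma sum_delta (T : finType) (P : pred T) (a : T) : \sum_(x | P x) delta a x = (P a)%:R.
Proof.
rewrite /delta; case Pa: (P a).
  rewrite (bigD1 a) //= eqxx big1 ?addr0 // => x /andP[_ ne].
  by rewrite eq_sym (negPf ne).
by rewrite big1 // => x Px; case: eqP => // e; rewrite e Px in Pa.
Qed.

Lemma push_delta (A B : finType) (f : A -> B) a : push f (delta a) =1 delta (f a).
Proof. by move=> b; rewrite /push sum_delta. Qed.

Lemma push_single (A B : finType) (f : A -> B) w a :
  (forall a', f a' = f a -> w a' != 0 -> a' = a) -> push f w (f a) = w a.
Proof.
move=> h; rewrite /push (bigD1 a) //= big1 ?addr0 // => a' /andP[/eqP e ne].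
by apply/eqP; apply: contraNT ne => w0; apply/eqP; apply: h.
Qed.

Lemma sum_coords (T : finType) (w : T -> rat) x : \sum_a w a * delta a x = w x.
Proof.
rewrite (bigD1 x) //= /delta eqxx mulr1 big1 ?addr0 // => a ne.
by rewrite (negPf ne) mulr0.
Qed.

End Push.

Section Chains.
Local Open Scope ring_scope.
Variables (D : finType) (rv : D -> D).
Hypotheses (rvK : involutive rv).

Definition anti (w : D -> rat) := forall d, w (rv d) = - w d.

(** The 1-chain traced by a walk; opposite traversals cancel, so it depends only on the class under
    [weq] ([chain_weq]). *)
Definition chain (s : seq D) : D -> rat :=
  fun d => (count_mem d s)%:R - (count_mem (rv d) s)%:R.

Lemma chain_nil d : chain [::] d = 0.
Proof. by rewrite /chain /= subrr. Qed.

Lemma chain_cons d s x : chain (d :: s) x = delta d x - delta (rv d) x + chain s x.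
Proof.
rewrite /chain /delta /= !natrD.
rewrite (_ : (d == rv x) = (rv d == x)); first by ring.
by apply/eqP/eqP => [->|<-]; rewrite rvK.
Qed.

Lemma chain_anti s : anti (chain s).
Proof. by move=> d; rewrite /chain rvK opprB. Qed.

Lemma chain_cat s t d : chain (s ++ t) d = chain s d + chain t d.
Proof. by rewrite /chain !count_cat !natrD; ring. Qed.

Lemma chain_inv s d : chain (inv_walk rv s) d = - chain s d.
Proof.
rewrite /chain /inv_walk !count_rev !count_map opprB.
congr (_%:R - _%:R); apply: eq_count => x /=.
  by apply/eqP/eqP => [<-|->]; rewrite rvK.
exact: (inj_eq (can_inj rvK)).
Qed.

Lemma chain_wpow s n d : chain (wpow s n) d = n%:R * chain s d.
Proof.
elim: n => [|n IH]; first by rewrite chain_nil mul0r.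
by rewrite wpowS chain_cat IH mulrSr; ring.
Qed.

Lemma chain_wzpow s n d : chain (wzpow rv s n) d = n%:~R * chain s d.
Proof.
case: n => n; rewrite /wzpow chain_wpow ?chain_inv //.
by rewrite NegzE mulrNz; ring.
Qed.

Lemma chain_weq s t : weq rv s t -> chain s =1 chain t.
Proof.
have h u : chain u =1 chain (wreduce rv u).
  apply: (@wreduce_ind _ _ (fun u v => chain u =1 chain v)) => {u} //.
  - by move=> u v w h1 h2 x; rewrite h1.
  - by move=> d u v e x; rewrite !chain_cons e.
  by move=> d u x; rewrite !chain_cons rvK; ring.
by move=> e x; rewrite h e -h.
Qed.

Lemma anti0 : anti (fun _ => 0).
Proof. by move=> d; rewrite oppr0. Qed.

Lemma antiD w w' : anti w -> anti w' -> anti (fun d => w d + w' d).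
Proof. by move=> h h' d; rewrite h h' opprD. Qed.

Lemma antiB w w' : anti w -> anti w' -> anti (fun d => w d - w' d).
Proof. by move=> h h' d; rewrite h h' opprB addrC opprK. Qed.

Lemma antiZ c w : anti w -> anti (fun d => c * w d).
Proof. by move=> h d; rewrite h mulrN. Qed.

Lemma anti_sum (I : finType) (c : I -> rat) (w : I -> D -> rat) :
  (forall i, anti (w i)) -> anti (fun d => \sum_i c i * w i d).
Proof.
by move=> h d; rewrite -sumrN; apply: eq_bigr => i _; rewrite h mulrN.
Qed.

Lemma anti_delta d : anti (fun x => delta d x - delta (rv d) x).
Proof.
move=> x; have := chain_anti [:: d] x.
by rewrite !chain_cons !chain_nil !addr0.
Qed.

Lemma bd_chain (V : finType) (tg : D -> V) u s v x : walk_from_to rv tg u s v ->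
  push tg (chain s) x = delta v x - delta u x.
Proof.
elim: s u => [|d s IH] u.
  by rewrite walk0 => /eqP->; rewrite subrr push0 // => *; apply: chain_nil.
rewrite walk_cons => /andP[/eqP<- /IH h].
rewrite (push_ext tg (chain_cons d s)) pushD h pushD pushN !push_delta; ring.
Qed.

Lemma anti_push (D' : finType) (rv' : D' -> D') (f : D -> D') w :
  involutive rv' -> {morph f : d / rv d >-> rv' d} -> anti w ->
  forall d, push f w (rv' d) = - push f w d.
Proof.
move=> rvK' hf aw d; rewrite /push -sumrN (reindex_inj (can_inj rvK)) /=.
apply: eq_big => [a|a _]; last exact: aw.
by rewrite hf (inj_eq (can_inj rvK')).
Qed.

End Chains.

Lemma push_chain (D D' : finType) (rv : D -> D) (rv' : D' -> D') (f : D -> D') s :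
  involutive rv -> involutive rv' -> {morph f : d / rv d >-> rv' d} ->
  push f (chain rv s) =1 chain rv' (map f s).
Proof.
move=> rvK rvK' hf x; elim: s => [|d s IH].
  by rewrite push0 => [|*]; rewrite /= chain_nil.
rewrite /= chain_cons // -IH (push_ext f (chain_cons rvK d s)) !pushD pushN.
by rewrite !push_delta hf.
Qed.

(** * Dimension counts, orthogonal projection and leading terms *)

Section LinearAlgebra.
Local Open Scope ring_scope.

Lemma sum_rank (T : finType) (F : 'I_#|T| -> rat) :
  \sum_i F i = \sum_(x : T) F (enum_rank x).
Proof.
by rewrite (reindex (@enum_rank T)) //=; apply/onW_bij/enum_rank_bij.
Qed.

Lemma dependency (A B : finType) (M : B -> A -> rat) : (#|A| < #|B|)%N ->
  exists c : B -> rat, (exists b, c b != 0) /\ forall a, \sum_b c b * M b a = 0.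
Proof.
move=> lt; pose N := \matrix_(i < #|B|, j < #|A|) M (enum_val i) (enum_val j).
have /rowV0Pn[v sv v0] : kermx N != 0.
  rewrite -mxrank_eq0 mxrank_ker -lt0n subn_gt0.
  exact: leq_ltn_trans (rank_leq_col _) lt.
exists (fun b => v 0 (enum_rank b)); split.
  have /existsP[i vi] : [exists i, v 0 i != 0].
    apply: contraNT v0; rewrite negb_exists => /forallP h.
    by apply/eqP/rowP => i; rewrite mxE; apply/eqP; move: (h i); rewrite negbK.
  by exists (enum_val i); rewrite enum_valK.
move=> a; have /sub_kermxP/rowP/(_ (enum_rank a)) := sv.
rewrite !mxE => h; rewrite -[RHS]h sum_rank.
by apply: eq_bigr => b _; rewrite !mxE !enum_rankK.
Qed.

(** The hypothesis is exactness of I -> J -> K in the middle, so #|J| - rank G is at most rank F.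
    The ranks are at most #|K| and #|I|; in the extreme case the rows of F are independent. *)
Lemma exact_count (I J K : finType) (F : I -> J -> rat) (G : J -> K -> rat) :
  (forall y : J -> rat, (forall k, \sum_j y j * G j k = 0) ->
     exists x : I -> rat, forall j, y j = \sum_i x i * F i j) ->
  (#|J| <= #|I| + #|K|)%N /\
  ((#|I| + #|K| <= #|J|)%N -> forall x : I -> rat,
     (forall j, \sum_i x i * F i j = 0) -> forall i, x i = 0).
Proof.
move=> ex.
pose M := \matrix_(i < #|I|, j < #|J|) F (enum_val i) (enum_val j).
pose N := \matrix_(j < #|J|, k < #|K|) G (enum_val j) (enum_val k).
have sub : (kermx N <= M)%MS.
  apply/rV_subP => v /sub_kermxP vN.
  case: (ex (fun j => v 0 (enum_rank j))) => [k|x hx].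
    move/rowP/(_ (enum_rank k)): vN; rewrite !mxE => h.
    rewrite -[RHS]h sum_rank; apply: eq_bigr => j _.
    by rewrite !mxE !enum_rankK.
  apply/submxP; exists (\row_i x (enum_val i)); apply/rowP => j.
  have := hx (enum_val j); rewrite enum_valK => ->; rewrite mxE.
  rewrite sum_rank; apply: eq_bigr => i _.
  by rewrite !mxE !enum_rankK.
have r1 := mxrankS sub; rewrite mxrank_ker in r1.
have r2 := rank_leq_col N; have r3 := rank_leq_row M.
split; first lia.
move=> le x hx i.
have fr : row_free M by rewrite /row_free; apply/eqP; lia.
have /(row_free_inj fr)/rowP/(_ (enum_rank i)) : (\row_i x (enum_val i)) *m M = 0 *m M.
  rewrite mul0mx; apply/rowP => j; rewrite !mxE -[RHS](hx (enum_val j)).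
  rewrite sum_rank; apply: eq_bigr => i' _.
  by rewrite !mxE !enum_rankK.
by rewrite !mxE enum_rankK.
Qed.

Definition subsp (I : Type) (H : (I -> rat) -> Prop) :=
  [/\ forall x y, H x -> x =1 y -> H y, H (fun _ => 0)
    & forall a x y, H x -> H y -> H (fun i => a * x i + y i)].

Lemma subsp_sum (I : Type) (H : (I -> rat) -> Prop) (B : finType) (c : B -> rat) X :
  subsp H -> (forall b, H (X b)) -> H (fun i => \sum_b c b * X b i).
Proof.
move=> [He H0 Hl] HX.
have h (r : seq B) : H (fun i => \sum_(b <- r) c b * X b i).
  elim: r => [|b r IH]; first by apply: He H0 _ => i; rewrite big_nil.
  by apply: He (Hl (c b) _ _ (HX b) IH) _ => i; rewrite big_cons.
exact: h.
Qed.

Lemma subspB (I : Type) (H : (I -> rat) -> Prop) x y :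
  subsp H -> H x -> H y -> H (fun i => x i - y i).
Proof.
move=> [He _ Hl] hx hy; apply: He (Hl (-1) _ _ hy hx) _ => i; ring.
Qed.

(** Orthogonal projection onto [H] for the form that sees only the coordinates in [P], by
    Gram-Schmidt on one coordinate at a time, without choosing a basis of [H]. *)
Lemma projection (I : eqType) (P : seq I) (H : (I -> rat) -> Prop) (v : I -> rat) :
  subsp H -> exists2 z, H z &
    forall z', H z' -> \sum_(p <- P) (v p - z p) * z' p = 0.
Proof.
elim: P H v => [|p0 P IH] H v sH.
  by case: (sH) => _ H0 _; exists (fun _ => 0) => // z' _; rewrite big_nil.
case: (classic (exists2 h, H h & h p0 != 0)) => [[h Hh h0]|no]; last first.
  case: (IH H v sH) => z Hz zP; exists z => // z' Hz'; rewrite big_cons zP // addr0.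
  suff -> : z' p0 = 0 by rewrite mulr0.
  by apply/eqP/negPn/negP => ne; apply: no; exists z'.
pose H0 z := H z /\ z p0 = 0.
case: (sH) => He Hz0 Hl.
have sH0 : subsp H0.
  split=> [x y [hx x0] e||a x y [hx x0] [hy y0]].
  - by split; [apply: He hx e | rewrite -e].
  - by split.
  - by split; [apply: Hl | rewrite x0 y0 mulr0 addr0].
(* Make [h] orthogonal to the hyperplane [H0] of [H]. Since [h'] still has a nonzero entry at [p0],
   its length is positive and the last coefficient [t] can be solved for. *)
case: (IH H0 h sH0) => g [Hg g0] gP.
pose h' i := h i - g i.
have Hh' : H h' by apply: subspB.
have h'0 : h' p0 != 0 by rewrite /h' g0 subr0.
case: (IH H0 v sH0) => z1 [Hz1 z10] z1P.
pose ip (x y : I -> rat) := \sum_(p <- p0 :: P) x p * y p.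
have hh : 0 < ip h' h'.
  rewrite /ip big_cons ltr_pwDl ?sumr_ge0 // => [|i _]; last by rewrite -expr2 sqr_ge0.
  by rewrite -expr2 exprn_even_gt0.
pose t := ip (fun p => v p - z1 p) h' / ip h' h'.
exists (fun i => t * h' i + z1 i); first exact: Hl.
move=> z' Hz'.
pose q := z' p0 / h' p0; pose u i := z' i - q * h' i.
have Hu : H0 u.
  split; last by rewrite /u /q mulfVK // subrr.
  apply: He (Hl (- q) _ _ Hh' Hz') _ => i; rewrite /u; ring.
have e1 : ip (fun p => v p - z1 p) u = 0.
  by rewrite /ip big_cons (z1P _ Hu) Hu.2 mulr0 addr0.
have e2 : ip h' u = 0 by rewrite /ip big_cons (gP _ Hu) Hu.2 mulr0 addr0.
have lin (x y : I -> rat) c : ip x (fun i => u i + c * y i) = ip x u + c * ip x y.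
  rewrite /ip mulr_sumr -big_split; apply: eq_bigr => i _ /=; ring.
have -> : \sum_(p <- p0 :: P) (v p - (t * h' p + z1 p)) * z' p =
   ip (fun p => v p - z1 p) (fun i => u i + q * h' i) - t * ip h' (fun i => u i + q * h' i).
  rewrite /ip mulr_sumr -sumrB; apply: eq_bigr => i _; rewrite /u; ring.
by rewrite !lin e1 e2 /t; field; rewrite gt_eqF.
Qed.

Section Levels.
Variables (I : finType) (lev : I -> nat) (H : (I -> rat) -> Prop).
Hypothesis sH : subsp H.

Definition above n (z : I -> rat) := H z /\ forall i, (lev i < n)%N -> z i = 0.

(* The canonical representative of an element of [above n] with prescribed
   restriction to level [n]. *)
Definition reduced n (y : I -> rat) := above n y /\
  forall m z, (n < m)%N -> above m z -> \sum_(i | lev i == m) y i * z i = 0.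

Lemma subsp_above n : subsp (above n).
Proof.
case: (sH) => He H0 Hl; split=> [x y [hx x0] e||a x y [hx x0] [hy y0]]; split=> //.
- exact: He hx e.
- by move=> i li; rewrite -e x0.
- exact: Hl.
- by move=> i li; rewrite x0 // y0 // mulr0 addr0.
Qed.

Lemma aboveW n m z : (m <= n)%N -> above n z -> above m z.
Proof. by move=> le [h z0]; split=> // i li; apply: z0; apply: leq_trans le. Qed.

(** Subtract projections onto [above m] for m = n+1, n+2, ... in turn; each correction leaves the
    lower levels untouched, so orthogonality already achieved there persists. *)
Lemma reduced_exists n z : above n z ->
  exists2 y, reduced n y & forall i, lev i = n -> y i = z i.
Proof.
move=> az.
have h k : exists2 y, above n y & (forall i, lev i = n -> y i = z i) /\
   forall m u, (n < m <= n + k)%N -> above m u -> \sum_(i | lev i == m) y i * u i = 0.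
  elim: k => [|k [y ay [ey oy]]]; first by exists z => //; split=> // m u; lia.
  case: (projection (enum [pred i | lev i == (n + k.+1)%N]) y (subsp_above (n + k.+1))).
  move=> p ap op; exists (fun i => y i - p i); last split.
  - apply: subspB => //; first exact: subsp_above.
    by apply: aboveW ap; lia.
  - by move=> i li; rewrite ap.2 ?subr0 ?ey //; lia.
  move=> m u lm am; case: (ltnP m (n + k.+1)) => lt.
    rewrite -[RHS](oy m u _ am); last lia.
    by apply: eq_bigr => i /eqP li; rewrite ap.2 ?subr0 //; lia.
  have em : m = (n + k.+1)%N by lia.
  by move: (op u); rewrite -em => /(_ am); rewrite big_enum.
case: (h (\max_i lev i)) => y ay [ey oy]; exists y => //; split=> // m u lm am.
case: (leqP m (n + \max_i lev i)) => le; first by apply: oy => //; lia.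
rewrite big_pred0 // => i; apply/negbTE.
have := @leq_bigmax _ lev i; lia.
Qed.

(** At the first level above [n] where the two could differ, their difference belongs to the space
    to which both are orthogonal, hence is orthogonal to itself there. *)
Lemma reduced_uniq n y y' : reduced n y -> reduced n y' ->
  (forall i, lev i = n -> y i = y' i) -> y =1 y'.
Proof.
move=> [ay oy] [ay' oy'] e.
have h k : forall i, (lev i < n + k)%N -> y i = y' i.
  elim: k => [|k IH] i li; first by rewrite ay.2 ?ay'.2 //; lia.
  case: (ltnP (lev i) (n + k)) => l2; first exact: IH.
  case: k IH li l2 => [|k] IH li l2; first by apply: e; lia.
  pose d i := y i - y' i.
  have ad : above (n + k.+1) d.
    split; first by apply: subspB => //; [case: ay | case: ay'].
    by move=> j lj; rewrite /d IH // subrr.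
  have o : \sum_(i | lev i == (n + k.+1)%N) d i * d i = 0.
    have lt : (n < n + k.+1)%N by lia.
    transitivity (\sum_(i | lev i == (n + k.+1)%N) y i * d i -
                  \sum_(i | lev i == (n + k.+1)%N) y' i * d i).
      rewrite -sumrB; apply: eq_bigr => j _; rewrite /d; ring.
    by rewrite (oy _ _ lt ad) (oy' _ _ lt ad) subrr.
  have : d i * d i = 0 by apply: psumr_eq0P o _ _ => [j _|]; [rewrite -expr2 sqr_ge0 | lia].
  by move/eqP; rewrite mulf_eq0 orbb subr_eq0 => /eqP.
move=> i; apply: (h (lev i).+1); lia.
Qed.

End Levels.

(** The vectors chosen for [B] have triangular images under [F], while [F x] is zero as soon as [x]
    vanishes on [A]. If [B] were larger, a nontrivial combination of these vectors would vanish on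
    [A]. *)
Lemma pivot_count (I J K : finType) (H : (I -> rat) -> Prop) (F : (I -> rat) -> J -> rat)
    (rho : J -> nat) (e : K -> I) (A : {set K}) (B : {set J}) :
  subsp H -> injective rho ->
  (forall (c : J -> rat) X j,
     F (fun i => \sum_b c b * X b i) j = \sum_b c b * F (X b) j) ->
  (forall x, H x -> (forall a, a \in A -> x (e a) = 0) -> forall j, F x j = 0) ->
  (forall b, b \in B -> exists x, [/\ H x, F x b != 0
      & forall b', b' \in B -> (rho b' < rho b)%N -> F x b' = 0]) ->
  (#|B| <= #|A|)%N.
Proof.
move=> sH inj Flin det piv; rewrite leqNgt; apply/negP => lt.
have /fin_all_exists[X hX] : forall b : J, exists x, H x /\ (b \in B -> F x b != 0 /\
     forall b', b' \in B -> (rho b' < rho b)%N -> F x b' = 0).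
  move=> b; case: (boolP (b \in B)) => [/piv[x [h1 h2 h3]]|_]; first by exists x.
  by case: sH => _ H0 _; exists (fun _ => 0).
pose TA := {a : K | a \in A}; pose TB := {b : J | b \in B}.
have [|c [[b0 cb0] hc]] := @dependency TA TB (fun b a => X (val b) (e (val a))).
  by rewrite !card_sig (eq_card (B := mem A)) ?(@eq_card _ [pred b | b \in B] B) // => ?; rewrite inE.
pose c' b := if insub b is Some b' then c b' else 0.
pose x i := \sum_b c' b * X b i.
have sumE (f : J -> rat) : \sum_b c' b * f b = \sum_(b : TB) c b * f (val b).
  rewrite (bigID (mem B)) /= [X in _ + X]big1 ?addr0 => [|b nb]; last first.
    by rewrite /c' insubF ?mul0r //; apply/negbTE.
  rewrite [LHS](reindex_omap (val : TB -> J) insub) => [|b bB]; last first.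
    by rewrite insubT.
  apply: eq_big => [b|b _]; last by rewrite /c' valK.
  by rewrite valK eqxx (valP b).
have Hx : H x by apply: subsp_sum => // b; case: (hX b).
have Fx j : F x j = 0.
  by apply: det => // a aA; rewrite /x sumE; apply: (hc (exist _ a aA)).
(* The lowest pivot occurring with a nonzero coefficient cannot be cancelled by the others. *)
have [b cb bmin] := @arg_minnP _ b0 (fun b => c b != 0) (fun b => rho (val b)) cb0.
have [Fb _] := (hX (val b)).2 (valP b).
have := Fx (val b); rewrite Flin sumE (bigD1 b) //= big1 ?addr0 => [|b' ne].
  by move/eqP; rewrite mulf_eq0 (negPf cb) (negPf Fb).
case: (eqVneq (c b') 0) => [->|cb']; first by rewrite mul0r.
rewrite ((hX (val b')).2 (valP b')).2 ?mulr0 ?(valP b) // ltn_neqAle bmin // andbT.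
by apply: contraNneq ne => /inj/val_inj->.
Qed.

End LinearAlgebra.

(** * Stallings folding and injectivity on fundamental groups *)

Lemma wreduce_subset (D : eqType) (rv : D -> D) (s : seq D) : {subset wreduce rv s <= s}.
Proof.
elim: s => //= d s IH x; rewrite /red_cons.
case E: (wreduce rv s) => [|d' t]; first by rewrite !inE => /eqP->; rewrite eqxx.
case: eqP => _; rewrite !inE => h; last first.
  by case/orP: h => [->//|h]; rewrite IH ?orbT // E inE.
by rewrite IH ?orbT // E inE h orbT.
Qed.

(** Supplies the pair of edges to fold; for a locally injective [l] such a pair cannot exist on a
    walk. *)
Lemma backtrack (D D' : eqType) (rv : D -> D) (rv' : D' -> D') (l : D -> D') s :
  reducedw rv s -> ~~ reducedw rv' (map l s) ->
  exists s1 a b s2, [/\ s = s1 ++ a :: b :: s2, l b = rv' (l a) & b != rv a].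
Proof.
elim: s => // a [|b s] IH //.
rewrite [map l _]/= [reducedw rv _]reducedw_cons [reducedw rv' _]reducedw_cons.
move=> /andP[ne rs]; rewrite negb_and negbK.
case/orP => [/eqP e|nr]; first by exists [::], a, b, s.
case: (IH rs nr) => s1 [a' [b' [s2 [-> h1 h2]]]].
by exists (a :: s1), a', b', s2.
Qed.

Section Fold.
Local Open Scope ring_scope.
Variables (V D DU : finType) (rv : D -> D) (rU : DU -> DU) (l : D -> DU).
Hypotheses (rvK : involutive rv) (rvN : forall d, rv d != d).
Hypotheses (rUK : involutive rU) (rUN : forall d, rU d != d).
Hypothesis lrv : {morph l : d / rv d >-> rU d}.

Definition h1_inj (A : {set D}) (tg : D -> V) := forall w, anti rv w ->
  (forall d, d \notin A -> w d = 0) -> push tg w =1 (fun _ => 0) ->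
  push l w =1 (fun _ => 0) -> w =1 (fun _ => 0).

Section Step.
Variables (A : {set D}) (tg : D -> V) (a b : D).
Hypotheses (Aa : a \in A) (Ab : b \in A) (Arv : forall d, d \in A -> rv d \in A).
Hypotheses (ab : tg a = tg (rv b)) (lab : l b = rU (l a)) (nab : b != rv a).
Hypothesis inj : h1_inj A tg.

Let y1 := tg (rv a).
Let y2 := tg b.

Let a_b : (a == b) = false.
Proof.
by apply/eqP => e; have := rUN (l a); rewrite -lab -e eqxx.
Qed.

Let wab : walk_from_to rv tg y1 [:: a; b] y2.
Proof. by rewrite !walk_cons walk0 -ab !eqxx. Qed.

Let chainb : chain rv [:: a; b] b = 1.
Proof.
rewrite !chain_cons // chain_nil /delta a_b eqxx (negPf (rvN b)) [rv a == b]eq_sym (negPf nab) /=.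
by ring.
Qed.

Let chain_supp d : d \notin A -> chain rv [:: a; b] d = 0.
Proof.
move=> nd; rewrite !chain_cons // chain_nil /delta.
have h x : x \in A -> (x == d) = false by move=> xA; apply: contraNF nd => /eqP<-.
by rewrite !h ?Arv // !subrr.
Qed.

Let chainl : push l (chain rv [:: a; b]) =1 (fun _ => 0).
Proof.
move=> x; rewrite (push_chain _ rvK rUK lrv) /= lab.
rewrite (chain_weq rUK (t := [::])) ?chain_nil //.
exact: (weq_cancel rUK (l a) [::]).
Qed.

(** Otherwise [[:: a; b]] would be a closed walk with nonzero chain whose label chain vanishes. *)
Lemma fold_ends : y1 != y2.
Proof.
apply/eqP => e; have := inj (chain_anti rvK [:: a; b]) chain_supp _ chainl b.
rewrite chainb => h; have /eqP : (1 : rat) = 0; last by rewrite oner_eq0.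
by apply: h => x; rewrite (bd_chain rvK _ wab) e subrr.
Qed.

Let g v := if v == y2 then y1 else v.
Let tg' d := g (tg d).
Let A' := A :\ b :\ rv b.
Let q d := if d == b then rv a else if d == rv b then a else d.

Lemma fold_card : (#|A'| < #|A|)%N.
Proof.
apply: proper_card; apply/properP; split.
  by apply/subsetP => x; rewrite !inE => /and3P[].
by exists b => //; rewrite !inE eqxx andbF.
Qed.

Lemma fold_closed d : d \in A' -> rv d \in A'.
Proof.
rewrite !inE (inj_eq (can_inj rvK)) (can2_eq rvK rvK) => /and3P[-> -> dA].
by rewrite Arv.
Qed.

(** Before folding, a cycle [w] of the folded graph has boundary c(y2 - y1). Subtracting [c] times
    the chain of [[:: a; b]] closes it without changing the label chain, and the value at [b], which
    lies outside the support of [w], then forces c = 0. *)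
Lemma fold_h1_inj : h1_inj A' tg'.
Proof.
move=> w aw sw bw lw.
pose c := push tg w y2.
have bw' v : push g (push tg w) v = 0 by rewrite push_comp.
pose w1 d := w d + (- c) * chain rv [:: a; b] d.
have w10 : w1 =1 (fun _ => 0).
  apply: inj.
  - by apply: antiD => //; apply: antiZ; apply: chain_anti.
  - move=> d dA; rewrite /w1 chain_supp // mulr0 addr0 sw //.
    by apply: contra dA; rewrite !inE => /and3P[].
  - move=> v; rewrite pushD pushZ (bd_chain rvK _ wab) /delta.
    case: (eqVneq y2 v) => [<-|n2]; first by rewrite (negPf fold_ends) -/c /=; ring.
    have := bw' v; rewrite {1}/push /g.
    case: (eqVneq y1 v) => [e1|n1].
      rewrite (bigD1 y2) /=; last by rewrite eqxx e1.
      rewrite (bigD1 v) /=; last by rewrite [v == y2]eq_sym (negPf n2) eqxx.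
      rewrite big1 ?addr0; first by rewrite -/c /=; lra.
      move=> i /andP[/andP[]]; case: (i == y2) => // /eqP->.
      by rewrite eqxx.
    rewrite (big_pred1 v) => [h|i /=]; first by rewrite h /=; ring.
    case: (eqVneq i y2) => // ->; rewrite (negPf n2); exact/negbTE.
  - by move=> e; rewrite pushD pushZ lw chainl mulr0 addr0.
have c0 : c = 0.
  have := w10 b; rewrite /w1 chainb sw ?inE ?eqxx ?andbF // add0r mulr1.
  by move/eqP; rewrite oppr_eq0 => /eqP.
by move=> d; have := w10 d; rewrite /w1 c0 oppr0 mul0r addr0.
Qed.

Let qrv : {morph q : d / rv d >-> rv d}.
Proof.
move=> d; rewrite /q (inj_eq (can_inj rvK)) (can2_eq rvK rvK).
case: (eqVneq d b) => [->|_]; last by case: eqP.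
by rewrite eq_sym (negPf (rvN b)) rvK.
Qed.

Let tgq d : tg' (q d) = g (tg d).
Proof.
rewrite /tg' /q; case: eqP => [->|_]; last by case: eqP => // ->; rewrite ab.
by rewrite /g -/y1 -/y2 eqxx (negPf fold_ends).
Qed.

Lemma fold_walk u s : walk_from_to rv tg u s u ->
  walk_from_to rv tg' (g u) (map q s) (g u).
Proof. exact: walk_map. Qed.

Lemma fold_label s : map l (map q s) = map l s.
Proof.
rewrite -map_comp; apply: eq_map => d /=; rewrite /q.
by case: eqP => [->|_]; [rewrite lrv lab | case: eqP => // ->; rewrite lrv lab rUK].
Qed.

Lemma fold_all s : all (mem A) s -> all (mem A') (map q s).
Proof.
move/allP => h; apply/allP => x /mapP[d /h dA ->] {x}; rewrite /= /q.
have inj_rv := inj_eq (can_inj rvK).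
case: (eqVneq d b) => [_|n1].
  by rewrite !inE inj_rv a_b eq_sym nab Arv.
case: (eqVneq d (rv b)) => [_|n2]; last by rewrite !inE n1 n2.
by rewrite !inE a_b Aa -(can2_eq rvK rvK) eq_sym nab.
Qed.

(* [J] carries walks of the folded graph back to the original one, up to
   homotopy; it undoes [q] because [[:: a; b]] joins the two identified vertices. *)
Lemma fold_weq u s : walk_from_to rv tg u s u -> weq rv (map q s) [::] -> weq rv s [::].
Proof.
move=> ws eq; pose c v := if v == y2 then [:: a; b] else [::].
pose J d := c (tg (rv d)) ++ [:: d] ++ inv_walk rv (c (tg d)).
have Jrv d : weq rv (J (rv d)) (inv_walk rv (J d)).
  by rewrite /J !inv_walk_cat rvK inv_walkK // -catA.
have Jq d : weq rv (J (q d)) (J d).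
  rewrite /q; case: eqP => [->|_].
    rewrite /J rvK -/y1 ab; apply: weq_catl => //.
    rewrite /c (negPf fold_ends) -/y2 eqxx /inv_walk /rev /=.
    by apply: weq_sym; apply: weq_cancel.
  case: eqP => // ->; rewrite /J rvK -/y1 -/y2 ab /c (negPf fold_ends) eqxx.
  rewrite catA [in X in weq _ _ X]catA; apply: weq_catr => //=.
  apply: weq_sym; apply: (weq_cons rvK a); exact: (weq_cancel rvK b [::]).
have tel v t v' : walk_from_to rv tg v t v' ->
    weq rv (flatten (map J t)) (c v ++ t ++ inv_walk rv (c v')).
  elim: t v => [|d t IH] v; rewrite ?walk0 ?walk_cons.
    by move/eqP->; apply: weq_sym; apply: weq_invr.
  case/andP=> /eqP<- /IH h /=; apply: weq_trans (weq_catl rvK _ h) _.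
  rewrite /J -!catA; do 2!apply: weq_catl => //; rewrite catA.
  exact: (weq_catr rvK _ (weq_invl rvK _)).
have h1 : weq rv (flatten (map J (map q s))) [::] by apply: (weq_hom rvK rvK Jrv eq).
have h2 : weq rv (flatten (map J (map q s))) (flatten (map J s)).
  by elim: (s) => //= d t IH; apply: weq_cat.
have h3 := weq_trans (weq_sym (tel _ _ _ ws)) (weq_trans (weq_sym h2) h1).
have h4 : weq rv (c u ++ s ++ inv_walk rv (c u)) (c u ++ [::] ++ inv_walk rv (c u)).
  by apply: weq_trans h3 _; apply: weq_sym; apply: weq_invr.
exact: weq_catIr (weq_catIl rvK h4).
Qed.

End Step.

(* Stallings folding: injectivity on rational homology is inherited by the
   folded graph, and folding two edges with distinct far ends is a homotopy
   equivalence. *)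
Lemma pi1_inj (A : {set D}) (tg : D -> V) u s :
  (forall d, d \in A -> rv d \in A) -> h1_inj A tg ->
  walk_from_to rv tg u s u -> all (mem A) s -> weq rU (map l s) [::] -> weq rv s [::].
Proof.
elim: {A}_.+1 {-2}A (ltnSn #|A|) tg u s => // n IH A lt tg u s Arv inj ws As ls.
pose t := wreduce rv s.
have wt : walk_from_to rv tg u t u by apply: walk_red.
have At : all (mem A) t.
  by apply/allP => x /wreduce_subset; apply: (allP As).
have est : weq rv t s by apply: weq_red.
have lt0 : weq rU (map l t) [::].
  by apply: weq_trans ls; apply: (weq_map rvK rUK lrv).
apply: weq_trans (weq_sym est) _.
case: (boolP (reducedw rU (map l t))) => [rl|nr].
  by move: lt0; rewrite /weq (wreduce_id rl); case: (t).
have [s1 [a [b [s2 [et lab nab]]]]] := backtrack (wreduce_reduced rv s) nr.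
have [Aa Ab] : a \in A /\ b \in A.
  by split; apply: (allP At); rewrite /t et mem_cat !inE eqxx ?orbT.
have ab : tg a = tg (rv b).
  move: wt; rewrite /t et => /walk_catP[v _]; rewrite !walk_cons.
  by case/and3P=> _ /eqP.
apply: (fold_weq Aa Ab Arv ab lab nab inj wt).
apply: (IH _ _ _ _ _ _ (fold_h1_inj Aa Ab Arv ab lab nab inj)).
- exact: leq_trans (fold_card Ab) lt.
- exact: fold_closed.
- exact: (fold_walk Aa Ab Arv ab lab nab inj wt).
- exact: fold_all.
- by rewrite fold_label.
Qed.

End Fold.

(** * The Magnus order on a free group *)

Section Magnus.
Local Open Scope ring_scope.
Variables (DU : finType) (rU : DU -> DU).
Hypotheses (rUK : involutive rU) (rUN : forall d, rU d != d).

(** The free generator behind a dart: the dart of smaller rank in the pair d, [rU d]; [lsign] is its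
    exponent. *)
Definition letter d := if (enum_rank d <= enum_rank (rU d))%N then d else rU d.
Definition lsign d : int := if (enum_rank d <= enum_rank (rU d))%N then 1 else -1.

Lemma rank_rU d : (enum_rank (rU d) <= enum_rank d)%N = ~~ (enum_rank d <= enum_rank (rU d))%N.
Proof.
rewrite -ltnNge ltn_neqAle; case: eqP => // /val_inj/enum_rank_inj e.
by have := rUN d; rewrite e eqxx.
Qed.

Lemma letter_rU d : letter (rU d) = letter d.
Proof. by rewrite /letter rUK rank_rU; case: leqP => _ //=. Qed.

Lemma lsign_rU d : lsign (rU d) = - lsign d.
Proof. by rewrite /lsign rUK rank_rU; case: leqP => _ //=; rewrite opprK. Qed.

Lemma letter_eq d d' : letter d = letter d' -> d = d' \/ d = rU d'.
Proof.
rewrite /letter; case: ifP => _; case: ifP => _ e; auto.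
- by right; rewrite -e rUK.
- by left; rewrite -[d]rUK e rUK.
Qed.

(* [coef w v] is the coefficient of the monomial [v] in the image of [w] under
   d |-> 1 + lsign d * letter d.  In the quotient by the squares of the letters
   this map sends inverse letters to inverses; the quotient has as basis the
   monomials without equal neighbours. *)
Fixpoint coef (w v : seq DU) : int :=
  if w is d :: w' then
    coef w' v + (if v is a :: v' then (if a == letter d then lsign d * coef w' v' else 0) else 0)
  else (v == [::])%:R.

Definition nrep (v : seq DU) := sorted (fun a b => a != b) v.

Lemma nrep_cons a v : nrep (a :: v) = (if v is b :: _ then a != b else true) && nrep v.
Proof. by case: v. Qed.

Lemma nrep_behead a v : nrep (a :: v) -> nrep v.
Proof. by rewrite nrep_cons => /andP[]. Qed.

Lemma nrep_cat u v : nrep (u ++ v) -> nrep u /\ nrep v.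
Proof.
elim: u => //= a u IH; rewrite -!/(nrep (_ :: _)).
change (nrep (a :: (u ++ v)) -> nrep (a :: u) /\ nrep v).
rewrite !nrep_cons => /andP[h /IH[-> ->]]; split=> //.
by rewrite andbT; case: u h {IH}.
Qed.

Lemma coef_nil w : coef w [::] = 1.
Proof. by elim: w => //= d w ->; rewrite addr0. Qed.

Lemma coef_size w v : (size w < size v)%N -> coef w v = 0.
Proof.
elim: w v => [|d w IH] [|a v] //= lt; rewrite !IH ?mulr0 ?if_same ?addr0 //=; lia.
Qed.

Lemma coef_cat w1 w2 v :
  coef (w1 ++ w2) v = \sum_(i < (size v).+1) coef w1 (take i v) * coef w2 (drop i v).
Proof.
elim: w1 v => [|d w1 IH] v.
  rewrite big_ord_recl /= take0 drop0 mul1r big1 ?addr0 // => i _ /=.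
  by case: v i => [[[]]|a v i] //=; rewrite mul0r.
pose f v := if v is a :: v' then (if a == letter d then lsign d * coef w1 v' else 0) else 0.
have e u : coef (d :: w1) u = coef w1 u + f u by [].
rewrite (eq_bigr _ (fun (i : 'I_(size v).+1) _ =>
   etrans (congr1 (fun x => x * coef w2 (drop i v)) (e (take i v))) (mulrDl _ _ _))).
rewrite big_split /= IH; congr (_ + _).
case: v => [|a v]; first by rewrite big_ord1 /= mul0r.
rewrite big_ord_recl /= mul0r add0r.
case: eqP => _; last by rewrite big1 // => i _; rewrite mul0r.
by rewrite IH mulr_sumr; apply: eq_bigr => i _; rewrite mulrA.
Qed.

(** In the product for [d :: rU d] the linear terms cancel, and the quadratic term repeats a letter,
    which [nrep] excludes. *)
Lemma coef_weq w w' v : weq rU w w' -> nrep v -> coef w v = coef w' v.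
Proof.
have h u : forall v, nrep v -> coef u v = coef (wreduce rU u) v.
  apply: (@wreduce_ind _ _ (fun x y => forall v, nrep v -> coef x v = coef y v)) => {u v} //.
  - by move=> s t u h1 h2 v nv; rewrite h1 // h2.
  - move=> d s t e [|a v] nv /=; rewrite e //; congr (_ + _).
    by rewrite e //; apply: nrep_behead nv.
  - move=> d s [|a v] nv /=; first by rewrite !addr0.
    rewrite letter_rU lsign_rU; case: eqP => [ea|_]; last by rewrite !addr0.
    case: v nv => [|b v] nv; first by rewrite addr0; ring.
    case: eqP => [e|_]; last by rewrite addr0; ring.
    by move: nv; rewrite nrep_cons ea e eqxx.
by move=> e nv; rewrite h // e -h.
Qed.

(** One generator for each maximal run of equal generators. *)
Fixpoint syll (w : seq DU) : seq DU :=
  if w is d :: w' then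
    (if syll w' is a :: s then (if a == letter d then a :: s else letter d :: a :: s)
     else [:: letter d])
  else [::].

Lemma syll_cons d w : exists s, syll (d :: w) = letter d :: s.
Proof.
rewrite /=; case: (syll w) => [|a s]; first by exists [::].
by case: eqP => [->|_]; eexists.
Qed.

Lemma syll_size d w : (size (syll w) <= size (syll (d :: w)))%N.
Proof. by rewrite /=; case: (syll w) => //= a s; case: eqP => //= _. Qed.

(** A monomial without equal neighbours takes at most one letter from each run; so it is no longer
    than [syll w], and if equally long it starts with the generator of the first run. *)
Lemma coef_syll0 w u : nrep u -> (size (syll w) < size u)%N \/
  (size u = size (syll w) /\ if u is a :: _ then (if syll w is b :: _ then a != b else true)
     else false) -> coef w u = 0.
Proof.
elim: w u => [|d w IH] [|a u] // nu; first by case=> // -[].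
  by case=> [|[]].
have nu' : nrep u by apply: nrep_behead nu.
move=> h; have h1 : coef w (a :: u) = 0.
  apply: IH => //; have hs := syll_size d w; move: h hs; rewrite /=.
  case: (syll w) => [|b s] /=; first by move=> *; left.
  case: eqP => [->|_] //=; case=> [h _|[h _] _]; left; lia.
rewrite /= h1 add0r; case: eqP => // ea; rewrite IH ?mulr0 //.
move: h; rewrite /= ea; case: (syll w) => [|b s] /=.
  by rewrite eqxx => -[h|[]//]; left.
case: (eqVneq b (letter d)) => [eb|nb] /=; rewrite ?eb eqxx; last first.
  by case=> [h|[]//]; left.
case=> [h|[]//]; case: (ltnP (size s).+1 (size u)) => h2; first by left.
right; split; first by lia.
case: u nu {nu' h1 IH} h h2 => [|a2 u]; first by move=> _ /=; lia.
by rewrite nrep_cons ea eq_sym => /andP[].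
Qed.

Lemma nrep_syll w : nrep (syll w).
Proof.
elim: w => //= d w; case: (syll w) => // a s h.
by case: eqP => // /eqP ne; rewrite nrep_cons eq_sym ne.
Qed.

(** The first run, of length [n], offers [n] choices for the first letter. Up to sign the
    coefficient at [syll] is therefore the product of the run lengths, hence nonzero; this is the
    faithfulness of the Magnus map. *)
Lemma coef_syll d w : reducedw rU (d :: w) ->
  exists v (n : nat) (m : int), [/\ syll (d :: w) = letter d :: v, (0 < n)%N, m != 0,
    coef (d :: w) v = m & coef (d :: w) (letter d :: v) = lsign d * n%:Z * m].
Proof.
elim: w d => [|d2 w IH] d.
  by exists [::], 1%N, 1; split=> //=; rewrite !eqxx /=; ring.
rewrite reducedw_cons => /andP[ne /IH[v [n [m [es n0 m0 c1 c2]]]]].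
have nv := nrep_syll (d2 :: w); rewrite es in nv.
case: (eqVneq (letter d2) (letter d)) => e.
  have ed : d2 = d.
    by case: (letter_eq e) => // h; rewrite h eqxx in ne.
  subst d2; exists v, n.+1, m; split=> //.
  - by change (syll (d :: d :: w)) with (if syll (d :: w) is a :: s then
       (if a == letter d then a :: s else letter d :: a :: s) else [:: letter d]);
    rewrite es eqxx.
  - change (coef (d :: w) v + (if v is a :: v' then
       (if a == letter d then lsign d * coef (d :: w) v' else 0) else 0) = m).
    case: v nv {es c2} c1 => [|a v] nv; rewrite ?addr0 // => ->.
    by move: nv; rewrite nrep_cons eq_sym => /andP[/negPf-> _]; rewrite addr0.
  - change (coef (d :: w) (letter d :: v) + (if letter d == letter d then
       lsign d * coef (d :: w) v else 0) = lsign d * n.+1%:Z * m).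
    by rewrite eqxx c1 c2 -addn1 PoszD; ring.
exists (letter d2 :: v), 1%N, (lsign d2 * n%:Z * m).
have ls0 : lsign d2 != 0 by rewrite /lsign; case: ifP.
split=> //.
- change (syll (d :: d2 :: w)) with (if syll (d2 :: w) is a :: s then
       (if a == letter d then a :: s else letter d :: a :: s) else [:: letter d]).
  by rewrite es (negPf e).
- by rewrite !mulf_neq0 //; lia.
- change (coef (d2 :: w) (letter d2 :: v) + (if letter d2 == letter d then
       lsign d * coef (d2 :: w) v else 0) = lsign d2 * n%:Z * m).
  by rewrite (negPf e) addr0.
- change (coef (d2 :: w) (letter d :: letter d2 :: v) + (if letter d == letter d then
       lsign d * coef (d2 :: w) (letter d2 :: v) else 0) = lsign d * 1 * (lsign d2 * n%:Z * m)).
  rewrite eqxx c2 coef_syll0; first by ring.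
    by rewrite nrep_cons eq_sym e.
  by left; rewrite es.
Qed.

Lemma coef_trivial w : (forall v, nrep v -> coef w v = coef [::] v) -> weq rU w [::].
Proof.
move=> h; rewrite /weq /=; have h' v : nrep v -> coef (wreduce rU w) v = (v == [::])%:R.
  by move=> nv; rewrite -[RHS]h //; apply: coef_weq nv; apply: weq_red.
have := wreduce_reduced rU w; case: (wreduce rU w) h' => // d s h' /coef_syll.
case=> v [n [m [es n0 m0 _]]].
have nv : nrep (letter d :: v) by rewrite -es nrep_syll.
rewrite (h' _ nv) /=.
move/esym/eqP; rewrite !mulf_eq0 (negPf m0) orbF.
by rewrite /lsign; case: ifP => _ /=; lia.
Qed.

Section Keys.
Variable B : nat.

(** Monomials come by increasing degree, so that comparing coefficient lists lexicographically gives
    the Magnus order truncated at degree [B]. *)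
Definition words : seq (seq DU) :=
  [seq v <- flatten [seq map val (enum {:n.-tuple DU}) | n <- iota 0 B.+1] | nrep v].

Lemma mem_words v : (v \in words) = nrep v && (size v <= B)%N.
Proof.
rewrite mem_filter; case: (nrep v); rewrite // !andTb; apply/idP/idP => [h|le].
  have [s /mapP[n]] := elimT flattenP h.
  by rewrite mem_iota => /= lt -> /mapP[t _ ->]; rewrite size_tuple; lia.
apply/flattenP; exists (map val (enum {:(size v).-tuple DU})).
  by apply/mapP; exists (size v) => //; rewrite mem_iota add0n ltnS.
by apply/mapP; exists (in_tuple v) => //; rewrite mem_enum.
Qed.

Lemma words_sorted s1 v s2 u : words = s1 ++ v :: s2 -> u \in words ->
  (size u < size v)%N -> u \in s1.
Proof.
have so : sorted (fun a b : seq DU => (size a <= size b)%N) words.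
  apply: sorted_filter; first by move=> a b c; apply: leq_trans.
  rewrite sorted_pairwise; last by move=> a b c; apply: leq_trans.
  have : pairwise leq (iota 0 B.+1) by rewrite -sorted_pairwise ?iota_sorted //; apply: leq_trans.
  elim: (iota 0 B.+1) => //= n r IH /andP[/allP hn /IH hr].
  rewrite pairwise_cat hr andbT; apply/andP; split.
    apply/allrelP => a b /mapP[t _ ->] /flattenP[s /mapP[k /hn nk ->]] /mapP[t' _ ->].
    by rewrite !size_tuple.
  rewrite pairwise_map; elim: (enum _) => //= t l ->; rewrite andbT.
  by apply/allP => t' _ /=; rewrite !size_tuple.
move=> e; rewrite e in so *; rewrite mem_cat => /orP[//|].
move: so; rewrite sorted_pairwise; last by move=> a b c; apply: leq_trans.
rewrite pairwise_cat /= => /and3P[_ _ /andP[/allP h _]].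
by rewrite inE => /orP[/eqP->|/h]; lia.
Qed.

Definition key (w : seq DU) : seqlexi int := map (coef w) words.

Lemma lexi_eq (T : eqType) (f g f' g' : T -> int) (L : seq T) :
  (forall s1 v s2, L = s1 ++ v :: s2 -> (forall u, u \in s1 -> f u = g u /\ f' u = g' u) ->
     f v - g v = f' v - g' v) ->
  ((map f L : seqlexi int) <= map g L)%O = ((map f' L : seqlexi int) <= map g' L)%O.
Proof.
elim: L => // v L IH h.
have e := h [::] v L erefl (fun u (hu : u \in [::]) => match notF hu with end).
rewrite /= !lexi_cons.
have e1 : (f v <= g v) = (f' v <= g' v) by rewrite -subr_le0 e subr_le0.
have e2 : (f v >= g v) = (f' v >= g' v) by rewrite -subr_ge0 e subr_ge0.
rewrite e1 e2; case: (boolP (f' v <= g' v)) => //= l1; case: (boolP (f' v >= g' v)) => //= l2.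
apply: IH => s1 u s2 eL hs; apply: (h (v :: s1) u s2); first by rewrite eL.
move=> x; rewrite inE => /orP[/eqP->|/hs//].
by split; apply/eqP; rewrite eq_le ?e1 ?e2 l1 l2.
Qed.

(** Bi-invariance of the order, stated for conjugation by a letter: multiplication by [d] on either
    side changes a coefficient only by terms of lower degree, so at the first disagreement the
    differences are the same for both pairs. *)
Lemma key_conj d w1 w2 w1' w2' :
  weq rU (w1 ++ [:: d]) (d :: w2) -> weq rU (w1' ++ [:: d]) (d :: w2') ->
  (key w1 <= key w1')%O = (key w2 <= key w2')%O.
Proof.
move=> e e'; apply: lexi_eq => s1 v s2 eL hs.
have vw : v \in words by rewrite eL mem_cat inE eqxx orbT.
move: (vw); rewrite mem_words => /andP[nv lv].
have sh u : nrep u -> (size u < size v)%N -> coef w1 u = coef w1' u /\ coef w2 u = coef w2' u.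
  by move=> nu lu; apply/hs/(words_sorted eL) => //; rewrite mem_words nu; exact: leq_trans (ltnW lu) lv.
have E w : coef (w ++ [:: d]) v =
    \sum_(i < size v) coef w (take i v) * coef [:: d] (drop i v) + coef w v.
  rewrite coef_cat big_ord_recr; congr (_ + _).
  rewrite -[RHS]mulr1 -(coef_nil [:: d]); congr (coef _ _ * coef _ _).
    exact: take_size.
  exact: drop_size.
have := congr2 (fun x y => x - y) (coef_weq e nv) (coef_weq e' nv).
rewrite !E; set S := \sum_(i < _) _; set S' := \sum_(i < _) _.
have -> : S = S'.
  apply: eq_bigr => i _; congr (_ * _); apply: (sh _ _ _).1.
    by have := nv; rewrite -{1}(cat_take_drop i v) => /nrep_cat[].
  by rewrite size_take ltn_ord.
rewrite /=.
set x := (if v is a :: v' then _ else _); set x' := (if v is a :: v' then _ else _).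
have -> : x = x'.
  rewrite /x /x'; case: (v) nv sh => // a v' nv' sh'; case: eqP => // _.
  by rewrite (sh' _ (nrep_behead nv') _).2 /=.
lia.
Qed.

(** Expanding w w^-1 = 1 at the first nontrivial monomial leaves only the coefficients of w and of
    w^-1, which are therefore opposite. *)
Lemma key_inv w : (key [::] <= key w)%O = (key (inv_walk rU w) <= key [::])%O.
Proof.
apply: lexi_eq => s1 v s2 eL hs.
have vw : v \in words by rewrite eL mem_cat inE eqxx orbT.
move: (vw); rewrite mem_words => /andP[nv lv].
have sh u : nrep u -> (size u < size v)%N -> coef w u = (u == [::])%:R.
  by move=> nu lu; apply/esym/(hs _ _).1/(words_sorted eL) => //; rewrite mem_words nu; exact: leq_trans (ltnW lu) lv.
have := coef_weq (weq_invr rUK w) nv; rewrite coef_cat.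
case: v {eL vw} nv lv sh => [|a v] nv lv sh; first by rewrite big_ord1 /= !coef_nil.
rewrite big_ord_recl big_ord_recr big1 => [|i _].
  rewrite take0 drop0 coef_nil.
  rewrite (_ : take _ _ = a :: v); last by rewrite take_oversize // lift0.
  rewrite (_ : drop _ _ = [::]); last by rewrite drop_oversize // lift0.
  by rewrite coef_nil /=; lia.
rewrite sh ?mul0r //; last first.
  by rewrite size_takel lift0 /= ltnS ?ltn_ord // ltnW.
by have := nv; rewrite -{1}(cat_take_drop (lift ord0 (widen_ord (leqnSn _) i)) (a :: v)) => /nrep_cat[].
Qed.

(** A word of length at most [B] has no terms of degree above [B], so the truncated key determines
    all coefficients. *)
Lemma key_inj w w' : (size w <= B)%N -> (size w' <= B)%N -> key w = key w' -> weq rU w w'.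
Proof.
move=> lw lw' e.
have h v : nrep v -> coef w v = coef w' v.
  move=> nv; case: (leqP (size v) B) => lv; last by rewrite !coef_size //; lia.
  have vw : v \in words by rewrite mem_words nv.
  by move/eq_in_map: e => /(_ v vw).
have h2 : weq rU (w ++ inv_walk rU w') [::].
  apply: coef_trivial => v nv; rewrite -(coef_weq (weq_invr rUK w') nv) !coef_cat.
  apply: eq_bigr => i _; rewrite h //.
  by have := nv; rewrite -{1}(cat_take_drop i v) => /nrep_cat[].
apply: (@weq_catIr _ _ rUK (inv_walk rU w')).
by apply: weq_trans h2 (weq_sym (weq_invr rUK w')).
Qed.

End Keys.

End Magnus.

Lemma prop_set (T : finType) (P : T -> Prop) : exists A : {set T}, forall x, x \in A <-> P x.
Proof.
have /fin_all_exists[f hf] : forall x, exists b : bool, b <-> P x.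
  by move=> x; case: (classic (P x)) => h; [exists true | exists false].
by exists [set x | f x] => x; rewrite inE.
Qed.

Lemma period_gcd (T : Type) (a : nat -> T) m n : (0 < m)%N ->
  (forall i, a (i + m)%N = a i) -> (forall i, a (i + n)%N = a i) ->
  forall i, a (i + gcdn m n)%N = a i.
Proof.
move=> m0 hm hn i.
have hk k p : (forall i, a (i + p)%N = a i) -> forall i, a (i + k * p)%N = a i.
  move=> hp; elim: k => [|k IH] j; first by rewrite addn0.
  by rewrite mulSn addnA IH hp.
case: (egcdnP n m0) => u v e _.
by rewrite -(hk v _ hn (i + gcdn m n)%N) -addnA [(gcdn m n + _)%N]addnC -e hk.
Qed.

Lemma finite_order (T : finType) (f : T -> T) : injective f ->
  exists2 N, (0 < N)%N & forall x, iter N f x = x.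
Proof.
move=> fi; exists (\prod_(x : T) order f x)%N.
  by apply: prodn_gt0 => x; apply: order_gt0.
move=> x; rewrite (bigD1 x) //=; set m := (\prod_(i | _) _)%N.
elim: m => [|m IH]; first by rewrite muln0.
by rewrite mulnS addnC iterD iter_order.
Qed.

(** * Vanishing of cycles in folded vertex and edge spaces *)

Section Core.
Local Open Scope ring_scope.
Variables (DU : finType) (rU : DU -> DU).
Hypotheses (rUK : involutive rU) (rUN : forall d, rU d != d).
Variables (VG DG : finType) (rG : DG -> DG) (tG : DG -> VG) (lG : DG -> DU).
Hypotheses (rGK : involutive rG) (lGr : {morph lG : d / rG d >-> rU d}).
Hypothesis immG : forall d d', tG d = tG d' -> lG d = lG d' -> d = d'.
Variables (VP DP : finType) (rP : DP -> DP) (tP : DP -> VP).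
Hypothesis rPK : involutive rP.
Variables (aV bV : VP -> VG) (aD bD : DP -> DG).
Hypotheses (aDr : {morph aD : f / rP f >-> rG f}) (bDr : {morph bD : f / rP f >-> rG f}).
Hypotheses (aDt : forall f, tG (aD f) = aV (tP f)) (bDt : forall f, tG (bD f) = bV (tP f)).
Hypothesis ab_label : forall f, lG (aD f) = lG (bD f).
Let lP f := lG (aD f).
Hypothesis immP : forall f f', tP f = tP f' -> lP f = lP f' -> f = f'.
Let src f := tP (rP f).

Hypothesis h1G : forall w, anti rP w -> push tG (push aD w) =1 (fun _ => 0) ->
  push lG (push aD w) =1 (fun _ => 0) -> push aD w =1 (fun _ => 0).
Hypothesis prim : forall q d0 s z j, walk_from_to rP tP q (d0 :: s) q ->
  d0 \notin s -> rP d0 \notin d0 :: s -> walk_from_to rG tG (aV q) z (aV q) ->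
  map aD (d0 :: s) = wpow z j -> j = 1%N.
Hypothesis indep : forall q q' d0 s d0' s',
  walk_from_to rP tP q (d0 :: s) q -> walk_from_to rP tP q' (d0' :: s') q' ->
  d0 \notin s -> rP d0 \notin d0 :: s -> d0' \notin s' -> rP d0' \notin d0' :: s' ->
  aV q = aV q' -> map aD (d0 :: s) = map aD (d0' :: s') ->
  d0 \in d0' :: s' \/ rP d0 \in d0' :: s'.

Lemma lPr f : lP (rP f) = rU (lP f). Proof. by rewrite /lP aDr lGr. Qed.

Lemma srcK f : src (rP f) = tP f. Proof. by rewrite /src rPK. Qed.

Lemma immP_src f f' : src f = src f' -> lP f = lP f' -> f = f'.
Proof.
move=> e1 e2; apply: (can_inj rPK); apply: immP => //.
by rewrite !lPr e2.
Qed.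

(** A vertex [p] of the page graph is an edge from [bV p] to [aV p] in a bipartite vertex space, so
    these are rational cycles of vertex spaces, restricted to those over [V]. Likewise [in_E]
    consists of cycles of the edge space with label [e]; pushing forward along [tP] and [src] gives
    the maps induced by the two attaching maps. *)
Definition in_V (V : {set VG}) (z : VP -> rat) :=
  [/\ forall p, bV p \notin V -> z p = 0, push aV z =1 (fun _ => 0)
    & push bV z =1 (fun _ => 0)].

Definition in_E (D : {set DG}) e (x : DP -> rat) :=
  [/\ forall f, ~~ ((bD f \in D) && (lP f == e)) -> x f = 0, push aD x =1 (fun _ => 0)
    & push bD x =1 (fun _ => 0)].

(* A subgraph of the target of [bD]: closed, full above, of nonnegative Euler
   characteristic and with an essential loop at every vertex. *)
Record config (V : {set VG}) (D : {set DG}) : Prop := {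
  cf_rev : forall d, d \in D -> rG d \in D;
  cf_tgt : forall d, d \in D -> tG d \in V;
  cf_cover : forall p h, h \in D -> tG h = bV p -> exists2 f, tP f = p & bD f = h;
  cf_fill : forall z, (forall p, bV p \notin V -> z p = 0) -> push bV z =1 (fun _ => 0) ->
    exists w, [/\ anti rP w, forall f, bD f \notin D -> w f = 0, push tP w =1 z
      & push bD w =1 (fun _ => 0)];
  cf_count : (#|D| <= 2 * #|V|)%N;
  cf_loop : forall v, v \in V -> exists s, [/\ s != [::], reducedw rG s,
    walk_from_to rG tG v s v & all (mem D) s] }.

Section Linear.
Variables (V : {set VG}) (D : {set DG}).
Hypothesis cf : config V D.

Lemma subsp_V : subsp (in_V V).
Proof.
split=> [x y [h1 h2 h3] e||a x y [h1 h2 h3] [k1 k2 k3]]; split.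
- by move=> p np; rewrite -e h1.
- by move=> v; rewrite -(push_ext _ e).
- by move=> v; rewrite -(push_ext _ e).
- by [].
- by move=> v; rewrite push0.
- by move=> v; rewrite push0.
- by move=> p np; rewrite h1 // k1 // mulr0 addr0.
- by move=> v; rewrite pushD pushZ h2 k2 mulr0 addr0.
- by move=> v; rewrite pushD pushZ h3 k3 mulr0 addr0.
Qed.

Lemma subsp_E e : subsp (in_E D e).
Proof.
split=> [x y [h1 h2 h3] exy||a x y [h1 h2 h3] [k1 k2 k3]]; split.
- by move=> p np; rewrite -exy h1.
- by move=> v; rewrite -(push_ext _ exy).
- by move=> v; rewrite -(push_ext _ exy).
- by [].
- by move=> v; rewrite push0.
- by move=> v; rewrite push0.
- by move=> p np; rewrite h1 // k1 // mulr0 addr0.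
- by move=> v; rewrite pushD pushZ h2 k2 mulr0 addr0.
- by move=> v; rewrite pushD pushZ h3 k3 mulr0 addr0.
Qed.

Lemma in_E_supp e x f : in_E D e x -> x f != 0 -> bD f \in D /\ lP f = e.
Proof.
case=> h _ _ nz; case: (boolP ((bD f \in D) && (lP f == e))) => [/andP[-> /eqP]|/h e0] //.
by rewrite e0 eqxx in nz.
Qed.

Lemma push_flip (A : finType) (rA : A -> A) (f : DP -> A) (x : DP -> rat) a :
  involutive rA -> {morph f : d / rP d >-> rA d} ->
  push f (x \o rP) a = push f x (rA a).
Proof.
move=> rAK hf; rewrite [RHS]/push (reindex_inj (can_inj rPK)) /=.
by apply: eq_bigl => d; rewrite hf (inj_eq (can_inj rAK)).
Qed.

Lemma in_E_flip e x : in_E D e x -> in_E D (rU e) (x \o rP).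
Proof.
case=> h1 h2 h3; split=> [f|d|d]; last 2 first.
- by rewrite (push_flip _ _ rGK aDr).
- by rewrite (push_flip _ _ rGK bDr).
move=> nf; apply: h1; apply: contra nf; rewrite bDr lPr => /andP[/(cf_rev cf)].
by rewrite rGK => -> /eqP<-; rewrite rUK /=.
Qed.

Lemma push_tail (T : finType) (f : DP -> T) x : push (f \o rP) x =1 push f (x \o rP).
Proof.
move=> t; rewrite [RHS]/push (reindex_inj (can_inj rPK)) /=.
by apply: eq_big => [d|d _] /=; rewrite ?rPK.
Qed.

Lemma head_in_V e x : in_E D e x -> in_V V (push tP x).
Proof.
move=> hx; case: (hx) => h1 h2 h3; split.
- move=> p np; apply: push0 => f ef; apply/eqP/negPn/negP => nz.
  have [fD _] := in_E_supp hx nz.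
  by move: np; rewrite -ef -bDt (cf_tgt cf fD).
- move=> v; rewrite push_comp -(push_fun (f := tG \o aD)) => [|f]; last exact: aDt.
  by rewrite -push_comp push0.
- move=> v; rewrite push_comp -(push_fun (f := tG \o bD)) => [|f]; last exact: bDt.
  by rewrite -push_comp push0.
Qed.

Lemma tail_in_V e x : in_E D e x -> in_V V (push src x).
Proof.
move=> hx; case: subsp_V => + _ _; apply; first exact: head_in_V (in_E_flip hx).
by move=> p; rewrite -push_tail.
Qed.

(** Among darts with one label the target map is injective ([immP]), so nothing cancels; thus heads,
    and similarly tails, embed edge cycles in vertex cycles. *)
Lemma head_val e x f : in_E D e x -> lP f = e -> push tP x (tP f) = x f.
Proof.
move=> hx lf; apply: push_single => f' tf nz.
by apply: immP => //; rewrite lf; case: (in_E_supp hx nz).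
Qed.

Lemma tail_val e x f : in_E D e x -> lP f = e -> push src x (src f) = x f.
Proof.
move=> hx lf; apply: push_single => f' tf nz.
by apply: immP_src => //; rewrite lf; case: (in_E_supp hx nz).
Qed.

Definition in_E_tot w := [/\ anti rP w, forall f, bD f \notin D -> w f = 0,
  push aD w =1 (fun _ => 0) & push bD w =1 (fun _ => 0)].

Lemma subsp_E_tot : subsp in_E_tot.
Proof.
split=> [x y [h0 h1 h2 h3] e||a x y [h0 h1 h2 h3] [k0 k1 k2 k3]]; split.
- by move=> f; rewrite -!e.
- by move=> p np; rewrite -e h1.
- by move=> v; rewrite -(push_ext _ e).
- by move=> v; rewrite -(push_ext _ e).
- exact: anti0.
- by [].
- by move=> v; rewrite push0.
- by move=> v; rewrite push0.
- by apply: antiD => //; apply: antiZ.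
- by move=> p np; rewrite h1 // k1 // mulr0 addr0.
- by move=> v; rewrite pushD pushZ h2 k2 mulr0 addr0.
- by move=> v; rewrite pushD pushZ h3 k3 mulr0 addr0.
Qed.

(* The chain found by [cf_fill] is a cycle over the target of [aD], because its
   image there is a horizontal cycle with trivial label. *)
Lemma fill z : in_V V z -> exists2 w, in_E_tot w & push tP w =1 z.
Proof.
case=> h1 h2 h3; case: (cf_fill cf h1 h3) => w [aw sw ez bw].
exists w => //; split=> //; apply: h1G => // x.
  rewrite push_comp (push_fun (g := aV \o tP)) => [|f]; last exact: aDt.
  by rewrite -push_comp (push_ext _ ez).
rewrite push_comp (push_fun (g := lG \o bD)) => [|f]; last exact: ab_label.
by rewrite -push_comp push0.
Qed.

Lemma restrict w e : in_E_tot w -> in_E D e (fun f => if lP f == e then w f else 0).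
Proof.
case=> _ sw w1 w2; split=> [f|d|d].
- by case: eqP => //; rewrite andbT => _ /sw.
- case: (eqVneq (lG d) e) => [<-|ne].
    rewrite -[RHS](w1 d); apply: eq_bigr => f /eqP<-; by rewrite eqxx.
  by apply: push0 => f ef; rewrite /lP ef (negPf ne).
- case: (eqVneq (lG d) e) => [<-|ne].
    rewrite -[RHS](w2 d); apply: eq_bigr => f /eqP<-; by rewrite /lP ab_label eqxx.
  by apply: push0 => f ef; rewrite /lP ab_label ef (negPf ne).
Qed.

Lemma in_V_trivial : (forall e x, in_E D e x -> x =1 (fun _ => 0)) ->
  forall z, in_V V z -> z =1 (fun _ => 0).
Proof.
move=> tr z /fill[w hw ez] p; rewrite -ez push0 // => f _.
by have := tr _ _ (restrict (lP f) hw) f; rewrite eqxx.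
Qed.

End Linear.

Lemma in_E_trivial V D : config V D -> (forall z, in_V V z -> z =1 (fun _ => 0)) ->
  forall e x, in_E D e x -> x =1 (fun _ => 0).
Proof.
move=> cf tr e x hx f; apply/eqP/negPn/negP => nz.
have [_ lf] := in_E_supp hx nz.
by move: nz; rewrite -(head_val hx lf) (tr _ (head_in_V cf hx)) eqxx.
Qed.

Section Trim.
Variables (V : {set VG}) (D : {set DG}) (v : VG) (d0 : DG).
Hypotheses (cf : config V D) (d0D : d0 \in D) (d0v : tG d0 = v).
Hypothesis leaf : forall d, d \in D -> tG d = v -> d = d0.

Let V' := V :\ v.
Let D' := D :\ d0 :\ rG d0.

Let vV : v \in V. Proof. by rewrite -d0v (cf_tgt cf). Qed.

(** Cutting off a leaf removes one vertex and two darts, so the count is kept; fillings and reduced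
    loops based elsewhere cannot use the leaf edge. *)
Lemma trim_config : config V' D'.
Proof.
have rGN d : rG d != d.
  by apply: contraNneq (rUN (lG d)) => e; rewrite -lGr e.
have D'D d : d \in D' -> d \in D by rewrite !inE => /and3P[].
split.
- move=> d; rewrite !inE (inj_eq (can_inj rGK)) (can2_eq rGK rGK) => /and3P[-> -> /=].
  exact: (cf_rev cf).
- move=> d; rewrite !inE => /and3P[n1 n2 dD]; rewrite (cf_tgt cf) // andbT.
  by apply: contra n2 => /eqP/(leaf dD)->.
- by move=> p h /D'D; apply: (cf_cover cf).
- move=> z sz bz; case: (cf_fill cf (z := z)) => // [p np|w [aw sw ez bw]].
    by apply: sz; apply: contra np => /setD1P[].
  exists w; split=> // f; rewrite !inE !negb_and !negbK.
  (* Only one live page dart ends at [tP g], so its coefficient is the boundary coefficient there,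
     which is zero because [tP g] lies over [v]. *)
  have w0 g : bD g = d0 -> w g = 0.
    move=> eg; rewrite -(push_single (f := tP) (w := w) (a := g)) => [|g' tg nz].
      by rewrite ez sz // !inE -bDt eg d0v eqxx.
    apply: immP => //; rewrite /lP !ab_label eg; congr lG; apply: leaf.
      by apply: contraNT nz => /sw->.
    by rewrite bDt tg -bDt eg.
  case/or3P => [/eqP e|/eqP/w0//|/sw//].
  by apply/eqP; rewrite -oppr_eq0 -aw w0 // bDr e rGK.
- have := cf_count cf; rewrite (cardsD1 v V) vV (cardsD1 d0 D) d0D.
  by rewrite (cardsD1 (rG d0) (D :\ d0)) !inE rGN (cf_rev cf) //= /V' /D'; lia.
- move=> u; rewrite !inE => /andP[uv /(cf_loop cf)[s [s0 rs ws /allP as_]]].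
  exists s; split=> //.
  (* A reduced closed walk based away from the leaf would have to turn back at it. *)
  have key d : d \in s -> d <> d0 /\ d <> rG d0.
    have hd x : x \in s -> x <> d0.
      move=> xs ex; subst x; case/splitPr: xs rs ws as_ => s1 s2 rs ws as_.
      case: s2 rs ws as_ => [|x s2] rs /walk_catP[y _]; rewrite !walk_cons.
        by rewrite walk0 d0v => /andP[_ /eqP e]; rewrite e eqxx in uv.
      rewrite d0v => /and3P[_ /eqP ex _] as_.
      have xD : rG x \in D by apply: (cf_rev cf); apply: as_; rewrite mem_cat !inE eqxx !orbT.
      have e := leaf xD ex.
      by have [_ /=] := cat_sorted2 rs; rewrite -e rGK eqxx.
    move=> ds; split; first exact: hd.
    move=> e; subst d; case/splitPr: ds rs ws as_ hd => s1 s2 rs ws as_ hd.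
    case/lastP: s1 rs ws as_ hd => [|s1 x] rs ws as_ hd.
      move: ws; rewrite /= walk_cons rGK d0v => /andP[/eqP e _].
      by rewrite e eqxx in uv.
    move: ws => /walk_catP[y h1]; rewrite walk_cons rGK d0v => /andP[/eqP e _].
    move: h1; rewrite -cats1 => /walk_catP[y' _]; rewrite walk_cons walk0 => /andP[_ /eqP ex].
    apply: (hd x); first by rewrite mem_cat mem_rcons inE eqxx.
    apply: leaf; last by rewrite ex.
    by apply: as_; rewrite mem_cat mem_rcons inE eqxx.
  apply/allP => d ds; have [/eqP n1 /eqP n2] := key d ds.
  by rewrite /= !inE n1 n2; apply: as_.
Qed.

(** Only [d0] enters [v]. So the heads of cycles with any other label, and the tails of cycles
    labelled [lG d0], avoid [v]; and a cycle is determined by its head or by its tail. *)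
Lemma trim_V : (forall z, in_V V' z -> z =1 (fun _ => 0)) ->
  forall z, in_V V z -> z =1 (fun _ => 0).
Proof.
move=> tr; apply: (in_V_trivial cf) => e x hx f; apply/eqP/negPn/negP => nz.
have [_ lf] := in_E_supp hx nz.
have V'P z : in_V V z -> (forall p, bV p = v -> z p = 0) -> in_V V' z.
  case=> h1 h2 h3 h; split=> // p; rewrite !inE negb_and negbK => /orP[/eqP/h//|/h1//].
move/eqP: nz; apply; case: (eqVneq e (lG d0)) => ne.
  rewrite -(tail_val hx lf) tr //; apply: V'P; first exact: tail_in_V hx.
  move=> p ep; apply: push0 => g eg; apply/eqP/negPn/negP => ng.
  have [gD lg] := in_E_supp hx ng.
  have : bD (rP g) = d0 by apply: leaf; rewrite ?bDr ?(cf_rev cf) // -bDr bDt -/(src g) eg.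
  move=> h; have := rUN (lP g); rewrite -lPr /lP ab_label h -ne -lg eqxx //.
rewrite -(head_val hx lf) tr //; apply: V'P; first exact: head_in_V hx.
move=> p ep; apply: push0 => g eg; apply/eqP/negPn/negP => ng.
have [gD lg] := in_E_supp hx ng.
have h : bD g = d0 by apply: leaf => //; rewrite bDt eg.
by rewrite -lg /lP ab_label h eqxx in ne.
Qed.

End Trim.

Section Circle.
Variables (V : {set VG}) (D : {set DG}).
Hypothesis cf : config V D.
Hypothesis noleaf : forall v, v \in V -> #|[set d in D | tG d == v]| <> 1%N.

Let alive f := bD f \in D.

Lemma alive_rP f : alive f -> alive (rP f).
Proof. by rewrite /alive bDr; apply: (cf_rev cf). Qed.

(** Essential loops and the absence of leaves give valency at least 2 everywhere, while [cf_count]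
    bounds the average by 2. *)
Lemma two_darts v : v \in V -> #|[set d in D | tG d == v]| = 2.
Proof.
pose n v := #|[set d in D | tG d == v]|.
have ge u : u \in V -> (2 <= n u)%N.
  move=> uV; have [s [s0 _ ws /allP as_]] := cf_loop cf uV.
  suff : n u != 0%N by have := noleaf uV; rewrite -/(n u); lia.
  case: s s0 ws as_ => // d s _; rewrite walk_cons => /andP[/eqP e _] as_.
  rewrite -lt0n; apply/card_gt0P; exists (rG d).
  by rewrite !inE e eqxx (cf_rev cf) //; apply: as_; rewrite inE eqxx.
have e : #|D| = (\sum_(u in V) n u)%N.
  rewrite -sum1_card (partition_big tG (mem V)) /=; last by move=> d /(cf_tgt cf).
  by apply: eq_bigr => u _; rewrite /n -sum1dep_card.
have h : (\sum_(u in V) n u <= \sum_(u in V) 2)%N.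
  by rewrite -e sum_nat_const mulnC; apply: (cf_count cf).
move=> vV; apply/eqP; rewrite eqn_leq -/(n v) ge // andbT leqNgt; apply/negP => lt.
move: h; rewrite (bigD1 v) //= [X in (_ <= X)%N](bigD1 v) //= leqNgt => /negP; apply.
rewrite -addSn; apply: leq_add => //; apply: leq_sum => u /andP[uV _]; exact: ge.
Qed.

Lemma bD_inj f f' : tP f = tP f' -> bD f = bD f' -> f = f'.
Proof. by move=> e1 e2; apply: immP => //; rewrite /lP !ab_label e2. Qed.

Lemma other_ex p : bV p \in V -> exists f1 f2, [/\ tP f1 = p /\ tP f2 = p, f1 != f2,
  alive f1 /\ alive f2 & forall f, alive f -> tP f = p -> f = f1 \/ f = f2].
Proof.
move=> pV; have [d1 [d2 [ne e]]] : exists x y, x != y /\ [set d in D | tG d == bV p] = [set x; y].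
  by apply/cards2P; rewrite two_darts.
have m d : (d \in D) && (tG d == bV p) = (d == d1) || (d == d2).
  by have /setP/(_ d) := e; rewrite !inE.
have /andP[d1D /eqP t1] : (d1 \in D) && (tG d1 == bV p) by rewrite m eqxx.
have /andP[d2D /eqP t2] : (d2 \in D) && (tG d2 == bV p) by rewrite m eqxx orbT.
have [f1 p1 b1] := cf_cover cf d1D t1; have [f2 p2 b2] := cf_cover cf d2D t2.
exists f1, f2; split=> //.
- by apply: contraNneq ne => ef; rewrite -b1 -b2 ef.
- by rewrite /alive b1 b2.
- move=> f fD tf; have : (bD f \in D) && (tG (bD f) == bV p) by rewrite bDt tf eqxx andbT.
  rewrite m => /orP[/eqP ed|/eqP ed]; [left|right]; apply: bD_inj; rewrite ?tf ?ed //.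
Qed.

Definition other f := odflt f [pick f' | [&& alive f', tP f' == tP f & f' != f]].

Lemma otherP f : alive f -> [/\ alive (other f), tP (other f) = tP f, other f != f
  & forall f', alive f' -> tP f' = tP f -> f' = f \/ f' = other f].
Proof.
move=> fa; have pV : bV (tP f) \in V by rewrite -bDt (cf_tgt cf).
have [f1 [f2 [[t1 t2] ne [a1 a2] un]]] := other_ex pV.
rewrite /other; case: pickP => [g /and3P[ga /eqP tg ng] /=|no].
  split=> // f' fa' tf'.
  case: (un _ fa erefl) (un _ ga tg) (un _ fa' tf') ng => -> [] -> [] ->; auto;
    by rewrite eqxx.
case: (un _ fa erefl) => e.
  by have := no f2; rewrite a2 t2 e eqxx eq_sym ne.
by have := no f1; rewrite a1 t1 e eqxx ne.
Qed.

(* Follow the circle below without backtracking. *)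
Definition nx f := if alive f then rP (other f) else f.

Lemma nx_alive f : alive (nx f) = alive f.
Proof.
rewrite /nx; case: ifP => // fa; have [h _ _ _] := otherP fa.
exact: alive_rP.
Qed.

Lemma nx_src f : alive f -> src (nx f) = tP f.
Proof. by move=> fa; rewrite /nx fa srcK; case: (otherP fa). Qed.

Lemma nx_nb f : alive f -> nx f != rP f.
Proof. by move=> fa; rewrite /nx fa (inj_eq (can_inj rPK)); case: (otherP fa). Qed.

Lemma nx_uniq f g : alive f -> alive g -> src g = tP f -> g != rP f -> g = nx f.
Proof.
move=> fa ga sg ng; have [_ _ _ un] := otherP fa.
case: (un _ (alive_rP ga) sg) => e.
  by rewrite -e rPK eqxx in ng.
by rewrite /nx fa -e rPK.
Qed.

Lemma nx_rev f : alive f -> nx (rP (nx f)) = rP f.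
Proof.
move=> fa; have na : alive (nx f) by rewrite nx_alive.
apply/esym/nx_uniq; rewrite ?alive_rP //.
- by rewrite srcK -/(src (nx f)) nx_src.
- by rewrite rPK eq_sym nx_nb.
Qed.

Lemma nx_inj : injective nx.
Proof.
move=> f g e; have ea : alive f = alive g by rewrite -[LHS]nx_alive e nx_alive.
case fa: (alive f) ea => /esym ga; last by rewrite /nx fa ga in e.
by apply: (can_inj rPK); rewrite -(nx_rev fa) -(nx_rev ga) e.
Qed.

Lemma iter_alive i f : alive (iter i nx f) = alive f.
Proof. by elim: i => //= i; rewrite nx_alive. Qed.

Variables (N : nat).
Hypotheses (N0 : (0 < N)%N) (Nper : forall f, iter N nx f = f).

(** As [N] is a common period, every word is read around a closed walk, and all words have length
    [N], which is also the truncation degree of the keys. *)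
Definition word f := map lP (traject nx f N).
Local Notation keyN := (key rU N).

Lemma size_word f : size (word f) = N.
Proof. by rewrite size_map size_traject. Qed.

Lemma nx_label f : alive f -> lP (nx f) != rU (lP f).
Proof.
move=> fa; apply: contra (nx_nb fa) => /eqP e; apply/eqP/immP_src.
  by rewrite nx_src // srcK.
by rewrite lPr.
Qed.

Lemma word_reduced f : alive f -> reducedw rU (word f).
Proof.
rewrite /word; elim: N f => // n IH f fa; rewrite trajectS map_cons reducedw_cons.
rewrite IH ?nx_alive // andbT; case: n {IH} => //= n; exact: nx_label.
Qed.

Lemma word_inj f f' : alive f -> alive f' -> keyN (word f) = keyN (word f') ->
  word f = word f'.
Proof.
move=> fa fa' /(key_inj rUK rUN); rewrite !size_word => /(_ (leqnn _) (leqnn _)).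
by rewrite /weq !wreduce_id // word_reduced.
Qed.

Lemma word_label f i : lP (iter i nx f) = nth (lP f) (word f) (i %% N).
Proof.
have lt := ltn_pmod i N0.
rewrite (nth_map f) ?size_traject // nth_traject // {1}(divn_eq i N) addnC iterD.
congr (lP (iter _ _ _)); elim: (i %/ N)%N => // k IH.
by rewrite mulSn iterD IH Nper.
Qed.

Lemma word_labels f f' i : word f = word f' -> lP (iter i nx f) = lP (iter i nx f').
Proof.
move=> e; have e0 : lP f = lP f'.
  by move: e; rewrite /word; case: N N0 => // n _ [].
by rewrite !word_label e e0.
Qed.

Lemma eq_word f f' : (forall i, (i < N)%N -> lP (iter i nx f) = lP (iter i nx f')) ->
  word f = word f'.
Proof.
move=> h; apply: (@eq_from_nth _ (lP f)); rewrite !size_word // => i lt.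
by rewrite (nth_map f) ?size_traject // (nth_map f') ?size_traject // !nth_traject // h.
Qed.

Lemma word_nx f f' : word f = word f' <-> word (nx f) = word (nx f').
Proof.
split=> e; apply: eq_word => i lt.
  by rewrite -!iterSr; apply: word_labels.
have h := word_labels (N.-1 + i) e.
by rewrite -!iterSr -addSn prednK // addnC !iterD !Nper in h.
Qed.

Lemma word_shift f : word f ++ [:: lP f] = lP f :: word (nx f).
Proof.
by rewrite /word -map_cons -trajectS trajectSr map_rcons Nper cats1.
Qed.

Lemma word_rP f : alive f -> word (rP f) = inv_walk rU (word (nx f)).
Proof.
move=> fa.
have h n g : alive g ->
    traject nx (rP (iter n nx g)) n = rev (map rP (traject nx (nx g) n)).
  move=> ga; elim: n => // n IH; rewrite trajectS iterS nx_rev ?iter_alive //.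
  by rewrite IH trajectSr map_rcons rev_rcons -iterSr.
rewrite /word -{1}[f]Nper h // map_rev /inv_walk; congr rev.
by rewrite -!map_comp; apply: eq_map => g /=; rewrite lPr.
Qed.

(** The word exceeds the identity. By conjugation invariance this is constant along a circle
    ([pos_nx]), and exactly one of the two directions qualifies ([pos_rP]); so it orients the
    circles. *)
Definition pos f := ~~ (keyN (word f) <= keyN [::])%O.

Lemma pos_nx f : pos (nx f) = pos f.
Proof.
congr (~~ _); apply/esym; apply: (key_conj rUK rUN N (d := lP f)) => //.
by rewrite word_shift.
Qed.

Lemma pos_iter i f : pos (iter i nx f) = pos f.
Proof. by elim: i => //= i; rewrite pos_nx. Qed.

Lemma pos_rP f : alive f -> pos (rP f) = ~~ pos f.
Proof.
move=> fa; rewrite -[pos f]pos_nx /pos word_rP //.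
set w := word (nx f); have := key_inv rUK rUN N w.
rewrite negbK => <-; rewrite -ltNge lt_neqAle; case: eqP => // e; exfalso.
have na : alive (nx f) by rewrite nx_alive.
have lw : (size w <= N)%N by rewrite size_word.
have := key_inj rUK rUN lw (w' := [::]) (leq0n N) e; rewrite /weq wreduce_id ?word_reduced //=.
by move=> ew; move: N0; rewrite -(size_word (nx f)) -/w ew.
Qed.

Lemma pos_src f f' : alive f -> alive f' -> pos f -> pos f' -> src f = src f' -> f = f'.
Proof.
move=> fa fa' pf pf' e; apply/eqP; apply: contraLR pf' => ne.
have -> : f' = nx (rP f).
  by apply: nx_uniq; rewrite ?alive_rP // ?rPK 1?eq_sym.
by rewrite pos_nx pos_rP // pf.
Qed.

Lemma pos_in p : bV p \in V -> exists f, [/\ alive f, pos f & tP f = p].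
Proof.
move=> pV; have [f1 [f2 [[t1 t2] ne [a1 a2] _]]] := other_ex pV.
case p1: (pos f1); first by exists f1.
exists f2; split=> //; have -> : f2 = rP (nx f1).
  have -> : nx f1 = rP f2; last by rewrite rPK.
  apply/esym/nx_uniq; rewrite ?alive_rP ?srcK ?t2 //.
  by rewrite (inj_eq (can_inj rPK)) eq_sym.
by rewrite pos_rP ?nx_alive // pos_nx p1.
Qed.

Lemma pos_out p : bV p \in V -> exists f, [/\ alive f, pos f & src f = p].
Proof.
move=> /pos_in[f [fa pf tf]]; exists (nx f).
by rewrite nx_alive pos_nx nx_src.
Qed.

(** Over [V] exactly one positive dart leaves each vertex; the default serves only the other
    vertices. *)
Definition keyp p := if [pick f | [&& alive f, pos f & src f == p]] is Some f
  then keyN (word f) else keyN [::].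

Lemma keypE f : alive f -> pos f -> keyp (src f) = keyN (word f).
Proof.
move=> fa pf; rewrite /keyp; case: pickP => [g /and3P[ga pg /eqP sg]|/(_ f)].
  by rewrite (pos_src ga fa pg pf sg).
by rewrite fa pf eqxx.
Qed.

Definition lev p := #|[set q | (keyp q < keyp p)%O]|.

Lemma lev_le p q : (lev p <= lev q)%N = (keyp p <= keyp q)%O.
Proof.
case: (leP (keyp p) (keyp q)) => le.
  apply/subset_leq_card/subsetP => x; rewrite !inE => h; exact: lt_le_trans le.
apply/negbTE; rewrite -ltnNge; apply: proper_card; apply/properP; split.
  by apply/subsetP => x; rewrite !inE => h; apply: lt_trans le.
by exists q; rewrite !inE ?ltxx.
Qed.

Lemma lev_eq p q : lev p = lev q -> keyp p = keyp q.
Proof. by move=> e; apply/le_anti; rewrite -!lev_le e leqnn. Qed.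

Lemma edge_words f : alive f -> exists w1 w2, [/\ keyp (src f) = keyN w1,
  keyp (tP f) = keyN w2 & weq rU (w1 ++ [:: lP f]) (lP f :: w2)].
Proof.
move=> fa; case pf: (pos f).
  exists (word f), (word (nx f)); split; first exact: keypE.
    by rewrite -(nx_src fa) keypE ?nx_alive ?pos_nx.
  by rewrite word_shift.
have ra := alive_rP fa; have rp : pos (rP f) by rewrite pos_rP // pf.
exists (word (nx (rP f))), (word (rP f)); split.
- by rewrite /src -(nx_src ra) keypE ?nx_alive ?pos_nx.
- by rewrite -srcK keypE.
have := word_shift (rP f); rewrite lPr; set e := lP f; set w := word _; set w' := word _.
move=> ew; have h : weq rU ((e :: w) ++ [:: rU e]) w'.
  by rewrite cat_cons ew; apply: (weq_cancel rUK).
apply: weq_trans (weq_catr rUK _ (weq_sym h)) _.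
rewrite -catA -[X in weq _ _ X]cats0; apply: (weq_catl rUK).
by have := weq_cancel rUK (rU e) [::]; rewrite rUK.
Qed.

(** The place where bi-invariance enters: the positive words at the two ends of a dart are conjugate
    by its label, whatever its direction, so equal labels preserve and reflect the order. *)
Lemma lev_transport f f' : alive f -> alive f' -> lP f = lP f' ->
  (lev (src f) <= lev (src f'))%N = (lev (tP f) <= lev (tP f'))%N.
Proof.
move=> fa fa' e; rewrite !lev_le.
have [w1 [w2 [-> -> h]]] := edge_words fa; have [w1' [w2' [-> -> h']]] := edge_words fa'.
by apply: (key_conj rUK rUN N h); rewrite e.
Qed.

Lemma lev_transport_eq f f' : alive f -> alive f' -> lP f = lP f' ->
  (lev (src f) == lev (src f')) = (lev (tP f) == lev (tP f')).
Proof. by move=> fa fa' e; rewrite !eqn_leq !lev_transport. Qed.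

Lemma lev_word f f' : alive f -> alive f' -> pos f -> pos f' ->
  lev (src f) = lev (src f') -> word f = word f'.
Proof.
move=> fa fa' pf pf' /lev_eq; rewrite !keypE //; exact: word_inj.
Qed.

Lemma word_lev f f' : alive f -> alive f' -> pos f -> word f = word f' ->
  pos f' /\ lev (src f) = lev (src f').
Proof.
move=> fa fa' pf e; have pf' : pos f' by rewrite /pos -e.
by split=> //; rewrite /lev !keypE // e.
Qed.

Lemma lev_label f f' : alive f -> alive f' -> pos f -> pos f' ->
  lev (src f) = lev (src f') -> lP f = lP f'.
Proof. by move=> fa fa' pf pf' e; apply: (word_labels 0 (lev_word fa fa' pf pf' e)). Qed.

(** Equal levels mean equal positive words, so the positive dart leaving [src f'] has the label of
    [f], and by immersion it is [f']. *)
Lemma lev_pos f f' : alive f -> alive f' -> pos f -> lP f = lP f' ->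
  lev (src f) = lev (src f') -> pos f'.
Proof.
move=> fa fa' pf l e; case nf': (pos f') => //; exfalso.
have ra := alive_rP fa'.
pose g := nx (rP f'); have ga : alive g by rewrite nx_alive.
have pg : pos g by rewrite pos_nx pos_rP // nf'.
have sg : src g = src f' by rewrite nx_src.
have lg : lP f = lP g by apply: lev_label; rewrite ?sg.
have eg : g = f' by apply: immP_src; rewrite // -lg.
by move: nf'; rewrite -eg pg.
Qed.

Lemma lev_tgt f f' : alive f -> alive f' -> pos f -> pos f' ->
  (lev (src f) = lev (src f')) <-> (lev (tP f) = lev (tP f')).
Proof.
move=> fa fa' pf pf'; split=> e.
  apply/eqP; rewrite -lev_transport_eq ?e //; exact: lev_label.
have [|p' h] := @word_lev f f' fa fa' pf; last exact: h.
apply/word_nx; apply: lev_word; rewrite ?nx_alive ?pos_nx ?nx_src //.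
Qed.

(** Breaks ties of [lev] by rank, so that each nonzero vector has a single lowest vertex. *)
Definition rho p := (lev p * #|VP| + enum_rank p)%N.

Lemma rho_inj : injective rho.
Proof.
move=> p q e; apply: enum_rank_inj; apply: val_inj => /=.
have := congr1 (modn ^~ #|VP|) e.
by rewrite /rho !modnMDl !modn_small.
Qed.

Lemma rho_lt_lev p q : (rho p < rho q)%N -> (lev p <= lev q)%N.
Proof.
apply: contraTT; rewrite -!ltnNge ltnS => lt.
apply: (@leq_trans ((lev q).+1 * #|VP|)); first apply: ltnW; first by rewrite /rho mulSn [X in (_ < X)%N]addnC ltn_add2l.
by apply: leq_trans (leq_addr _ _); rewrite leq_mul2r lt orbT.
Qed.

Lemma lev_lt_rho p q : (lev p < lev q)%N -> (rho p < rho q)%N.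
Proof.
move=> lt; rewrite ltnNge leq_eqVlt; apply/negP => /orP[/eqP/rho_inj e|/rho_lt_lev].
  by rewrite e ltnn in lt.
by rewrite leqNgt lt.
Qed.

(** Positions of lowest terms, as in an echelon form; they count the dimension. *)
Definition pivot_V p := exists z, [/\ in_V V z, z p != 0
  & forall q, (rho q < rho p)%N -> z q = 0].

Definition pivot_E f := [/\ alive f, pos f & exists x, [/\ in_E D (lP f) x, x f != 0
  & forall g, (rho (src g) < rho (src f))%N -> x g = 0]].

Lemma pivot_EV f : pivot_E f -> pivot_V (src f).
Proof.
case=> fa pf [x [hx nz lo]]; exists (push src x); split; first exact: tail_in_V hx.
  by rewrite (tail_val hx).
by move=> q lt; apply: push0 => g eg; apply: lo; rewrite eg.
Qed.

(** If the dart with lowest tail is negative, then the dart with lowest head has the same level by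
    [lev_transport], so it is negative too by [lev_pos], and its reverse is a pivot of the reversed
    cycle. *)
Lemma lowest_pivot e x f : in_E D e x -> x f != 0 ->
  exists g, [/\ pivot_E g & x g != 0 \/ x (rP g) != 0].
Proof.
move=> hx nz.
have [g ng gmin] := @arg_minnP _ f (fun g => x g != 0) (fun g => rho (src g)) nz.
have [ga lg] := in_E_supp hx ng.
case pg: (pos g).
  exists g; split; last by left.
  split=> //; exists x; rewrite lg; split=> // h lt; apply/eqP/negPn/negP => nh.
  by move: (gmin h nh); rewrite leqNgt lt.
have [h nh hmin] := @arg_minnP _ f (fun g => x g != 0) (fun g => rho (tP g)) nz.
have [ha lh] := in_E_supp hx nh.
have le1 : (lev (src g) <= lev (src h))%N.
  move: (gmin h nh); rewrite leq_eqVlt => /orP[/eqP/rho_inj->//|]; exact: rho_lt_lev.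
have le2 : (lev (src h) <= lev (src g))%N.
  rewrite lev_transport ?lh //.
  move: (hmin g ng); rewrite leq_eqVlt => /orP[/eqP/rho_inj->//|]; exact: rho_lt_lev.
have lhg : lev (src h) = lev (src g) by apply/eqP; rewrite eqn_leq le1 le2.
have ph : pos h = false.
  case ph: (pos h) => //; have := lev_pos ha ga ph.
  by rewrite lh lg pg => /(_ erefl lhg).
exists (rP h); split; last by right; rewrite rPK.
split; [exact: alive_rP | by rewrite pos_rP // ph | exists (x \o rP)].
rewrite lPr lh /= rPK; split=> //; first exact: (in_E_flip cf hx).
move=> k; rewrite srcK => lt; apply/eqP/negPn/negP => nk.
by move: (hmin (rP k) nk); rewrite leqNgt /= lt.
Qed.

(* Dually to [pivot_EV], by a dimension count: [push tP] is onto [in_V V]. *)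
Lemma pivot_VE p : pivot_V p -> exists2 f, pivot_E f & src f = p.
Proof.
have [A hA] := prop_set pivot_E; have [B hB] := prop_set pivot_V.
have le : (#|B| <= #|A|)%N.
  apply: (pivot_count (F := push tP) (e := id) (subsp_E_tot D) rho_inj).
  - by move=> c X j; apply: push_sum.
  - move=> w hw w0 j; apply: push0 => f _; apply/eqP/negPn/negP => nz.
    have hx := restrict (lP f) hw.
    have [|g [gA ng]] := lowest_pivot hx (f := f); first by rewrite eqxx.
    have wg : w g = 0 by apply: w0; apply/hA.
    case: hw => aw _ _ _; case: ng; case: ifP => _; rewrite ?eqxx ?aw ?wg ?oppr0 ?eqxx //.
  - move=> b /hB[z [hz nz lo]]; case: (fill cf hz) => w hw ew; exists w; split=> //.
      by rewrite ew.
    by move=> b' _ lt; rewrite ew lo.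
have sub : src @: A \subset B.
  by apply/subsetP => q /imsetP[f /hA hf ->]; apply/hB/pivot_EV.
have inj : {in A &, injective src}.
  by move=> f g /hA[fa pf _] /hA[ga pg _]; apply: pos_src.
have /eqP e : src @: A == B by rewrite eqEcard sub card_in_imset.
by move=> /hB; rewrite -e => /imsetP[f /hA hf ->]; exists f.
Qed.

Notation above_V := (above lev (in_V V)).
Notation above_E e := (above (fun f => lev (src f)) (in_E D e)).

(** Gaussian elimination within one level: the lowest vertex of [z] is a pivot, hence by [pivot_VE]
    the source of a pivot dart, whose label is [lP f0] because positive darts on one level read one
    word. Subtract a multiple of its tail and go on. *)
Lemma lift_pos f0 z : alive f0 -> pos f0 -> above_V (lev (src f0)) z ->
  exists2 x, above_E (lP f0) (lev (src f0)) x &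
    forall f, alive f -> lP f = lP f0 -> lev (src f) = lev (src f0) -> x f = z (src f).
Proof.
move=> fa0 pf0; set n := lev (src f0); set e := lP f0.
(* [k] counts the ranks still to be cleared: on level [n], [z] already vanishes at the first #|VP| -
   k vertices. *)
have h k : forall z, above_V n z ->
    (forall q, lev q = n -> (enum_rank q < #|VP| - k)%N -> z q = 0) ->
  exists2 x, above_E e n x &
    forall f, alive f -> lP f = e -> lev (src f) = n -> x f = z (src f).
  elim: k => [|k IH] {}z az z0.
    exists (fun _ => 0).
      by split=> //; case: (subsp_E D e).
    by move=> f _ _ lf; rewrite z0 // subn0.
  case: (classic (exists q, [/\ lev q = n, enum_rank q = (#|VP| - k.+1)%N :> nat & z q != 0]))
      => [[q [lq rq nz]]|no]; last first.
    apply: IH => // q lq rq; apply/eqP/negPn/negP => nz.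
    case: (ltnP (enum_rank q) (#|VP| - k.+1)) => lt; first by rewrite z0 ?eqxx in nz.
    by apply: no; exists q; split=> //; lia.
  have zlo q' : (rho q' < rho q)%N -> z q' = 0.
    move=> lt; have := rho_lt_lev lt; rewrite leq_eqVlt lq => /orP[/eqP e'|]; last exact: az.2.
    by apply: z0 => //; move: lt; rewrite /rho e' lq rq; lia.
  have [|g [ga pg [x1 [hx1 n1 lo1]]] sg] := pivot_VE (p := q); first by exists z; split=> //; case: az.
  have eg : lP g = e by apply: lev_label => //; rewrite sg.
  rewrite eg in hx1; rewrite sg in lo1.
  pose c := z q / x1 g.
  pose z' p := (- c) * push src x1 p + z p.
  have t1 p : (rho p < rho q)%N -> push src x1 p = 0.
    by move=> lt; apply: push0 => g' eg'; apply: lo1; rewrite eg'.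
  have az' : above_V n z'.
    split.
      by case: (subsp_V V) => _ _; apply; [apply: (tail_in_V cf hx1) | case: az].
    move=> p lp; rewrite /z' t1 ?mulr0 ?add0r; first exact: az.2.
    by apply: lev_lt_rho; rewrite lq.
  have [|x2 [hx2 lo2] e2] := IH z' az'.
    move=> p lp rp; case: (ltnP (rho p) (rho q)) => lt.
      by rewrite /z' t1 // mulr0 add0r zlo.
    have ep : p = q by apply: rho_inj; move: lt; rewrite /rho lp lq rq; lia.
    rewrite ep /z' -sg (tail_val hx1) // sg /c; field; exact: n1.
  exists (fun f => c * x1 f + x2 f); first split.
  - by case: (subsp_E D e) => _ _; apply.
  - move=> f lf; rewrite lo2 // lo1 ?mulr0 ?addr0 //.
    by apply: lev_lt_rho; rewrite lq.
  - move=> f fa lf lev_f; rewrite e2 // /z' (tail_val hx1) //; ring.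
move=> az; apply: (h #|VP|) => // q _; by rewrite subnn.
Qed.

(** Lift across one positive dart and take heads: the values on the lowest level move one step along
    all circles reading the same word. *)
Lemma carry f z i : alive f -> pos f -> above_V (lev (src f)) z ->
  exists2 z', above_V (lev (src (iter i nx f))) z' &
    forall g, alive g -> pos g -> lev (src g) = lev (src f) ->
      z' (src (iter i nx g)) = z (src g).
Proof.
elim: i f z => [|i IH] f z fa pf az; first by exists z.
have [x [hx lo] ex] := lift_pos fa pf az.
have na : alive (nx f) by rewrite nx_alive.
have az' : above_V (lev (src (nx f))) (push tP x).
  split; first exact: head_in_V hx.
  move=> q lq; apply: push0 => g eg; apply/eqP/negPn/negP => nz.
  have [ga lg] := in_E_supp hx nz.
  move: lq; rewrite nx_src // -eg ltnNge -lev_transport // -ltnNge => lt.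
  by rewrite lo ?eqxx in nz.
have [|z' az2 e2] := IH _ _ na _ az'; first by rewrite pos_nx.
exists z' => [|g ga pg eg]; rewrite iterSr //.
have lg : lP g = lP f by apply: lev_label.
rewrite e2 ?nx_alive ?pos_nx ?nx_src //; last by apply/(lev_tgt ga fa pg pf).
by rewrite (head_val hx) // ex.
Qed.

(** Instead of going back across [f0], carry [z] forwards for the remaining N - 1 steps of the
    period, which ends at the tail of [f0], and lift there. *)
Lemma lift_pos_tgt f0 z : alive f0 -> pos f0 -> above_V (lev (tP f0)) z ->
  exists x, [/\ in_E D (lP f0) x, forall f, (lev (tP f) < lev (tP f0))%N -> x f = 0 &
    forall f, alive f -> lP f = lP f0 -> lev (tP f) = lev (tP f0) -> x f = z (tP f)].
Proof.
move=> fa pf az; have na : alive (nx f0) by rewrite nx_alive.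
have [||z' az' ez'] := @carry (nx f0) z N.-1 na; rewrite ?pos_nx ?nx_src //.
have eN g : iter N.-1 nx (nx g) = g by rewrite -iterSr prednK.
rewrite eN in az'; have [x [hx lo] ex] := lift_pos fa pf az'.
exists x; split=> // f.
  move=> lt; apply/eqP/negPn/negP => nz; have [ga lg] := in_E_supp hx nz.
  move: lt; rewrite ltnNge -lev_transport // -ltnNge => lt.
  by rewrite lo ?eqxx in nz.
move=> ga lg lt; have ls : lev (src f) = lev (src f0).
  by apply/eqP; rewrite lev_transport_eq // lt.
have pg : pos f by apply: (lev_pos fa).
rewrite ex // -[f in LHS]eN ez' ?nx_alive ?pos_nx ?nx_src //.
Qed.

Lemma lift_src f0 z : alive f0 -> above_V (lev (src f0)) z ->
  exists2 x, above_E (lP f0) (lev (src f0)) x &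
    forall f, alive f -> lP f = lP f0 -> lev (src f) = lev (src f0) -> x f = z (src f).
Proof.
move=> fa az; case pf: (pos f0); first exact: lift_pos.
have ra := alive_rP fa.
have [||x [hx lo ex]] := @lift_pos_tgt (rP f0) z ra; rewrite ?pos_rP ?pf //.
exists (x \o rP); first split.
- by rewrite -[lP f0]rUK -lPr; apply: (in_E_flip cf hx).
- by move=> f lt /=; apply: lo.
- move=> f ga lg lv /=; apply: ex => //; [exact: alive_rP | by rewrite !lPr lg].
Qed.

Lemma lift_tgt f0 z : alive f0 -> above_V (lev (tP f0)) z ->
  exists x, [/\ in_E D (lP f0) x, forall f, (lev (tP f) < lev (tP f0))%N -> x f = 0 &
    forall f, alive f -> lP f = lP f0 -> lev (tP f) = lev (tP f0) -> x f = z (tP f)].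
Proof.
move=> fa az; have ra := alive_rP fa.
have az' : above_V (lev (src (rP f0))) z by rewrite srcK.
have [x [hx lo] ex] := lift_src ra az'; rewrite srcK in lo ex.
exists (x \o rP); split.
- by rewrite -[lP f0]rUK -lPr; apply: (in_E_flip cf hx).
- by move=> f lt /=; apply: lo; rewrite srcK.
- by move=> f ga lg lv /=; rewrite ex ?srcK ?lPr ?lg //; apply: alive_rP.
Qed.

Notation red_V := (reduced lev (in_V V)).
Notation red_E e := (reduced (fun f => lev (src f)) (in_E D e)).

Lemma sum_push (f : DP -> VP) (x : DP -> rat) (z : VP -> rat) (P : pred VP) :
  \sum_(q | P q) push f x q * z q = \sum_(g | P (f g)) x g * z (f g).
Proof.
rewrite [RHS](partition_big f P) //=; apply: eq_bigr => q Pq.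
rewrite /push mulr_suml; apply: eq_big => [g|g /eqP->//].
by case: eqP => [->|]; rewrite ?Pq ?andbF.
Qed.

(** A test vector [z] on a higher level lifts to an edge cycle by [lift_src] if the label occurs
    there, and pairing the tail of [x] with [z] is pairing [x] with the lift. For heads, [lift_tgt]
    plays the same part. *)
Lemma tail_red e n x : red_E e n x -> red_V n (push src x).
Proof.
case=> [[hx lo] ox]; split; first split.
- exact: tail_in_V hx.
- by move=> q lq; apply: push0 => g eg; apply: lo; rewrite eg.
move=> m z lt az; rewrite sum_push.
case: (classic (exists f0, [/\ alive f0, lP f0 = e & lev (src f0) = m])) => [[f0 [fa lf lv]]|no].
  rewrite -lv in az; have [x' ax' ex'] := lift_src fa az; rewrite lv lf in ax' ex'.
  rewrite -[RHS](ox _ _ lt ax'); apply: eq_bigr => f /eqP lvf.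
  case: (eqVneq (x f) 0) => [->|nz]; first by rewrite !mul0r.
  by have [ga lg] := in_E_supp hx nz; rewrite ex'.
apply: big1 => f /eqP lvf; case: (eqVneq (x f) 0) => [->|nz]; first by rewrite mul0r.
by have [ga lg] := in_E_supp hx nz; case: no; exists f.
Qed.

Lemma head_red f0 x : alive f0 -> red_E (lP f0) (lev (src f0)) x ->
  red_V (lev (tP f0)) (push tP x).
Proof.
move=> fa [[hx lo] ox]; split; first split.
- exact: head_in_V hx.
- move=> q lq; apply: push0 => g eg; apply/eqP/negPn/negP => nz.
  have [ga lg] := in_E_supp hx nz.
  move: lq; rewrite -eg ltnNge -lev_transport // -ltnNge => lt.
  by rewrite lo ?eqxx in nz.
move=> m z lt az; rewrite sum_push.
case: (classic (exists f1, [/\ alive f1, lP f1 = lP f0 & lev (tP f1) = m]))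
    => [[f1 [ga lf lv]]|no]; last first.
  apply: big1 => f /eqP lvf; case: (eqVneq (x f) 0) => [->|nz]; first by rewrite mul0r.
  by have [ha lh] := in_E_supp hx nz; case: no; exists f.
rewrite -lv in az lt *; have [x' [hx' lo' ex']] := lift_tgt ga az; rewrite lf in hx' ex'.
have lt1 : (lev (src f0) < lev (src f1))%N by rewrite ltnNge lev_transport // -ltnNge.
have ax' : above_E (lP f0) (lev (src f1)) x'.
  split=> // f lf1; apply/eqP/negPn/negP => nz; have [ha lh] := in_E_supp hx' nz.
  move: lf1; rewrite ltnNge lev_transport ?lf // -ltnNge => h.
  by rewrite lo' ?eqxx in nz.
rewrite -[RHS](ox _ _ lt1 ax') [LHS]big_mkcond [RHS]big_mkcond.
apply: eq_bigr => f _; case: (eqVneq (x f) 0) => [->|nz]; first by rewrite !mul0r !if_same.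
have [ha lh] := in_E_supp hx nz; rewrite -lev_transport_eq ?lf //.
case: eqP => // e; rewrite ex' //; apply/eqP; by rewrite -lev_transport_eq ?e ?lf.
Qed.

(** Lift the lowest level of [y] and reduce the lift. Its tail is reduced and agrees with [y] on the
    lowest level, so by uniqueness it is all of [y]. Thus the whole support of [y], not only its
    lowest level, crosses darts labelled [lP f]. *)
Lemma red_step f y : alive f -> pos f -> red_V (lev (src f)) y ->
  exists y', [/\ red_V (lev (src (nx f))) y', y' (tP f) = y (src f) &
    forall q, y q != 0 -> exists g, [/\ alive g, lP g = lP f, src g = q & y' (tP g) != 0]].
Proof.
move=> fa pf ry; have [x0 ax0 ex0] := lift_src fa ry.1.
have [x rx ex] := reduced_exists (subsp_E D (lP f)) ax0.
have hx := rx.1.1.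
have ey : y =1 push src x.
  apply: (reduced_uniq (subsp_V V) ry (tail_red rx)) => q lq.
  case: (boolP (bV q \in V)) => qV; last first.
    by case: ry.1.1 => /(_ _ qV)->; case: (tail_in_V cf hx) => /(_ _ qV)->.
  have [g [ga pg sg]] := pos_out qV; rewrite -sg in lq *.
  have lg : lP g = lP f by apply: lev_label.
  by rewrite (tail_val hx) // ex // ex0.
exists (push tP x); split.
- by rewrite nx_src //; apply: head_red.
- by rewrite (head_val hx) // ey (tail_val hx).
move=> q; rewrite ey => nz.
case: (classic (exists2 g, src g = q & x g != 0)) => [[g sg ng]|no].
  have [ga lg] := in_E_supp hx ng.
  by exists g; split=> //; rewrite (head_val hx).
move/eqP: nz; case; apply: push0 => g eg; apply/eqP/negPn/negP => ng.
by apply: no; exists g.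
Qed.

(** Iterate [red_step]; consecutive darts found this way do not backtrack, because their labels are
    those read from [f], so they follow [nx]. *)
Lemma red_parallel k f y q : alive f -> pos f -> red_V (lev (src f)) y -> y q != 0 ->
  exists g, [/\ alive g, src g = q &
    forall i, (i <= k)%N -> lP (iter i nx g) = lP (iter i nx f)].
Proof.
elim: k f y q => [|k IH] f y q fa pf ry nz.
  have [y' [_ _ /(_ q nz)[g [ga lg sg _]]]] := red_step fa pf ry.
  by exists g; split=> // -[].
have [y' [ry' _ /(_ q nz)[g [ga lg sg nz']]]] := red_step fa pf ry.
have na : alive (nx f) by rewrite nx_alive.
have [|g' [ga' sg' h]] := IH (nx f) y' (tP g) na _ ry' nz'; first by rewrite pos_nx.
exists g; split=> // -[|i] le //; rewrite !iterSr -h //; congr (lP (iter _ _ _)).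
apply/esym/nx_uniq => //; apply: contra (nx_label fa) => /eqP e.
by rewrite -(h 0%N) // e lPr lg.
Qed.

(** If the image of a circle in the target of [aD] repeats after [d] steps, it is a power of a loop
    of length [d], and [prim] makes the exponent 1. *)
Lemma prim_period g d : alive g -> pos g -> (0 < d)%N -> (d %| order nx g)%N ->
  (forall i, aD (iter (i + d) nx g) = aD (iter i nx g)) -> d = order nx g.
Proof.
move=> ga pg d0 /dvdnP[j eL] per.
have L0 := order_gt0 nx g.
pose a i := aD (iter i nx g).
have srcG i : tG (rG (a i)) = aV (src (iter i nx g)) by rewrite /a -aDr aDt.
have nxs i : src (iter i.+1 nx g) = tP (iter i nx g) by rewrite iterS nx_src ?iter_alive.
have wG i n : walk_from_to rG tG (aV (src (iter i nx g))) (map a (iota i n))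
    (aV (src (iter (i + n) nx g))).
  elim: n i => [|n IH] i; first by rewrite addn0 walk0.
  rewrite /= walk_cons srcG eqxx /= addnS -addSn.
  have -> : tG (a i) = aV (src (iter i.+1 nx g)) by rewrite nxs aDt.
  exact: IH.
have wP i n : walk_from_to rP tP (src (iter i nx g)) (traject nx (iter i nx g) n)
    (src (iter (i + n) nx g)).
  elim: n i => [|n IH] i; first by rewrite addn0 walk0.
  by rewrite trajectS walk_cons eqxx /= -nxs addnS -addSn -iterS; apply: IH.
have au : aD g = aD (iter d nx g) by rewrite -(per 0%N).
have ez : aV (src (iter d nx g)) = aV (src g).
  by rewrite -[RHS](srcG 0%N) /a /= au -(srcG d).
have j1 : j = 1%N.
  have tr : traject nx g (order nx g) = g :: traject nx (nx g) (order nx g).-1.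
    by rewrite -{1}(prednK L0).
  have un : uniq (traject nx g (order nx g)) by apply: orbit_uniq.
  apply: (@prim (src g) g (traject nx (nx g) (order nx g).-1) (map a (iota 0 d))).
  - by rewrite -tr; have := wP 0%N (order nx g); rewrite add0n iter_order //; apply: nx_inj.
  - by move: un; rewrite tr /= => /andP[].
  - rewrite -tr; apply/trajectP => -[i _ e]; have := pos_rP ga.
    by rewrite e pos_iter pg.
  - by have := wG 0%N d; rewrite add0n ez.
  rewrite -tr eL.
  have h i : map aD (traject nx (iter (i * d) nx g) (j * d)) = wpow (map a (iota 0 d)) j.
    elim: (j) i => // j' IH i; rewrite wpowS mulSn trajectD map_cat.
    congr (_ ++ _); last by rewrite -iterD -mulSn; apply: IH.
    have pk k n : aD (iter n nx (iter (k * d) nx g)) = a n.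
      elim: k => // k IH'; rewrite -iterD mulSn addnA addnAC per -IH' -iterD //.
    apply: (@eq_from_nth _ (aD g)); first by rewrite !size_map size_traject size_iota.
    move=> n; rewrite size_map size_traject => lt.
    rewrite (nth_map (iter (i * d) nx g)) ?size_traject // nth_traject //.
    by rewrite (nth_map 0%N) ?size_iota // nth_iota // pk.
  exact: (h 0%N).
by rewrite eL j1 mul1n.
Qed.

(** By immersion the two circles have the same image for ever. Both lengths, hence their gcd, are
    periods of it, so the lengths agree by [prim_period]. Then [indep] makes the circles share a
    dart: the reverse direction contradicts positivity, and a proper shift would be a smaller
    period. *)
Lemma parallel_eq g g' : alive g -> alive g' -> pos g -> pos g' ->
  aV (src g) = aV (src g') -> word g = word g' -> g = g'.
Proof.
move=> ga ga' pg pg' es ew.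
have ea i : aD (iter i nx g) = aD (iter i nx g').
  have h : aV (src (iter i nx g)) = aV (src (iter i nx g')).
    elim: i => // i IH; rewrite !iterS !nx_src ?iter_alive // -!aDt; congr tG.
    apply: (can_inj rGK); apply: immG; first by rewrite -!aDr !aDt.
    by rewrite !lGr; congr rU; apply: (word_labels i ew).
  apply: (can_inj rGK); apply: immG; first by rewrite -!aDr !aDt.
  by rewrite !lGr; congr rU; apply: (word_labels i ew).
have pL h i : aD (iter (i + order nx h) nx h) = aD (iter i nx h).
  by rewrite iterD iter_order //; apply: nx_inj.
have pL' i : aD (iter (i + order nx g') nx g) = aD (iter i nx g).
  by rewrite !ea pL.
have pL2 i : aD (iter (i + order nx g) nx g') = aD (iter i nx g').
  by rewrite -!ea pL.
have L0 h : (0 < order nx h)%N by apply: order_gt0.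
have e1 : gcdn (order nx g) (order nx g') = order nx g.
  apply: prim_period; rewrite ?gcdn_gt0 ?L0 ?dvdn_gcdl //.
  exact: (@period_gcd _ (fun i => aD (iter i nx g))).
have e2 : gcdn (order nx g) (order nx g') = order nx g'.
  apply: prim_period; rewrite ?gcdn_gt0 ?L0 ?dvdn_gcdr //.
  exact: (@period_gcd _ (fun i => aD (iter i nx g'))).
have eL : order nx g = order nx g' by rewrite -e1 e2.
have tr h : traject nx h (order nx h) = h :: traject nx (nx h) (order nx h).-1.
  by rewrite -{1}(prednK (L0 h)).
have un h : h \notin traject nx (nx h) (order nx h).-1.
  by have := orbit_uniq nx h; rewrite /orbit tr /= => /andP[].
have nr h : alive h -> pos h -> rP h \notin traject nx h (order nx h).
  move=> ha ph; apply/trajectP => -[i _ e]; have := pos_rP ha.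
  by rewrite e pos_iter ph.
have wk h : alive h ->
    walk_from_to rP tP (src h) (traject nx h (order nx h)) (src h).
  move=> ha; have wP i n : walk_from_to rP tP (src (iter i nx h)) (traject nx (iter i nx h) n)
      (src (iter (i + n) nx h)).
    elim: n i => [|n IH] i; first by rewrite addn0 walk0.
    rewrite trajectS walk_cons eqxx /= addnS -addSn -iterS.
    by have := IH i.+1; rewrite {1}iterS nx_src ?iter_alive.
  by have := wP 0%N (order nx h); rewrite add0n iter_order //; apply: nx_inj.
have := @indep (src g) (src g') g (traject nx (nx g) (order nx g).-1)
  g' (traject nx (nx g') (order nx g').-1).
rewrite -!tr => /(_ (wk _ ga) (wk _ ga') (un _) (nr _ ga pg) (un _) (nr _ ga' pg') es).
case.
- apply: (@eq_from_nth _ (aD g)); first by rewrite !size_map !size_traject.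
  move=> i; rewrite size_map size_traject => lt.
  rewrite (nth_map g) ?size_traject // (nth_map g') ?size_traject -?eL //.
  by rewrite !nth_traject // ea.
- case/trajectP => j lt ej; case: (posnP j) => [j0|j0]; first by rewrite ej j0.
  have pj i : aD (iter (i + j) nx g) = aD (iter i nx g).
    by rewrite ea iterD -ej.
  have e3 : gcdn (order nx g) j = order nx g.
    apply: prim_period; rewrite ?gcdn_gt0 ?L0 ?dvdn_gcdl //.
    exact: (@period_gcd _ (fun i => aD (iter i nx g))).
  have := dvdn_leq j0 (dvdn_gcdr (order nx g) j); rewrite e3 eL; lia.
- case/trajectP => i _ e; have := pos_rP ga.
  by rewrite e pos_iter pg pg'.
Qed.

(** Pass to the reduced representative of the lowest level of [z]. It is nonzero at [src f] yet
    killed by [aV], so another support vertex would have to lie over the same vertex; it reads the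
    same word as [f], and [parallel_eq] identifies the two. *)
Lemma circle_trivial z : in_V V z -> z =1 (fun _ => 0).
Proof.
move=> hz p; apply/eqP/negPn/negP => nz.
have [p0 nz0 pmin] := @arg_minnP _ p (fun q => z q != 0) lev nz.
have p0V : bV p0 \in V.
  by apply: contraNT nz0; case: hz => h _ _ /h->.
have [f [fa pf sf]] := pos_out p0V.
have az : above_V (lev (src f)) z.
  split=> // q lq; apply/eqP/negPn/negP => nq.
  by move: (pmin q nq); rewrite leqNgt -sf lq.
have [y ry ey] := reduced_exists (subsp_V V) az.
have y0 : y (src f) != 0 by rewrite ey // sf.
case: (ry) => [[[_ /(_ (aV (src f))) ay _] _] _].
move: y0; rewrite -(push_single (f := aV) (w := y)) ?ay ?eqxx // => q eq nq.
have [g [ga sg hg]] := red_parallel N fa pf ry nq.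
have ew : word f = word g by apply: eq_word => i lt; rewrite hg // ltnW.
have [pg _] := word_lev fa ga pf ew.
by rewrite -sg (parallel_eq fa ga pf pg) // sg eq.
Qed.

End Circle.

(** Trimming lowers #|V|; once no leaf is left the circle case applies. *)
Lemma config_trivial V D : config V D -> forall z, in_V V z -> z =1 (fun _ => 0).
Proof.
elim: {V}_.+1 {-2}V (ltnSn #|V|) D => // n IH V lt D cf.
case: (classic (exists2 v, v \in V & #|[set d in D | tG d == v]| = 1%N)) => [[v vV]|no].
  move/eqP/cards1P => [d0 e].
  have /andP[d0D /eqP td0] : (d0 \in D) && (tG d0 == v).
    by have /setP/(_ d0) := e; rewrite !inE eqxx.
  have leaf d : d \in D -> tG d = v -> d = d0.
    by move=> dD td; have /setP/(_ d) := e; rewrite !inE dD td eqxx => /esym/eqP.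
  apply: (trim_V cf leaf).
  apply: IH (trim_config cf d0D td0 leaf).
  by move: lt; rewrite (cardsD1 v V) vV; lia.
have noleaf v : v \in V -> #|[set d in D | tG d == v]| <> 1%N by move=> vV e; apply: no; exists v.
have [N N0 per] := finite_order (nx_inj cf noleaf).
exact: (circle_trivial cf noleaf N0 per).
Qed.

Lemma config_E_trivial V D : config V D -> forall e x, in_E D e x -> x =1 (fun _ => 0).
Proof. by move=> cf; apply: in_E_trivial (config_trivial cf). Qed.

End Core.

(** * Euler characteristic and the mapping cone *)

Section Orientation.
Local Open Scope ring_scope.
Variables (D : finType) (rv : D -> D).
Hypotheses (rvK : involutive rv) (rvN : forall d, rv d != d).

Definition ori (d : D) := (enum_rank d < enum_rank (rv d))%N.

Lemma ori_rv d : ori (rv d) = ~~ ori d.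
Proof.
rewrite /ori /= rvK -leqNgt ltn_neqAle; case: eqP => // /val_inj/enum_rank_inj e.
by have := rvN d; rewrite e eqxx.
Qed.

Lemma card_ori (A : {set D}) : (forall d, d \in A -> rv d \in A) ->
  #|A| = (2 * #|[set d in A | ori d]|)%N.
Proof.
move=> Ar; rewrite -(cardsID [set d | ori d] A) mul2n -addnn; congr (_ + _)%N.
  by apply: eq_card => d; rewrite !inE.
rewrite -(card_imset _ (can_inj rvK)); apply: eq_card => d.
rewrite !inE; apply/imsetP/andP => [[d' + ->]|[dA od]].
  by rewrite !inE ori_rv => /andP[-> /Ar->].
exists (rv d); rewrite ?rvK // !inE ori_rv od /=; exact: Ar.
Qed.

Lemma anti_expand (A : {set D}) w d : (forall d, d \in A -> rv d \in A) ->
  anti rv w -> (forall d, d \notin A -> w d = 0) ->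
  w d = \sum_(i : {d | d \in [set d in A | ori d]}) w (val i) * (delta (val i) d - delta (rv (val i)) d).
Proof.
move=> Ar aw sw; set O := [set d in A | ori d].
have h x : x \in O ->
   w x = \sum_(i : {d | d \in O}) w (val i) * (delta (val i) x - delta (rv (val i)) x).
  move=> xO; rewrite (bigD1 (exist _ x xO)) //= /delta eqxx (negPf (rvN x)) subr0 mulr1.
  rewrite big1 ?addr0 // => i ne; have iO : val i \in O := valP i.
  have -> : (val i == x) = false by apply: contraNF ne => /eqP e; apply/eqP/val_inj.
  have -> : (rv (val i) == x) = false.
    apply/eqP => e; move: (xO) (iO); rewrite !inE -e ori_rv => /andP[_ /negPf->].
    by rewrite andbF.
  by rewrite subrr mulr0.
case: (boolP (d \in A)) => dA; last first.
  rewrite sw // big1 // => i _; have := valP i : val i \in O; rewrite inE => /andP[iA _].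
  have ne x : x \in A -> (x == d) = false by move=> xA; apply: contraNF dA => /eqP<-.
  by rewrite /delta !ne ?Ar // subrr mulr0.
case od: (ori d); first by apply: h; rewrite inE dA.
have rO : rv d \in O by rewrite inE Ar //= ori_rv od.
rewrite -[d]rvK aw h // -sumrN; apply: eq_bigr => i _; rewrite rvK -mulrN; congr (_ * _).
rewrite /delta opprB; congr (_%:R - _%:R).
  by rewrite (inj_eq (can_inj rvK)).
by rewrite (can2_eq rvK rvK).
Qed.

End Orientation.

Section Cone.
Local Open Scope ring_scope.
Variables (V D V' D' : finType) (rv : D -> D) (rv' : D' -> D') (tg : D -> V) (tg' : D' -> V').
Hypotheses (rvK : involutive rv) (rvN : forall d, rv d != d).
Hypotheses (rvK' : involutive rv') (rvN' : forall d, rv' d != d).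
Variables (f : D -> D') (g : V -> V') (A : {set D}) (B : {set V}) (A' : {set D'}) (B' : {set V'}).
Hypothesis Ar : forall d, d \in A -> rv d \in A.
Hypothesis Ar' : forall d, d \in A' -> rv' d \in A'.
Hypothesis AB' : forall d, d \in A' -> tg' d \in B'.
Hypothesis gB : forall v, v \in B -> g v \in B'.

(* If the mapping cone of [f] is exact in the middle, then comparing dimensions
   compares Euler characteristics and detects injectivity on [H_1]. *)
Lemma cone_count :
  (forall a c, (forall v, v \notin B -> a v = 0) -> anti rv' c ->
     (forall d, d \notin A' -> c d = 0) -> push g a =1 push tg' c -> exists w, [/\ anti rv w, forall d, d \notin A -> w d = 0,
       push tg w =1 a & push f w =1 c]) ->
  (2 * #|B| + #|A'| <= #|A| + 2 * #|B'|)%N /\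
  ((#|A| + 2 * #|B'| <= 2 * #|B| + #|A'|)%N -> forall w, anti rv w ->
     (forall d, d \notin A -> w d = 0) -> push tg w =1 (fun _ => 0) ->
     push f w =1 (fun _ => 0) -> w =1 (fun _ => 0)).
Proof.
move=> ex.
(* The mapping cone C_1 -> C_0 + C_1' -> C_0' in coordinates, with one oriented dart per edge. *)
pose I : finType := {d | d \in [set d in A | ori rv d]}.
pose O' : finType := {d | d \in [set d in A' | ori rv' d]}.
pose K : finType := {v | v \in B'}.
pose J : finType := ({v | v \in B} + O')%type.
pose e1 (i : I) d := delta (val i) d - delta (rv (val i)) d.
pose e2 (i : O') d := delta (val i) d - delta (rv' (val i)) d.
pose F (i : I) (j : J) := match j with
  | inl v => push tg (e1 i) (val v) | inr e => push f (e1 i) (val e) end.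
pose G (j : J) (k : K) := match j with
  | inl v => delta (g (val v)) (val k) | inr e => - push tg' (e2 e) (val k) end.
have cI : #|A| = (2 * #|I|)%N by rewrite (card_ori rvK rvN Ar) card_sig; congr (2 * _)%N; apply: eq_card => d; rewrite !inE.
have cO : #|A'| = (2 * #|O'|)%N by rewrite (card_ori rvK' rvN' Ar') card_sig; congr (2 * _)%N; apply: eq_card => d; rewrite !inE.
have cK : #|K| = #|B'| by rewrite card_sig; apply: eq_card => d; rewrite !inE.
have cJ : #|J| = (#|B| + #|O'|)%N.
  by rewrite card_sum card_sig; congr (_ + _)%N; apply: eq_card => d; rewrite !inE.
have exp w : anti rv w -> (forall d, d \notin A -> w d = 0) ->
    w =1 (fun d => \sum_(i : I) w (val i) * e1 i d).
  by move=> aw sw d; apply: anti_expand.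
have Fw w : anti rv w -> (forall d, d \notin A -> w d = 0) -> forall j,
    \sum_i w (val i) * F i j = match j with
      inl v => push tg w (val v) | inr e => push f w (val e) end.
  move=> aw sw [v|e]; by rewrite (push_ext _ (exp w aw sw)) push_sum.
have [|le inj] := @exact_count I J K F G.
  move=> y hy.
  pose a v := if insub v is Some v' then y (inl v') else 0.
  pose c d := \sum_(i : O') y (inr i) * e2 i d.
  have ac : anti rv' c by apply: anti_sum => i; apply: anti_delta.
  have sa v : v \notin B -> a v = 0 by move=> nB; rewrite /a insubN.
  have sc d : d \notin A' -> c d = 0.
    move=> nd; apply: big1 => i _; have := valP i : val i \in _; rewrite inE => /andP[iA _].
    have ne x : x \in A' -> (x == d) = false by move=> xA; apply: contraNF nd => /eqP<-.
    by rewrite /e2 /delta !ne ?Ar' // subrr mulr0.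
  have [k|w [aw sw tw fw]] := ex a c sa ac sc.
    case: (boolP (k \in B')) => kB; last first.
      rewrite !push0 // => [e ek|v vk]; first by apply: sc; apply: contra kB => /AB'; rewrite ek.
      by apply: sa; apply: contra kB => /gB; rewrite vk.
    move: (hy (exist _ k kB)); rewrite big_sumType /= => h.
    have -> : push g a k = \sum_(v : {v | v \in B}) y (inl v) * delta (g (val v)) k.
      rewrite /push (bigID (mem B)) /= [X in _ + X]big1 ?addr0 => [|v /andP[_ nB]]; last exact: sa.
      rewrite big_mkcondl /= (reindex_omap (val : {v | v \in B} -> V) insub) => [|v vB]; last first.
        by rewrite insubT.
      apply: eq_big => [v|v _]; first by rewrite valK eqxx (valP v).
      by rewrite /a valK /delta; case: eqP => _; rewrite ?mulr1 ?mulr0.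
    rewrite /c push_sum; apply/eqP; rewrite -subr_eq0 -[X in _ == X]h; apply/eqP.
    by congr (_ + _); rewrite -sumrN; apply: eq_bigr => i _; rewrite mulrN.
  exists (fun i => w (val i)) => j; rewrite Fw //.
  case: j => [v|e]; first by rewrite tw /a valK.
  rewrite fw /c (bigD1 e) //= /e2 /delta eqxx (negPf (rvN' _)) subr0 mulr1.
  rewrite big1 ?addr0 // => i ne.
  have -> : (val i == val e) = false by apply: contraNF ne => /eqP/val_inj->.
  have -> : (rv' (val i) == val e) = false.
    apply/eqP => h; have := valP e : val e \in _; have := valP i : val i \in _.
    rewrite !inE -h.
    by rewrite (ori_rv rvK' rvN') => /andP[_ ->]; rewrite andbF.
  by rewrite subrr mulr0.
split; first by lia.
move=> le2 w aw sw tw fw d; rewrite (exp w aw sw) big1 // => i _.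
rewrite (inj _ (fun i => w (val i))) ?mul0r //; first lia.
by move=> j; rewrite Fw //; case: j => x; rewrite ?tw ?fw.
Qed.

End Cone.

(** * Complete folding: the quotient by null-labelled walks *)

Section Quotient.
Variables (T : finType) (R : rel T).
Hypotheses (Rr : reflexive R) (Rs : symmetric R) (Rt : transitive R).

Definition qrep x := odflt x [pick y | R x y].

Lemma qrepR x : R x (qrep x).
Proof. by rewrite /qrep; case: pickP => //= _; apply: Rr. Qed.

Lemma qrep_eq x y : R x y -> qrep x = qrep y.
Proof.
move=> xy; have e : R x =1 R y.
  by move=> z; apply/idP/idP => h; [apply: Rt h; rewrite Rs | apply: Rt xy h].
by rewrite /qrep (eq_pick e); case: pickP => // /(_ y); rewrite Rr.
Qed.

Definition quot := {x : T | qrep x == x}.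

Lemma qrep_idem x : qrep (qrep x) == qrep x.
Proof. by rewrite eq_sym; apply/eqP/qrep_eq/qrepR. Qed.

Definition cls x : quot := exist _ (qrep x) (qrep_idem x).

Lemma cls_eq x y : cls x = cls y <-> R x y.
Proof.
split=> [[e]|/qrep_eq e]; last exact/val_inj.
by apply: Rt (qrepR x) _; rewrite e Rs qrepR.
Qed.

Lemma cls_val (y : quot) : cls (val y) = y.
Proof. by apply: val_inj => /=; apply/eqP/(valP y). Qed.

End Quotient.

Lemma quot_lift (T : finType) (R : rel T) (Rr : reflexive R) (Rs : symmetric R)
    (Rt : transitive R) (w : quot R -> rat) :
  exists w' : T -> rat, push (cls Rr Rs Rt) w' =1 w.
Proof.
exists (fun x => if qrep R x == x then w (cls Rr Rs Rt x) else 0%R) => y.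
rewrite /push (bigD1 (val y)) /=; last by rewrite cls_val.
rewrite (valP y) cls_val big1 ?addr0 // => x /andP[/eqP <-] /=.
by rewrite eq_sym => /negPf->.
Qed.

Lemma label_weq (V D DU : eqType) (rv : D -> D) (rvK : involutive rv) (tg : D -> V)
    (rU : DU -> DU) (rUK : involutive rU) (l : D -> DU) u s v :
  {morph l : d / rv d >-> rU d} ->
  (forall d d', tg d = tg d' -> l d = l d' -> d = d') ->
  walk_from_to rv tg u s v -> weq rU (map l s) [::] -> weq rv s [::].
Proof.
move=> lr imm ws ls; pose t := wreduce rv s.
have wt : walk_from_to rv tg u t v by apply: walk_red.
have est : weq rv t s by apply: weq_red.
have lt : weq rU (map l t) [::] by apply: weq_trans ls; apply: (weq_map rvK rUK lr).
apply: weq_trans (weq_sym est) _.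
case: (boolP (reducedw rU (map l t))) => [rl|nr].
  by move: lt; rewrite /weq (wreduce_id rl); case: (t).
have [s1 [a [b [s2 [et lab /eqP nab]]]]] := backtrack (wreduce_reduced rv s) nr.
move: wt; rewrite /t et => /walk_catP[x _]; rewrite !walk_cons => /and3P[_ /eqP ab _].
by case: nab; rewrite -[b]rvK; congr rv; apply: imm; rewrite // lr lab rUK.
Qed.

Section Bar.
Local Open Scope ring_scope.
Variables (DU : finType) (rU : DU -> DU) (rUK : involutive rU).
Variables (V D : finType) (rv : D -> D) (tg : D -> V) (l : D -> DU).
Hypotheses (rvK : involutive rv) (lr : {morph l : d / rv d >-> rU d}).

(** The identification reached when folding is carried to its end. *)
Definition triv x y := exists s, walk_from_to rv tg x s y /\ weq rU (map l s) [::].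

Lemma triv_refl x : triv x x.
Proof. by exists [::]; rewrite walk0. Qed.

Lemma triv_sym x y : triv x y -> triv y x.
Proof.
case=> s [ws ls]; exists (inv_walk rv s); split; first exact: walk_inv.
by rewrite (inv_walk_map _ lr); apply: (weq_inv rUK ls).
Qed.

Lemma triv_trans x y z : triv x y -> triv y z -> triv x z.
Proof.
case=> s [ws ls] [t [wt lt]]; exists (s ++ t); split; first exact: walk_catI ws wt.
by rewrite map_cat; apply: (weq_cat rUK ls lt).
Qed.

Lemma triv_step d d' : l d = l d' -> triv (tg d) (tg d') -> triv (tg (rv d)) (tg (rv d')).
Proof.
move=> e [s [ws ls]]; exists (d :: s ++ [:: rv d']); split.
  by rewrite walk_cons eqxx /=; apply: walk_catI ws _; rewrite walk_cons walk0 rvK !eqxx.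
rewrite /= map_cat /= lr -e; apply: weq_trans (weq_cons rUK _ (weq_catr rUK _ ls)) _.
exact: (weq_cancel rUK _ [::]).
Qed.

Variable eqv : rel V.
Hypothesis eqvP : forall x y, eqv x y <-> triv x y.

Lemma eqv_refl : reflexive eqv. Proof. by move=> x; apply/eqvP/triv_refl. Qed.
Lemma eqv_sym : symmetric eqv.
Proof. by move=> x y; apply/idP/idP => /eqvP/triv_sym/eqvP. Qed.
Lemma eqv_trans : transitive eqv.
Proof. by move=> y x z /eqvP h1 /eqvP h2; apply/eqvP/(triv_trans h1). Qed.

(** A folded dart is its label together with its folded target, so the quotient is immersed by
    construction ([bar_imm]). *)
Definition eqd d d' := (l d == l d') && eqv (tg d) (tg d').

Lemma eqd_refl : reflexive eqd. Proof. by move=> d; rewrite /eqd eqxx eqv_refl. Qed.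
Lemma eqd_sym : symmetric eqd.
Proof. by move=> d d'; rewrite /eqd eq_sym eqv_sym. Qed.
Lemma eqd_trans : transitive eqd.
Proof. by move=> d2 d1 d3 /andP[/eqP e1 h1] /andP[/eqP e2 h2]; rewrite /eqd e1 e2 eqxx (eqv_trans h1). Qed.

Definition barV := quot eqv.
Definition barD := quot eqd.
Definition clV : V -> barV := cls eqv_refl eqv_sym eqv_trans.
Definition clD : D -> barD := cls eqd_refl eqd_sym eqd_trans.
Definition bar_rv (d : barD) : barD := clD (rv (val d)).
Definition bar_tg (d : barD) : barV := clV (tg (val d)).
Definition bar_l (d : barD) : DU := l (val d).

Lemma clV_eq x y : clV x = clV y <-> triv x y.
Proof.
split=> h; first by apply/eqvP; apply: (iffLR (cls_eq eqv_refl eqv_sym eqv_trans x y)) h.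
by apply: (iffRL (cls_eq eqv_refl eqv_sym eqv_trans x y)); apply/eqvP.
Qed.

Lemma clD_eq d d' : clD d = clD d' <-> l d = l d' /\ triv (tg d) (tg d').
Proof.
have cE := cls_eq eqd_refl eqd_sym eqd_trans d d'.
split=> [/(iffLR cE)/andP[/eqP e /eqvP h]|[e h]] //.
by apply: (iffRL cE); rewrite /eqd e eqxx; apply/eqvP.
Qed.

Lemma clD_val d : clD (val d) = d. Proof. exact: cls_val. Qed.
Lemma clV_val x : clV (val x) = x. Proof. exact: cls_val. Qed.

Lemma val_clD d : l (val (clD d)) = l d /\ triv (tg (val (clD d))) (tg d).
Proof. by apply/clD_eq; rewrite clD_val. Qed.

Lemma val_clV x : triv (val (clV x)) x.
Proof. by apply/clV_eq; rewrite clV_val. Qed.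

Lemma bar_rvE d : bar_rv (clD d) = clD (rv d).
Proof.
have [e h] := val_clD d; apply/clD_eq; split; first by rewrite !lr e.
exact: triv_step.
Qed.

Lemma bar_tgE d : bar_tg (clD d) = clV (tg d).
Proof. by have [_ h] := val_clD d; apply/clV_eq. Qed.

Lemma bar_lE d : bar_l (clD d) = l d.
Proof. by have [] := val_clD d. Qed.

Lemma bar_rvK : involutive bar_rv.
Proof. by move=> d; rewrite -[d]clD_val !bar_rvE rvK. Qed.

Lemma bar_lr : {morph bar_l : d / bar_rv d >-> rU d}.
Proof. by move=> d; rewrite -[d]clD_val bar_rvE !bar_lE lr. Qed.

Lemma bar_imm d d' : bar_tg d = bar_tg d' -> bar_l d = bar_l d' -> d = d'.
Proof. by move=> /clV_eq h e; rewrite -[d]clD_val -[d']clD_val; apply/clD_eq. Qed.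

Local Notation walk := (walk_from_to rv tg).
Local Notation bwalk := (walk_from_to bar_rv bar_tg).

Lemma bar_walk x s y : walk x s y -> bwalk (clV x) (map clD s) (clV y).
Proof. by apply: walk_map => d; rewrite ?bar_rvE ?bar_tgE. Qed.

Lemma triv_chain x s y : walk x s y -> weq rU (map l s) [::] ->
  push clD (chain rv s) =1 (fun _ => 0).
Proof.
move=> ws ls d; rewrite (push_chain _ rvK bar_rvK) => [|e]; last by rewrite bar_rvE.
rewrite (chain_weq bar_rvK (t := [::])) ?chain_nil //.
apply: (label_weq bar_rvK rUK bar_lr bar_imm (bar_walk ws)).
by rewrite -map_comp (eq_map (g := l)) // => e /=; rewrite bar_lE.
Qed.

(** Consecutive darts lift after inserting null-labelled detours, which change neither the label
    class nor the folded chain. Only the class of the endpoint is prescribed. *)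
Lemma bar_lift x s y : bwalk (clV x) s y -> exists t z, [/\ walk x t z, clV z = y,
  weq rU (map l t) (map bar_l s) & push clD (chain rv t) =1 chain bar_rv s].
Proof.
elim: s x => [|d s IH] x.
  rewrite walk0 => /eqP<-; exists [::], x; rewrite walk0; split=> // e.
  by rewrite push0 => [|*]; rewrite chain_nil.
rewrite walk_cons -[d]clD_val bar_rvE !bar_tgE => /andP[/eqP/esym/clV_eq[r [wr lr0]] /IH].
set d' := val d => -[t [z [wt ez lt ct]]].
exists (r ++ d' :: t), z; split=> //.
- by apply: walk_catI wr _; rewrite walk_cons eqxx.
- rewrite map_cat /= bar_lE; apply: weq_trans (weq_catr rUK _ lr0) _.
  exact: (weq_cons rUK).
- move=> e; rewrite (push_ext _ (chain_cat rv r (d' :: t))) pushD (triv_chain wr lr0) add0r.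
  rewrite (push_ext _ (chain_cons rvK d' t)) pushD ct pushD pushN !push_delta.
  by rewrite (chain_cons bar_rvK) bar_rvE.
Qed.

Lemma bar_anti_lift w : anti bar_rv w -> exists2 w', anti rv w' & push clD w' =1 w.
Proof.
move=> aw; have [w0 h0] := quot_lift eqd_refl eqd_sym eqd_trans w.
exists (fun d => 2^-1 * (w0 d - w0 (rv d))).
  by move=> d; rewrite rvK -mulrN opprB.
move=> d; rewrite pushZ pushD pushN.
have -> : push clD (w0 \o rv) d = push clD w0 (bar_rv d).
  rewrite [RHS]/push (reindex_inj (can_inj rvK)) /=; apply: eq_bigl => e.
  by rewrite -bar_rvE (inj_eq (can_inj bar_rvK)).
by rewrite !h0 aw; field.
Qed.

(** Move every vertex to the representative of its class along a null-labelled walk; the chains of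
    these walks die in the quotient by [triv_chain]. [P] confines the result to a union of
    components. *)
Lemma bar_kernel (P : pred V) z : (forall d, P (tg (rv d)) = P (tg d)) ->
  (forall x, ~~ P x -> z x = 0) -> push clV z =1 (fun _ => 0) ->
  exists k, [/\ anti rv k, forall d, ~~ P (tg d) -> k d = 0, push tg k =1 z
    & push clD k =1 (fun _ => 0)].
Proof.
move=> Pinv sz z0.
have /fin_all_exists[s hs] : forall x, exists s, walk (val (clV x)) s x /\ weq rU (map l s) [::].
  by move=> x; case: (val_clV x) => s h; exists s.
have sP u t v d : walk u t v -> P v -> ~~ P (tg d) -> chain rv t d = 0.
  elim: t u => [|e t IH] u; first by rewrite chain_nil.
  rewrite walk_cons => /andP[_ w] Pv nd; rewrite (chain_cons rvK) (IH _ w) // /delta.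
  have Pe : P (tg e).
    elim: t (tg e) w {IH} => [|e' t IH] y; first by rewrite walk0 => /eqP->.
    by rewrite walk_cons => /andP[/eqP<- /IH]; rewrite Pinv.
  have -> : (e == d) = false by apply: contraNF nd => /eqP<-.
  have -> : (rv e == d) = false by apply: contraNF nd => /eqP<-; rewrite Pinv.
  by rewrite subrr.
exists (fun d => \sum_x z x * chain rv (s x) d); split.
- by apply: anti_sum => x; apply: chain_anti.
- move=> d nd; apply: big1 => x _; case: (boolP (P x)) => Px; last by rewrite sz // mul0r.
  by have [ws _] := hs x; rewrite (sP _ _ _ _ ws) ?mulr0.
- move=> y; rewrite push_sum.
  rewrite (eq_bigr (fun x => z x * delta x y - z x * delta (val (clV x)) y)) => [|x _]; last first.
    by rewrite -mulrBr; congr (_ * _); case: (hs x) => ws _; apply: bd_chain ws.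
  rewrite sumrB sum_coords -[RHS]subr0; congr (_ - _).
  rewrite (partition_big clV xpredT) //; apply: big1 => c _.
  rewrite (eq_bigr (fun x => z x * delta (val c) y)) => [|x /eqP->] //.
  by rewrite -mulr_suml -/(push clV z c) z0 mul0r.
- move=> d; rewrite push_sum big1 // => x _; case: (hs x) => ws ls.
  by rewrite (triv_chain ws ls) mulr0.
Qed.

End Bar.

Lemma prop_rel (T : finType) (P : T -> T -> Prop) :
  exists R : rel T, forall x y, R x y <-> P x y.
Proof.
have [A hA] := prop_set (fun u : T * T => P u.1 u.2).
by exists (fun x y => (x, y) \in A) => x y; apply: (hA (x, y)).
Qed.

(** * Forests from vanishing first homology *)

Lemma shorter_loop (V D : eqType) (rv : D -> D) (tg : D -> V) s u :
  reducedw rv s -> walk_from_to rv tg u s u -> s != [::] ->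
  exists v t, [/\ reducedw rv t, walk_from_to rv tg v t v, t != [::]
    & forall v' t', reducedw rv t' -> walk_from_to rv tg v' t' v' -> t' != [::] ->
      (size t <= size t')%N].
Proof.
elim: {s}_.+1 {-2}s (ltnSn (size s)) u => // n IH s lt u rs ws s0.
case: (classic (exists v t, [/\ reducedw rv t, walk_from_to rv tg v t v, t != [::]
    & (size t < size s)%N])) => [[v [t [rt wt t0 ltt]]]|no].
  by apply: (IH t _ v) => //; lia.
exists u, s; split=> // v t rt wt t0; rewrite leqNgt; apply/negP => h.
by apply: no; exists v, t.
Qed.

Lemma reducedw_cat (D : eqType) (rv : D -> D) s t :
  reducedw rv (s ++ t) -> reducedw rv s /\ reducedw rv t.
Proof. by move=> h; have [] := cat_sorted2 h. Qed.

Section Forest.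
Local Open Scope ring_scope.
Variables (V D : finType) (rv : D -> D) (tg : D -> V).
Hypotheses (rvK : involutive rv) (rvN : forall d, rv d != d).
Hypothesis acyclic : forall w, anti rv w -> push tg w =1 (fun _ => 0) -> w =1 (fun _ => 0).

(** A shortest reduced closed walk meets its first edge only once, so its chain is a nonzero
    cycle. *)
Lemma forest u s : reducedw rv s -> walk_from_to rv tg u s u -> s = [::].
Proof.
move=> rs ws; apply/eqP/negPn/negP => s0.
have [v [t [rt wt t0 tmin]]] := shorter_loop rs ws s0.
have inner t1 t2 t3 y : t = t1 ++ t2 ++ t3 -> walk_from_to rv tg y t2 y -> t2 != [::] ->
    t1 ++ t3 = [::].
  move=> e wy n0; move: rt; rewrite e => /reducedw_cat[_ /reducedw_cat[r2 _]].
  have := tmin _ _ r2 wy n0; rewrite e !size_cat => le.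
  by apply/nilP; rewrite /nilp size_cat; apply/eqP; lia.
case: t rt wt t0 tmin inner => // d t rt wt _ tmin inner.
have w0 := acyclic (chain_anti rvK (d :: t)) (fun x => etrans (bd_chain rvK x wt) (subrr _)) d.
have dt : d \notin t.
  apply/negP => dt; case/splitPr: dt rt wt w0 tmin inner => t1 t2 rt wt _ tmin inner.
  have wt' := wt; move: wt'; rewrite walk_cons => /andP[/eqP sd /walk_catP[y wy]].
  rewrite walk_cons => /andP[/eqP ey _].
  have : [::] ++ d :: t2 = [::].
    apply: (inner [::] (d :: t1) (d :: t2) v) => //.
    by rewrite walk_cons sd eqxx /=; move: wy; rewrite -ey sd.
  by [].
have rdt : rv d \notin t.
  apply/negP => dt'; case/splitPr: dt' rt wt w0 tmin inner dt => t1 t2 rt wt _ tmin inner _.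
  have wt' := wt; move: wt'; rewrite walk_cons => /andP[/eqP sd /walk_catP[y wy]].
  rewrite walk_cons rvK => /andP[/eqP ey _].
  case: t1 rt wt tmin inner wy => [|e t1] rt wt tmin inner wy.
    by move: rt; rewrite /= eqxx.
  have : [:: d] ++ (rv d :: t2) = [::]; last by [].
  by apply: (inner [:: d] (e :: t1) (rv d :: t2) y) => //; move: wy; rewrite ey.
move: w0; rewrite /chain /= eqxx (count_memPn dt) (count_memPn rdt) eq_sym.
by rewrite (negPf (rvN d)) /= subr0 => /eqP; rewrite oner_eq0.
Qed.

End Forest.

(** * The page graph, its folding, and the forest of 2-cells *)

Section Pages.
Local Open Scope ring_scope.
Variables (DU : finType) (rU : DU -> DU).
Hypotheses (rUK : involutive rU) (rUN : forall d, rU d != d).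
Variables (VG DG : finType) (rG : DG -> DG) (tG : DG -> VG) (lG : DG -> DU).
Hypotheses (rGK : involutive rG) (lGr : {morph lG : d / rG d >-> rU d}).
Variable inR : pred VG.
Hypothesis inR_rev : forall d, inR (tG (rG d)) = inR (tG d).
Variables (VP DP : finType) (rP : DP -> DP) (tP : DP -> VP).
Hypothesis rPK : involutive rP.
Variables (aV bV : VP -> VG) (aD bD : DP -> DG).
Hypotheses (aDr : {morph aD : f / rP f >-> rG f}) (bDr : {morph bD : f / rP f >-> rG f}).
Hypotheses (aDt : forall f, tG (aD f) = aV (tP f)) (bDt : forall f, tG (bD f) = bV (tP f)).
Hypothesis ab_label : forall f, lG (aD f) = lG (bD f).
Hypotheses (aV_out : forall p, ~~ inR (aV p)) (bV_in : forall p, inR (bV p)).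
Hypothesis cover : forall p h, tG h = bV p -> exists2 f, tP f = p & bD f = h.
Hypothesis aD_loc : forall f f', tP f = tP f' -> aD f = aD f' -> f = f'.
Hypothesis fillP : forall z, push bV z =1 (fun _ => 0) ->
  exists w, [/\ anti rP w, push tP w =1 z & push bD w =1 (fun _ => 0)].
Hypothesis h1 : forall w, anti rG w -> (forall d, inR (tG d) -> w d = 0) ->
  push tG w =1 (fun _ => 0) -> push lG w =1 (fun _ => 0) -> w =1 (fun _ => 0).
Hypothesis countR : (#|[set d | inR (tG d)]| <= 2 * #|[set v | inR v]|)%N.
Hypothesis loopR : forall v, inR v -> exists s, walk_from_to rG tG v s v /\
  ~ weq rU (map lG s) [::].
Variables (I : eqType) (comp : VP -> I) (p0 : I -> VP) (g : I -> seq DP).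
Hypothesis walk_g : forall i, walk_from_to rP tP (p0 i) (g i) (p0 i).
Hypothesis path_p : forall p, exists s, walk_from_to rP tP (p0 (comp p)) s p.
Hypothesis cyc : forall i s, walk_from_to rP tP (p0 i) s (p0 i) ->
  exists n : int, weq rP s (wzpow rP (g i) n).
Hypothesis indiv : forall i z j, walk_from_to rG tG (aV (p0 i)) z (aV (p0 i)) ->
  weq rG (wpow z j) (map aD (g i)) -> j = 1%N.
Hypothesis nonconj : forall i i' w, i != i' ->
  walk_from_to rG tG (aV (p0 i)) w (aV (p0 i')) ->
  ~ weq rG (map aD (g i)) (w ++ map aD (g i') ++ inv_walk rG w) /\
  ~ weq rG (map aD (g i)) (w ++ inv_walk rG (map aD (g i')) ++ inv_walk rG w).

Let lP f := lG (aD f).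
Hypothesis bD_glob : forall f f', bD f = bD f' -> triv rU rP tP lP (tP f) (tP f') -> f = f'.

Lemma lPr_ : {morph lP : f / rP f >-> rU f}.
Proof. by move=> f; rewrite /lP aDr lGr. Qed.

Lemma rGN d : rG d != d.
Proof. by apply: contraNneq (rUN (lG d)) => e; rewrite -lGr e. Qed.

Lemma rPN f : rP f != f.
Proof. by apply: contraNneq (rUN (lP f)) => e; rewrite -lPr_ e. Qed.

Lemma map_lP s : map lG (map aD s) = map lP s. Proof. by rewrite -map_comp. Qed.

Lemma map_lPb s : map lG (map bD s) = map lP s.
Proof. by rewrite -map_comp; apply: eq_map => f; rewrite /= -ab_label. Qed.

Lemma walk_aD p s p' : walk_from_to rP tP p s p' ->
  walk_from_to rG tG (aV p) (map aD s) (aV p').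
Proof. exact: walk_map. Qed.

Lemma walk_bD p s p' : walk_from_to rP tP p s p' ->
  walk_from_to rG tG (bV p) (map bD s) (bV p').
Proof. exact: walk_map. Qed.

Lemma triv_a p p' : triv rU rP tP lP p p' -> triv rU rG tG lG (aV p) (aV p').
Proof. by case=> s [ws ls]; exists (map aD s); rewrite map_lP; split=> //; apply: walk_aD. Qed.

Lemma triv_b p p' : triv rU rP tP lP p p' -> triv rU rG tG lG (bV p) (bV p').
Proof. by case=> s [ws ls]; exists (map bD s); rewrite map_lPb; split=> //; apply: walk_bD. Qed.

Lemma inR_walk u s v : walk_from_to rG tG u s v -> inR u = inR v.
Proof.
elim: s u => [|d s IH] u; first by rewrite walk0 => /eqP->.
by rewrite walk_cons => /andP[/eqP<- /IH<-].
Qed.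

Lemma inR_walk_all u s v : walk_from_to rG tG u s v -> all (fun d => inR (tG d) == inR u) s.
Proof.
elim: s u => // d s IH u; rewrite walk_cons => /andP[/eqP<- /IH /= h].
by rewrite inR_rev eqxx.
Qed.

Lemma bD_lift p s v : walk_from_to rG tG (bV p) s v -> exists t p',
  [/\ walk_from_to rP tP p t p', map bD t = s & bV p' = v].
Proof.
elim: s p => [|d s IH] p; first by rewrite walk0 => /eqP<-; exists [::], p; rewrite walk0.
rewrite walk_cons => /andP[/eqP e ws]; have [f tf bf] := cover e.
have h : tG d = bV (tP (rP f)) by rewrite -bDt bDr bf rGK.
rewrite h in ws; have [t [p' [wt mt ep]]] := IH _ ws.
exists (rP f :: t), p'; split=> //; last by rewrite /= bDr bf rGK mt.
by rewrite walk_cons rPK tf eqxx.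
Qed.

Lemma pi1_G u s : ~~ inR u -> walk_from_to rG tG u s u -> weq rU (map lG s) [::] ->
  weq rG s [::].
Proof.
move=> uR ws; apply: (pi1_inj rGK rGN rUK rUN lGr (A := [set d | ~~ inR (tG d)]) _ _ ws).
- by move=> d; rewrite !inE inR_rev.
- by move=> w aw sw; apply: h1 => // d dR; apply: sw; rewrite inE negbK.
- apply/allP => d /(allP (inR_walk_all ws)); rewrite /= inE => /eqP->; exact: uR.
Qed.

Lemma weq_G u s t v : ~~ inR u -> walk_from_to rG tG u s v -> walk_from_to rG tG u t v ->
  weq rU (map lG s) (map lG t) -> weq rG s t.
Proof.
move=> uR ws wt e; apply: (@weq_catIr _ _ rGK (inv_walk rG t)).
apply: weq_trans (weq_sym (weq_invr rGK t)); apply: (pi1_G uR).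
  by apply: walk_catI ws _; apply: walk_inv.
rewrite map_cat (inv_walk_map _ lGr); apply: weq_trans (weq_catr rUK _ e) _.
exact: weq_invr.
Qed.

Variables (eqG : rel VG) (eqP' : rel VP).
Hypothesis eqGP : forall x y, eqG x y <-> triv rU rG tG lG x y.
Hypothesis eqPP : forall x y, eqP' x y <-> triv rU rP tP lP x y.

Let qG := clV rUK rGK lGr eqGP.
Let qGd := clD rUK rGK lGr eqGP.
Let qP := clV rUK rPK lPr_ eqPP.
Let qPd := clD rUK rPK lPr_ eqPP.
Let rG' := bar_rv rUK rGK lGr eqGP.
Let tG' := bar_tg rUK rGK lGr eqGP.
Let lG' := @bar_l DU VG DG tG lG eqG.
Let rP' := bar_rv rUK rPK lPr_ eqPP.
Let tP' := bar_tg rUK rPK lPr_ eqPP.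
Let lP' := @bar_l DU VP DP tP lP eqP'.
Let bVG := barV eqG.
Let bDG := barD tG lG eqG.
Let bVP := barV eqP'.
Let bDP := barD tP lP eqP'.

Let aV' (p : bVP) : bVG := qG (aV (val p)).
Let bV' (p : bVP) : bVG := qG (bV (val p)).
Let aD' (f : bDP) : bDG := qGd (aD (val f)).
Let bD' (f : bDP) : bDG := qGd (bD (val f)).

Lemma aVE p : aV' (qP p) = qG (aV p).
Proof. by apply/clV_eq/triv_a/val_clV. Qed.
Lemma bVE p : bV' (qP p) = qG (bV p).
Proof. by apply/clV_eq/triv_b/val_clV. Qed.
Lemma aDE f : aD' (qPd f) = qGd (aD f).
Proof.
have [e t] := val_clD rUK rPK lPr_ eqPP f; apply/clD_eq; split; first exact: e.
by rewrite !aDt; apply: triv_a.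
Qed.
Lemma bDE f : bD' (qPd f) = qGd (bD f).
Proof.
have [e t] := val_clD rUK rPK lPr_ eqPP f; apply/clD_eq; split.
  by rewrite -!ab_label; apply: e.
by rewrite !bDt; apply: triv_b.
Qed.

Lemma qPdK f : qPd (val f) = f. Proof. exact: clD_val. Qed.
Lemma qPK p : qP (val p) = p. Proof. exact: clV_val. Qed.
Lemma qGK v : qG (val v) = v. Proof. exact: clV_val. Qed.
Lemma qGdK d : qGd (val d) = d. Proof. exact: clD_val. Qed.
Lemma rP'E f : rP' (qPd f) = qPd (rP f). Proof. exact: bar_rvE. Qed.
Lemma rG'E f : rG' (qGd f) = qGd (rG f). Proof. exact: bar_rvE. Qed.
Lemma tP'E f : tP' (qPd f) = qP (tP f). Proof. exact: bar_tgE. Qed.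
Lemma tG'E f : tG' (qGd f) = qG (tG f). Proof. exact: bar_tgE. Qed.
Lemma lG'E f : lG' (qGd f) = lG f. Proof. exact: bar_lE. Qed.
Lemma lP'E f : lP' (qPd f) = lP f. Proof. exact: bar_lE. Qed.

Lemma bar_aDr : {morph aD' : f / rP' f >-> rG' f}.
Proof. by move=> f; rewrite -[f]qPdK rP'E !aDE rG'E aDr. Qed.
Lemma bar_bDr : {morph bD' : f / rP' f >-> rG' f}.
Proof. by move=> f; rewrite -[f]qPdK rP'E !bDE rG'E bDr. Qed.
Lemma bar_aDt f : tG' (aD' f) = aV' (tP' f).
Proof. by rewrite -[f]qPdK tP'E aDE aVE tG'E aDt. Qed.
Lemma bar_bDt f : tG' (bD' f) = bV' (tP' f).
Proof. by rewrite -[f]qPdK tP'E bDE bVE tG'E bDt. Qed.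
Lemma bar_lPa f : lG' (aD' f) = lP' f.
Proof. by rewrite -[f]qPdK aDE lG'E lP'E. Qed.
Lemma bar_ab f : lG' (aD' f) = lG' (bD' f).
Proof. by rewrite -[f]qPdK aDE bDE !lG'E ab_label. Qed.
Lemma bar_immP f f' : tP' f = tP' f' -> lG' (aD' f) = lG' (aD' f') -> f = f'.
Proof. rewrite !bar_lPa; exact: bar_imm. Qed.

(** Lift [w] to unfolded pages and let [u] be its image. The boundary of [u] dies under folding, so
    [bar_kernel] gives a chain [k] with the same boundary that folding kills. Then u - k is a cycle
    with trivial label chain, zero by [h1], and [u] folds to zero. *)
Lemma bar_h1 w : anti rP' w -> push tG' (push aD' w) =1 (fun _ => 0) ->
  push lG' (push aD' w) =1 (fun _ => 0) -> push aD' w =1 (fun _ => 0).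
Proof.
move=> /bar_anti_lift[w0 aw0 e0] t0 l0.
have e1 : push aD' w =1 push qGd (push aD w0).
  move=> d; rewrite -(push_ext _ e0) !push_comp; apply: push_fun => f; exact: aDE.
pose u := push aD w0.
have au : anti rG u by apply: anti_push.
have su d : inR (tG d) -> u d = 0.
  by move=> dR; apply: push0 => f ef; have := aV_out (tP f); rewrite -aDt ef dR.
have y0 : push qG (push tG u) =1 (fun _ => 0).
  move=> v; rewrite -[RHS](t0 v) (push_ext _ e1) !push_comp.
  by apply: push_fun => d; rewrite /= tG'E.
have sy x : ~~ ~~ inR x -> push tG u x = 0.
  by move=> xR; apply: push0 => d ed; apply: su; rewrite ed -[inR x]negbK.
have Pinv d : ~~ inR (tG (rG d)) = ~~ inR (tG d) by rewrite inR_rev.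
have [k [ak sk tk qk]] := bar_kernel (P := [pred x | ~~ inR x]) Pinv sy y0.
have uk : u =1 k.
  move=> d; apply/eqP; rewrite -subr_eq0; apply/eqP.
  apply: (h1 (w := fun d => u d - k d)) => [|e eR|v|e].
  - exact: antiB.
  - by rewrite su // sk ?subr0 //= negbK.
  - by rewrite pushD pushN tk subrr.
  rewrite pushD pushN; have h x : push lG x e = push lG' (push qGd x) e.
    by rewrite push_comp; apply: push_fun => d' /=; rewrite lG'E.
  rewrite !h -(push_ext _ e1) l0 [push lG' (push _ k) e](_ : _ = 0) ?subr0 //.
  by apply: push0 => d' _; apply: qk.
by move=> d; rewrite e1 (push_ext _ uk) qk.
Qed.

(** To use [fillP], the lifted 0-chain must be killed by [bV] before folding: slide each vertex
    along a null-labelled page walk to one lying over the chosen representative of its image. *)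
Lemma bar_fill z : push bV' z =1 (fun _ => 0) ->
  exists w, [/\ anti rP' w, push tP' w =1 z & push bD' w =1 (fun _ => 0)].
Proof.
move=> bz; have [z0 ez] := quot_lift (eqv_refl eqPP) (eqv_sym rUK rPK lPr_ eqPP)
  (eqv_trans rUK eqPP) z.
have /fin_all_exists[r hr] : forall p, exists p', bV p' = val (qG (bV p)) /\ qP p' = qP p.
  move=> p; have [s [ws ls]] := triv_sym rUK rGK lGr (val_clV rUK rGK lGr eqGP (bV p)).
  have [t [p' [wt et ep]]] := bD_lift ws; exists p'; split; first exact: ep.
  apply/clV_eq/(triv_sym rUK rPK lPr_); exists t; split=> //.
  by rewrite -map_lPb et.
have [|w [aw tw bw]] := fillP (z := push r z0).
  move=> v; rewrite push_comp (push_fun (g := val \o bV' \o qP)) => [|p]; last first.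
    rewrite -[RHS]/(val (bV' (qP p))) bVE; exact: (hr p).1.
  rewrite -push_comp -push_comp; apply: push0 => c _; rewrite -[RHS](bz c).
  exact: push_ext.
exists (push qPd w); split.
- by apply: anti_push => // [|f]; [apply: bar_rvK | rewrite rP'E].
- move=> p; rewrite push_comp (push_fun (g := qP \o tP)) => [|f]; last exact: tP'E.
  rewrite -push_comp (push_ext _ tw) push_comp -[RHS]ez; apply: push_fun => x.
  exact: (hr x).2.
- move=> d; rewrite push_comp (push_fun (g := qGd \o bD)) => [|f]; last exact: bDE.
  by rewrite -push_comp push0.
Qed.

Lemma bar_cover p h : tG' h = bV' p -> exists2 f, tP' f = p & bD' f = h.
Proof.
rewrite -[p]qPK -[h]qGdK tG'E bVE => /clV_eq/(triv_sym rUK rGK lGr)[s [ws ls]].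
have [t [p' [wt et ep]]] := bD_lift ws.
have [f tf bf] := cover (esym ep); exists (qPd f); last by rewrite bDE bf.
rewrite tP'E tf; apply/clV_eq/(triv_sym rUK rPK lPr_); exists t; split=> //.
by rewrite -map_lPb et.
Qed.

Lemma inR_class v : inR (val (qG v)) = inR v.
Proof. by have [s [ws _]] := val_clV rUK rGK lGr eqGP v; apply: inR_walk ws. Qed.

Let RV := [set v : bVG | inR (val v)].
Let RD := [set d : bDG | inR (val (tG' d))].

(** Folding cannot lower the Euler characteristic, since the mapping cone of the folding map is
    exact in the middle. *)
Lemma bar_count : (#|RD| <= 2 * #|RV|)%N.
Proof.
pose A := [set d | inR (tG d)]; pose B := [set v | inR v].
have rN (d : bDG) : rG' d != d.
  by apply: contraNneq (rUN (lG' d)) => e; rewrite -(bar_lr rUK rGK lGr eqGP) -/rG' e.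
have inRE (d : bDG) : inR (val (tG' d)) = inR (tG (val d)) by rewrite inR_class.
have [|||||le _] := @cone_count _ _ _ _ rG rG' tG tG' rGK rGN (bar_rvK rUK rGK lGr eqGP) rN
  qGd qG A B RD RV.
- by move=> d; rewrite !inE inR_rev.
- by move=> d; rewrite !inE -[X in rG' X]qGdK rG'E tG'E inR_class inR_rev inRE.
- by move=> d; rewrite !inE.
- by move=> v; rewrite !inE inR_class.
- move=> a c sa ac sc eac; have [w0 aw0 e0] := bar_anti_lift ac.
  pose w1 d := if inR (tG d) then w0 d else 0.
  have aw1 : anti rG w1 by move=> d; rewrite /w1 inR_rev; case: ifP; rewrite ?oppr0.
  have e1 : push qGd w1 =1 c.
    move=> d; case: (boolP (d \in RD)) => dR.
      rewrite -[RHS]e0; apply: eq_bigr => d' /eqP ed.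
      by rewrite /w1; move: dR; rewrite inE -ed tG'E inR_class => ->.
    rewrite sc //; apply: push0 => d' ed; rewrite /w1; case: ifP => // h.
    by move: dR; rewrite inE -ed tG'E inR_class h.
  pose y v := a v - push tG w1 v.
  have sy v : ~~ inR v -> y v = 0.
    move=> nv; rewrite /y sa ?inE // push0 ?subrr // => d ed.
    by rewrite /w1 ed (negPf nv).
  have y0 : push qG y =1 (fun _ => 0).
    move=> v; rewrite pushD pushN eac -(push_ext _ e1) !push_comp.
    by apply/eqP; rewrite subr_eq0; apply/eqP/push_fun => d /=; rewrite tG'E.
  have [k [ak sk tk qk]] := bar_kernel inR_rev sy y0.
  exists (fun d => w1 d + k d); split.
  - exact: antiD.
  - by move=> d; rewrite inE => nd; rewrite sk // addr0 /w1 (negPf nd).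
  - by move=> v; rewrite pushD tk /y; ring.
  - by move=> d; rewrite pushD e1 qk addr0.
by move: countR; rewrite -/A -/B; lia.
Qed.

Lemma bar_loop (v : bVG) : v \in RV -> exists s, [/\ s != [::], reducedw rG' s,
  walk_from_to rG' tG' v s v & all (mem RD) s].
Proof.
rewrite inE => vR; have [s [ws ns]] := loopR vR.
have wb : walk_from_to rG' tG' v (map qGd s) v.
  by have := bar_walk rUK rGK lGr eqGP ws; rewrite -/(qG _) qGK.
have bK := bar_rvK rUK rGK lGr eqGP.
exists (wreduce rG' (map qGd s)); split.
- apply/eqP => e; apply: ns.
  have h : weq rG' (map qGd s) [::] by rewrite /weq e.
  have := weq_map bK rUK (bar_lr rUK rGK lGr eqGP) h.
  rewrite -map_comp (eq_map (g := lG)) // => d; exact: lG'E.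
- exact: wreduce_reduced.
- exact: walk_red.
- apply/allP => d /wreduce_subset/mapP[d1 ds ->]; rewrite /= inE tG'E inR_class.
  by move/(allP (inR_walk_all ws))/eqP: ds => ->.
Qed.

Lemma bar_config : config rG' tG' rP' tP' bV' bD' RV RD.
Proof.
have inRE (d : bDG) : inR (val (tG' d)) = inR (tG (val d)) by rewrite inR_class.
split.
- by move=> d; rewrite !inE -[X in rG' X]qGdK rG'E tG'E inR_class inR_rev inRE.
- by move=> d; rewrite !inE.
- by move=> p h _; apply: bar_cover.
- move=> z _ /bar_fill[w [aw tw bw]]; exists w; split=> // f.
  by rewrite inE bar_bDt -[f]qPdK tP'E bVE inR_class bV_in.
- exact: bar_count.
- exact: bar_loop.
Qed.

(* A closed walk of the quotient is homotopic to a power of the generating loop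
   of its component, and the exponent can be read off the chains. *)
Lemma loop_data (q : bVP) s : walk_from_to rP' tP' q s q ->
  exists t n r, [/\ walk_from_to rP tP (val q) t (val q), weq rU (map lP t) (map lP' s),
    walk_from_to rP tP (p0 (comp (val q))) r (val q),
    weq rP (r ++ t ++ inv_walk rP r) (wzpow rP (g (comp (val q))) n) &
    forall d, chain rP' s d = n%:~R * chain rP' (map qPd (g (comp (val q)))) d].
Proof.
rewrite -{1 2}[q]qPK => /bar_lift[t1 [p1 [w1 e1 l1 c1]]].
have [t2 [w2 l2]] : triv rU rP tP lP p1 (val q) by apply/(clV_eq rUK rPK lPr_ eqPP).
set p := val q in w1 w2 *; have [r wr] := path_p p.
have wt : walk_from_to rP tP p (t1 ++ t2) p by apply: walk_catI w1 w2.
have [|n en] := @cyc (comp p) (r ++ (t1 ++ t2) ++ inv_walk rP r).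
  by apply: (walk_catI wr); apply: (walk_catI wt); exact: (walk_inv rPK wr).
exists (t1 ++ t2), n, r; split=> //.
  rewrite map_cat; apply: weq_trans (weq_catl rUK _ l2) _; rewrite cats0; exact: l1.
have bK := bar_rvK rUK rPK lPr_ eqPP.
move=> d; have c2 := triv_chain rUK rPK lPr_ eqPP w2 l2.
have h : chain rP (t1 ++ t2) =1 (fun x => n%:~R * chain rP (g (comp p)) x).
  move=> x; have := chain_weq rPK en x; rewrite (chain_wzpow rPK) => <-.
  by rewrite !chain_cat (chain_inv rPK); ring.
rewrite -(push_chain (f := qPd) _ rPK bK) => [|f]; last by rewrite -rP'E.
rewrite -pushZ -(push_ext _ h) (push_ext _ (chain_cat rP t1 t2)) pushD c2 addr0.
by rewrite c1.
Qed.

Lemma chain_int (D : finType) (rv : D -> D) s d :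
  chain rv s d = ((count_mem d s)%:Z - (count_mem (rv d) s)%:Z)%:~R :> rat.
Proof. by rewrite /chain intrB. Qed.

Lemma unit_exponent (n : int) (D : finType) (rv : D -> D) s d :
  n%:~R * chain rv s d = 1 -> n = 1 \/ n = -1.
Proof.
rewrite chain_int -intrM; set m := (_ - _ : int) => /eqP.
rewrite -[1]/(1%:~R) eqr_int => /eqP h.
have := congr1 absz h; rewrite abszM /= => /eqP; rewrite muln_eq1 => /andP[/eqP h1' _].
by case: n h h1' => [[|[|k]]|[|k]] //=; [left | right].
Qed.

Lemma simple_chain (D : finType) (rv : D -> D) d s : d \notin s -> rv d \notin d :: s ->
  chain rv (d :: s) d = 1.
Proof.
by move=> h1' h2; rewrite /chain (count_memPn h2) /= eqxx (count_memPn h1') subr0.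
Qed.

Lemma weq_aD s t : weq rP s t -> weq rG (map aD s) (map aD t).
Proof. exact: weq_map. Qed.

(** By [loop_data] the walk is, up to conjugacy, a power [n] of the generator [g i]; a simple walk
    has coefficient 1 at [d0], so [n] is 1 or -1. If its image is the [j]-th power of a loop, so is,
    by injectivity on pi_1, the image of the generator or of its inverse, up to conjugacy. *)
Lemma bar_prim q d0 s z j : walk_from_to rP' tP' q (d0 :: s) q ->
  d0 \notin s -> rP' d0 \notin d0 :: s -> walk_from_to rG' tG' (aV' q) z (aV' q) ->
  map aD' (d0 :: s) = wpow z j -> j = 1%N.
Proof.
move=> ws n1 n2 wz ez; have [t [n [r [wt lt wr en cn]]]] := loop_data ws.
set p := val q in wt wr en cn; set i := comp p in wr en cn.
have := cn d0; rewrite simple_chain // => /esym/unit_exponent hn.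
move: wz; rewrite {1}/aV' => /bar_lift[u1 [y [wu1 ey lu1 _]]].
have [u2 [wu2 lu2]] : triv rU rG tG lG y (aV p) by apply/(clV_eq rUK rGK lGr eqGP).
pose u := u1 ++ u2.
have wu : walk_from_to rG tG (aV p) u (aV p) by apply: walk_catI wu1 wu2.
have lu : weq rU (map lG u) (map lG' z).
  rewrite map_cat; apply: weq_trans (weq_catl rUK _ lu2) _; rewrite cats0; exact: lu1.
have e1 : weq rG (map aD t) (wpow u j).
  apply: weq_G (walk_aD wt) _ _; first exact: aV_out; first exact: walk_pow.
  rewrite map_lP wpow_map; apply: weq_trans lt _.
  apply: weq_trans (weq_sym (weq_pow rUK j lu)); rewrite -wpow_map -ez -map_comp.
  by rewrite (eq_map (g := lP')) // => f; apply: bar_lPa.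
pose ar := map aD r.
have e2 : weq rG (wpow (ar ++ u ++ inv_walk rG ar) j) (map aD (wzpow rP (g i) n)).
  apply: weq_trans (weq_conj_pow rGK _ _ _) _.
  apply: weq_trans _ (weq_aD en); rewrite !map_cat (inv_walk_map _ aDr).
  by apply: (weq_catl rGK); apply: (weq_catr rGK); apply: weq_sym.
have wc : walk_from_to rG tG (aV (p0 i)) (ar ++ u ++ inv_walk rG ar) (aV (p0 i)).
  have wa := walk_aD wr; apply: (walk_catI wa); apply: (walk_catI wu); exact: (walk_inv rGK wa).
case: hn => en'; subst n; first by apply: (indiv wc); apply: weq_trans e2 _; rewrite /= /wpow /= cats0.
apply: (indiv (walk_inv rGK wc)); rewrite -inv_wpow; apply: weq_trans (weq_inv rGK e2) _.
by rewrite /= /wpow /= cats0 (inv_walk_map _ aDr) (inv_walkK rGK).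
Qed.

(** Both walks are conjugate to generators or their inverses. Equal images over one vertex make the
    images of these generators conjugate up to inversion, so the two walks lie in the same
    component. *)
Lemma bar_indep q q' d0 s d0' s' :
  walk_from_to rP' tP' q (d0 :: s) q -> walk_from_to rP' tP' q' (d0' :: s') q' ->
  d0 \notin s -> rP' d0 \notin d0 :: s -> d0' \notin s' -> rP' d0' \notin d0' :: s' ->
  aV' q = aV' q' -> map aD' (d0 :: s) = map aD' (d0' :: s') ->
  d0 \in d0' :: s' \/ rP' d0 \in d0' :: s'.
Proof.
move=> ws ws' n1 n2 n1' n2' eq es.
have [t [n [r [wt lt wr en cn]]]] := loop_data ws.
have [t' [n' [r' [wt' lt' wr' en' cn']]]] := loop_data ws'.
set p := val q in wt wr en cn; set i := comp p in wr en cn.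
set p' := val q' in wt' wr' en' cn'; set i' := comp p' in wr' en' cn'.
have := cn d0; rewrite simple_chain // => /esym c1; have hn := unit_exponent c1.
have := cn' d0'; rewrite simple_chain // => /esym c1'; have hn' := unit_exponent c1'.
have [x [wx lx]] : triv rU rG tG lG (aV p) (aV p') by apply/(clV_eq rUK rGK lGr eqGP).
have ax := walk_inv rGK wx.
have e1 : weq rG (map aD t) (x ++ map aD t' ++ inv_walk rG x).
  apply: weq_G (walk_aD wt) _ _; first exact: aV_out.
    by apply: (walk_catI wx); apply: (walk_catI (walk_aD wt') ax).
  rewrite !map_cat !map_lP (inv_walk_map _ lGr).
  apply: weq_trans lt _; apply: weq_sym.
  apply: weq_trans (weq_cat rUK lx (weq_cat rUK lt' (weq_inv rUK lx))) _.
  rewrite /= cats0; have := congr1 (map lG') es; rewrite -!map_comp.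
  have el z : map (lG' \o aD') z = map lP' z by apply: eq_map => f; apply: bar_lPa.
  by rewrite !el => e; apply: congr1; symmetry; exact: e.
pose ar := map aD r; pose ar' := map aD r'.
pose W := ar ++ x ++ inv_walk rG ar'.
have wW : walk_from_to rG tG (aV (p0 i)) W (aV (p0 i')).
  apply: (walk_catI (walk_aD wr)); apply: (walk_catI wx).
  exact: (walk_inv rGK (walk_aD wr')).
have wgi k := walk_aD (walk_g k).
have e2 : weq rG (map aD (wzpow rP (g i) n)) (W ++ map aD (wzpow rP (g i') n') ++ inv_walk rG W).
  apply: weq_trans (weq_sym (weq_aD en)) _.
  rewrite !map_cat (inv_walk_map _ aDr) -/ar.
  apply: weq_trans (weq_catl rGK _ (weq_catr rGK _ e1)) _.
  have := weq_aD en'; rewrite !map_cat (inv_walk_map _ aDr) -/ar' => h.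
  apply: weq_trans _ (weq_catl rGK _ (weq_catr rGK _ h)).
  rewrite /W !inv_walk_cat (inv_walkK rGK) -!catA; do 2!apply: (weq_catl rGK).
  apply: weq_sym; rewrite catA.
  apply: weq_trans (weq_catr rGK _ (weq_invl rGK _)) _ => /=.
  apply: (weq_catl rGK); rewrite catA.
  exact: (weq_catr rGK _ (weq_invl rGK _)).
have e3 : weq rG (inv_walk rG (map aD (wzpow rP (g i) n)))
    (W ++ inv_walk rG (map aD (wzpow rP (g i') n')) ++ inv_walk rG W).
  apply: weq_trans (weq_inv rGK e2) _.
  rewrite (inv_walk_cat rG W) (inv_walk_cat rG _ (inv_walk rG W)) (inv_walkK rGK) -catA.
  exact: weq_refl.
have ei : i = i'.
  apply/eqP/negPn/negP => ne; have [nc1 nc2] := nonconj ne wW.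
  move: e2 e3; case: hn hn' => -> [] ->; rewrite /= /wpow /= !cats0 ?(inv_walk_map _ aDr)
    ?(inv_walkK rGK) => e2 e3.
  - exact: nc1.
  - exact: nc2.
  - exact: nc2.
  - exact: nc1.
(* Both chains are nonzero multiples of the chain of the common generator, so the second does not
   vanish at [d0] either. *)
have : chain rP' (d0' :: s') d0 != 0.
  rewrite cn' -ei mulf_neq0 ?intr_eq0 //; first by case: hn' => ->.
  by apply: contra_eq_neq c1 => ->; rewrite mulr0 eq_sym oner_eq0.
rewrite /chain; case: (boolP (d0 \in d0' :: s')) => h; first by left.
case: (boolP (rP' d0 \in d0' :: s')) => h'; first by right.
by rewrite (count_memPn h) (count_memPn h') subrr eqxx.
Qed.

Lemma bar_trivial e x : in_E lG' aD' bD' RD e x -> x =1 (fun _ => 0).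
Proof.
have t1 := config_E_trivial rUK rUN (bar_rvK rUK rGK lGr eqGP) (bar_lr rUK rGK lGr eqGP)
  (bar_imm (eqvP := eqGP)) (bar_rvK rUK rPK lPr_ eqPP) bar_aDr bar_bDr bar_aDt.
have t2 := t1 bV' bar_bDt bar_ab bar_immP bar_h1 bar_prim bar_indep.
exact: t2 bar_config e x.
Qed.

(** The disjoint union of the edge spaces: vertices are horizontal darts, edges are 2-cells, and the
    boolean [true] directs a cell towards Gamma_oo. *)
Definition cell_rev (y : DP * bool) := (y.1, ~~ y.2).
Definition cell_tgt (y : DP * bool) := if y.2 then aD y.1 else bD y.1.

Let brev (y : bDP * bool) := (y.1, ~~ y.2).
Let btgt (y : bDP * bool) := if y.2 then aD' y.1 else bD' y.1.

(** The ends [aD'] and [bD'] of a cell lie on different sides, so the cycle condition splits into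
    vanishing under both maps; restricted to one label this is an element of [in_E]. *)
Lemma bar_acyclic w : anti brev w -> push btgt w =1 (fun _ => 0) -> w =1 (fun _ => 0).
Proof.
move=> aw bw.
have split d : push btgt w d = push aD' (fun f => w (f, true)) d + push bD' (fun f => w (f, false)) d.
  rewrite /push.
  have -> : \sum_(y | btgt y == d) w y = \sum_f \sum_b (if btgt (f, b) == d then w (f, b) else 0).
    by rewrite pair_big /= [LHS]big_mkcond; apply: eq_bigr => -[f b].
  rewrite [X in X + _]big_mkcond [X in _ + X]big_mkcond -big_split /=.
  by apply: eq_bigr => f _; rewrite big_bool.
have col (f : bDP) : inR (val (tG' (bD' f))) /\ ~~ inR (val (tG' (aD' f))).
  rewrite bar_bDt bar_aDt -[f]qPdK tP'E bVE aVE !inR_class bV_in.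
  by split=> //; apply: aV_out.
have a0 : push aD' (fun f => w (f, true)) =1 (fun _ => 0).
  move=> d; case: (boolP (inR (val (tG' d)))) => h.
    by apply: push0 => f e; have [_] := col f; rewrite e h.
  rewrite -[RHS](bw d) split [X in _ + X]push0 ?addr0 // => f e.
  by have [] := col f; rewrite e (negPf h).
have b0 : push bD' (fun f => w (f, true)) =1 (fun _ => 0).
  move=> d; have -> : push bD' (fun f => w (f, true)) d = - push bD' (fun f => w (f, false)) d.
    by rewrite -pushN; apply: eq_bigr => f _; rewrite -(aw (f, false)).
  apply/eqP; rewrite oppr_eq0; apply/eqP.
  by rewrite -[RHS](bw d) split a0 add0r.
have wt f : w (f, true) = 0.
  pose x f' := if lG' (aD' f') == lG' (aD' f) then w (f', true) else 0.
  have := @bar_trivial (lG' (aD' f)) x _ f; rewrite /x eqxx; apply; split=> [f'|d|d].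
  - by case: eqP => //; rewrite andbT inE; have [->] := col f'.
  - case: (eqVneq (lG' d) (lG' (aD' f))) => [ed|ne].
      by rewrite -[RHS](a0 d); apply: eq_bigr => f' /eqP e'; rewrite /x e' ed eqxx.
    by apply: push0 => f' ed; rewrite ed (negPf ne).
  - case: (eqVneq (lG' d) (lG' (aD' f))) => [ed|ne].
      by rewrite -[RHS](b0 d); apply: eq_bigr => f' /eqP ed'; rewrite bar_ab ed' ed eqxx.
    by apply: push0 => f' ed; rewrite bar_ab ed (negPf ne).
move=> [f []]; first exact: wt.
by have := aw (f, true); rewrite /brev /= => ->; rewrite wt oppr0.
Qed.

(** The reduced null-labelled walk between the two targets maps to a reduced loop of Gamma_oo with
    trivial label, which is empty by injectivity on pi_1. *)
Lemma aD_glob f f' : aD f = aD f' -> triv rU rP tP lP (tP f) (tP f') -> f = f'.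
Proof.
move=> ea [s [ws ls]]; pose t := wreduce rP s.
have wt : walk_from_to rP tP (tP f) t (tP f') by apply: walk_red.
have et : weq rP t s by apply: weq_red.
have wa : walk_from_to rG tG (aV (tP f)) (map aD t) (aV (tP f)).
  by have := walk_aD wt; rewrite -[aV (tP f')]aDt -ea aDt.
have la : weq rU (map lG (map aD t)) [::].
  by rewrite map_lP; apply: weq_trans ls; apply: (weq_map rPK rUK lPr_).
have := pi1_G (aV_out _) wa la.
have rt : reducedw rG (map aD t).
  apply/negPn/negP => nr.
  have [s1 [x [y [s2 [e exy /eqP nxy]]]]] := backtrack (wreduce_reduced rP s) nr.
  move: wt; rewrite /t e => /walk_catP[z _]; rewrite !walk_cons => /and3P[_ /eqP txy _].
  case: nxy; rewrite -[y]rPK; congr rP; apply: aD_loc => //.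
  by rewrite aDr exy rGK.
rewrite /weq (wreduce_id rt) /= => e0; apply: aD_loc => //.
by move: wt; case: (t) e0 => // _; rewrite walk0 => /eqP.
Qed.

(** By [aD_glob] and [bD_glob] folding is locally injective at both ends of a cell, so a reduced
    closed walk stays reduced in the folded graph, which is a forest by [bar_acyclic]. *)
Lemma cell_forest u s : reducedw cell_rev s -> walk_from_to cell_rev cell_tgt u s u -> s = [::].
Proof.
move=> rs ws; pose h (y : DP * bool) : bDP * bool := (qPd y.1, y.2).
have bK : involutive brev by move=> [f b]; rewrite /brev /= negbK.
have bN y : brev y != y by case: y => f []; rewrite /brev xpair_eqE andbF.
have wb : walk_from_to brev btgt (qGd u) (map h s) (qGd u).
  apply: walk_map ws => [[f b]|[f b]] //.
  by rewrite /btgt /cell_tgt /h /=; case: b; rewrite ?aDE ?bDE.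
have : map h s = [::]; last by case: (s).
apply: (forest bK bN bar_acyclic _ wb); apply/negPn/negP => nr.
have [s1 [x [y [s2 [e exy /eqP nxy]]]]] := backtrack rs nr.
move: ws; rewrite e => /walk_catP[z _]; rewrite !walk_cons => /and3P[_ /eqP txy _].
case: nxy; case: x y exy txy {e} => [f b] [f' b'] exy.
have ef : qPd f' = qPd f := f_equal (fun y : bDP * bool => y.1) exy.
have eb : b' = ~~ b := f_equal (fun y : bDP * bool => y.2) exy.
have [_ tr] := iffLR (clD_eq rUK rPK lPr_ eqPP f' f) ef.
rewrite /cell_rev /cell_tgt /= eb negbK => et; congr (_, _).
by case: b et {exy eb} => et; [apply: aD_glob | apply: bD_glob].
Qed.

End Pages.

(** * Fundamental groups of disjoint unions of circles *)

Lemma take_index_cat (T : eqType) (a b : seq T) y : uniq (a ++ y :: b) ->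
  take (index y (a ++ y :: b)).+1 (a ++ y :: b) = rcons a y.
Proof.
rewrite cat_uniq /= => /and3P[_ /norP[ya _] _].
rewrite index_cat (negPf ya) /= eqxx addn0 -cat_rcons take_size_cat //.
by rewrite size_rcons.
Qed.

Section Powers.
Variables (D : eqType) (rv : D -> D).
Hypothesis rvK : involutive rv.

Lemma wzpow_mull s (n : int) e : e \in [:: [::]; s; inv_walk rv s] ->
  exists n' : int, weq rv (e ++ wzpow rv s n) (wzpow rv s n').
Proof.
rewrite !inE => /or3P[]/eqP->; first by exists n.
  case: n => k; first by exists (Posz k.+1).
  have h : weq rv (s ++ wzpow rv s (Negz k)) (wpow (inv_walk rv s) k).
    by rewrite /wzpow wpowS catA; apply: (@weq_catr _ _ rvK _ [::]); apply: weq_invr.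
  by case: k h => [|k] h; [exists (Posz 0) | exists (Negz k)].
case: n => [[|k]|k]; [by exists (Negz 0) | | by exists (Negz k.+1)].
exists (Posz k); rewrite /wzpow wpowS catA.
by apply: (@weq_catr _ _ rvK _ [::]); apply: weq_invl.
Qed.

Lemma wzpow_comm s (n : int) : weq rv (wzpow rv s n ++ s) (s ++ wzpow rv s n).
Proof.
case: n => k; first by rewrite /wzpow -wpowSr wpowS.
rewrite /wzpow; apply: (weq_trans (t := wpow (inv_walk rv s) k)).
  rewrite wpowSr -catA -[X in weq _ _ X]cats0.
  by apply: (weq_catl rvK); apply: weq_invl.
apply: weq_sym; rewrite wpowS catA.
by apply: (@weq_catr _ _ rvK _ [::]); apply: weq_invr.
Qed.

End Powers.

Section Circles.
Variables (V D I : finType) (rv : D -> D) (tg : D -> V).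
Hypotheses (rvK : involutive rv) (rvN : forall d, rv d != d).
Hypothesis val2 : forall v, #|[set d | tg d == v]| = 2.
Variable g : I -> seq D.
Hypothesis g_n0 : forall i, g i != [::].
Hypothesis g_cycle : forall i, cycle (fun y y' => tg y == tg (rv y')) (g i).
Hypothesis g_cells : forall y, \sum_i count (fun z => (z == y) || (z == rv y)) (g i) = 1.
Local Notation walk := (walk_from_to rv tg).

Lemma cells_split y : \sum_i count_mem y (g i) + \sum_i count_mem (rv y) (g i) = 1.
Proof.
rewrite -big_split -[RHS](g_cells y); apply: eq_bigr => i _ /=.
rewrite -count_predUI [X in (_ + X)%N](_ : _ = 0) ?addn0 //.
apply/eqP; rewrite -leqn0 leqNgt -has_count; apply/hasPn => z _ /=.
by apply/negP => /andP[/eqP-> /eqP e]; have := rvN y; rewrite -e eqxx.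
Qed.

Lemma count_g i y : (count_mem y (g i) <= \sum_i count_mem y (g i))%N.
Proof. by rewrite (bigD1 i) //= leq_addr. Qed.

Lemma g_uniq i : uniq (g i).
Proof.
apply: count_mem_uniq => y; have := cells_split y; have := count_g i y.
by rewrite -has_pred1 has_count; lia.
Qed.

Lemma g_disj i j y : y \in g i -> y \in g j -> i = j.
Proof.
move=> yi yj; apply/eqP/negPn/negP => ne; have := cells_split y.
move: yi yj; rewrite -!has_pred1 !has_count (bigD1 i) //= (bigD1 j) 1?eq_sym //=; lia.
Qed.

Lemma g_rvN i j y : y \in g i -> rv y \notin g j.
Proof.
move=> yi; apply/negP => yj; have := cells_split y; have := count_g i y.
have := count_g j (rv y).
by move: yi yj; rewrite -!has_pred1 !has_count; lia.
Qed.

Lemma g_total y : exists i, y \in g i \/ rv y \in g i.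
Proof.
apply: NNPP => no; have := cells_split y; rewrite !big1 // => i _; apply/eqP.
  by rewrite -leqn0 leqNgt -has_count has_pred1; apply/negP => h; apply: no; exists i; right.
by rewrite -leqn0 leqNgt -has_count has_pred1; apply/negP => h; apply: no; exists i; left.
Qed.

Lemma third_dart v d1 d2 d3 : tg d1 = v -> tg d2 = v -> tg d3 = v -> d1 != d2 ->
  d3 = d1 \/ d3 = d2.
Proof.
move=> e1 e2 e3 ne; have /eqP/cards2P[a [b [_ ed]]] := val2 v.
have h d : tg d = v -> d = a \/ d = b.
  by move=> e; apply/set2P; rewrite -ed inE e.
move: (h _ e1) (h _ e2) (h _ e3) ne => [->|->] [->|->] [->|->]; rewrite ?eqxx //; auto.
Qed.

Lemma g_in_inj i j y y' : y \in g i -> y' \in g j -> tg y = tg y' -> y = y'.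
Proof.
move=> yi yj e; have e1 := eqP (next_cycle (g_cycle i) yi).
have nx : next (g i) y \in g i by rewrite mem_next.
have ne : y != rv (next (g i) y).
  by apply/eqP => ey; have := g_rvN i nx; rewrite -ey yi.
have [->|e'] // := third_dart erefl (esym e1) (esym e) ne.
by have := g_rvN j nx; rewrite -e' yj.
Qed.

Lemma g_in v : exists yi : D * I, yi.1 \in g yi.2 /\ tg yi.1 = v.
Proof.
have [d dv] : exists d, d \in [set d | tg d == v] by apply/card_gt0P; rewrite val2.
move: dv; rewrite inE => /eqP<-; have [i [di|ri]] := g_total d; first by exists (d, i).
exists (prev (g i) (rv d), i) => /=; rewrite mem_prev; split=> //.
by rewrite (eqP (prev_cycle (g_cycle i) ri)) rvK.
Qed.

(** Let [pi p] be the initial segment of [g] ending at [p]. Appending a dart leads to the segment of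
    the next vertex, up to a factor that is empty, [g] or its inverse, the last two when the base
    point is crossed. Along a loop at the base point these factors multiply to a power of [g]. *)
Lemma circles : exists (comp : V -> I) (p0 : I -> V), [/\
  forall i, walk (p0 i) (g i) (p0 i),
  forall p, exists s, walk (p0 (comp p)) s p,
  forall i s, walk (p0 i) s (p0 i) -> exists n : int, weq rv s (wzpow rv (g i) n),
  forall i y, y \in g i -> comp (tg y) = i &
  forall d, comp (tg (rv d)) = comp (tg d)].
Proof.
have [pin hp] := fin_all_exists g_in.
pose comp p := (pin p).2; pose pi p := take (index (pin p).1 (g (comp p))).+1 (g (comp p)).
have path_walk x t : path (fun y y' => tg y == tg (rv y')) x t -> walk (tg x) t (tg (last x t)).
  elim: t x => [|y t IH] x /=; first by rewrite walk0.
  by move=> /andP[/eqP e /IH w]; rewrite walk_cons -e eqxx.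
have /fin_all_exists[p0 hp0] : forall i, exists p, exists x t, g i = x :: t /\ p = tg (last x t).
  by move=> i; have := g_n0 i; case: (g i) => // x t _; exists (tg (last x t)), x, t.
have gw i : walk (p0 i) (g i) (p0 i).
  have [x [t [e ->]]] := hp0 i; have := g_cycle i; rewrite e /= rcons_path => /andP[h /eqP e'].
  by rewrite walk_cons -e' eqxx path_walk.
have pinE i y : y \in g i -> pin (tg y) = (y, i).
  move=> yi; have [h1 h2] := hp (tg y); case: (pin _) h1 h2 => y' j /= h1 h2.
  have e := g_in_inj h1 yi h2; subst y'; by rewrite (g_disj h1 yi).
have compE i y : y \in g i -> comp (tg y) = i by move=> yi; rewrite /comp (pinE i y yi).
have piE i y : y \in g i -> pi (tg y) = take (index y (g i)).+1 (g i).
  by move=> yi; rewrite /pi /comp (pinE i y yi).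
have p0E i : comp (p0 i) = i /\ pi (p0 i) = g i.
  have [x [t [e ->]]] := hp0 i; have li : last x t \in g i by rewrite e mem_last.
  rewrite (compE _ _ li) (piE _ _ li) e; split=> //.
  by rewrite index_last -?e ?g_uniq // e take_oversize.
have step1 i d : d \in g i -> comp (tg (rv d)) = i /\
    exists2 e, e \in [:: [::]; g i; inv_walk rv (g i)] &
      pi (tg (rv d)) ++ [:: d] = e ++ pi (tg d).
  move=> di; have [x [t [e ep]]] := hp0 i; rewrite (piE _ _ di).
  have dxt : d \in x :: t by rewrite -e.
  move: dxt; rewrite inE => /orP[/eqP ex|].
    subst d; have wg := gw i; rewrite e walk_cons in wg; case/andP: wg => /eqP-> _.
    have [-> ->] := p0E i; split=> //; exists (g i); first by rewrite !inE eqxx orbT.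
    by rewrite e /= eqxx take0.
  move=> dt; case/splitPr: dt e ep => t1 t2 e ep.
  have hc := g_cycle i; rewrite e /= rcons_path cat_path /= in hc.
  case/andP: hc => /andP[_ /andP[/eqP e1 _]] _.
  have li : last x t1 \in g i.
    by rewrite e -cat_cons mem_cat mem_last.
  rewrite -e1 (compE _ _ li) (piE _ _ li); split=> //; exists [::]; rewrite ?inE //=.
  have u := g_uniq i.
  have eg1 : g i = belast x t1 ++ last x t1 :: d :: t2.
    by rewrite e -cat_cons lastI cat_rcons.
  have eg2 : g i = (x :: t1) ++ d :: t2 by rewrite e.
  have -> : take (index (last x t1) (g i)).+1 (g i) = x :: t1.
    by rewrite eg1 take_index_cat -?eg1 // -lastI.
  have -> : take (index d (g i)).+1 (g i) = rcons (x :: t1) d.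
    by rewrite eg2 take_index_cat -?eg2.
  by rewrite cats1.
have step d : comp (tg (rv d)) = comp (tg d) /\
    exists2 e, e \in [:: [::]; g (comp (tg d)); inv_walk rv (g (comp (tg d)))] &
      weq rv (pi (tg (rv d)) ++ [:: d]) (e ++ pi (tg d)).
  have [i [di|ri]] := g_total d.
    have [ec [e he ee]] := step1 i d di; rewrite ec (compE _ _ di); split=> //.
    by exists e => //; rewrite ee; apply: weq_refl.
  have [ec [e he ee]] := step1 i (rv d) ri; rewrite rvK in ec ee.
  rewrite ec (compE _ _ ri); split=> //; exists (inv_walk rv e).
    move: he; rewrite !inE => /or3P[]/eqP->; rewrite ?eqxx ?orbT //.
    by rewrite (inv_walkK rvK) eqxx orbT.
  apply: (@weq_catIl _ _ rvK e); rewrite !catA -ee.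
  apply: (weq_trans (t := pi (tg d))).
    rewrite -catA -[X in weq _ _ X]cats0; apply: (weq_catl rvK).
    by have := weq_cancel rvK (rv d) [::]; rewrite rvK.
  by apply: weq_sym; apply: (@weq_catr _ _ rvK _ [::]); apply: weq_invr.
have walkP u p q : walk p u q -> comp p = comp q /\
    exists n : int, weq rv (pi p ++ u) (wzpow rv (g (comp p)) n ++ pi q).
  elim: u p => [|d u IH] p.
    by rewrite walk0 => /eqP->; split=> //; exists (Posz 0); rewrite cats0.
  rewrite walk_cons => /andP[/eqP<- /IH[e [n hn]]].
  have [ec [w hw ew]] := step d; rewrite ec e; split=> //.
  rewrite -e; have [n' hn'] := wzpow_mull rvK n hw; exists n'.
  rewrite -[d :: u]/([:: d] ++ u) catA.
  apply: weq_trans (weq_catr rvK _ ew) _; rewrite -catA.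
  by apply: weq_trans (weq_catl rvK _ hn) _; rewrite catA; apply: (weq_catr rvK).
exists comp, p0; split=> //.
- move=> p; have [h1 h2] := hp p; have gp := gw (comp p).
  case/splitPr: h1 gp => a b; rewrite -cat_rcons => /walk_catP[v w _].
  have ev := walk_wend w; rewrite /wend map_rcons last_rcons h2 in ev.
  by rewrite -ev in w; exists (rcons a (pin p).1).
- move=> i u /walkP[_ [n]]; have [-> ->] := p0E i => hn; exists n.
  apply: (weq_catIl rvK (r := g i)); apply: weq_trans hn _; exact: wzpow_comm.
- by move=> d; have [] := step d.
Qed.

End Circles.

Lemma map_reduced (V D D' : eqType) (rv : D -> D) (tg : D -> V) (rv' : D' -> D')
    (f : D -> D') u s v : involutive rv -> involutive rv' ->
  {morph f : d / rv d >-> rv' d} ->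
  (forall d d', tg d = tg d' -> f d = f d' -> d = d') ->
  walk_from_to rv tg u s v -> reducedw rv s -> reducedw rv' (map f s).
Proof.
move=> rvK rvK' fr imm ws rs; apply/negPn/negP => nr.
have [s1 [a [b [s2 [e fab /eqP nab]]]]] := backtrack rs nr.
move: ws; rewrite e => /walk_catP[x _]; rewrite !walk_cons => /and3P[_ /eqP ab _].
by case: nab; rewrite -[b]rvK; congr rv; apply: imm; rewrite // fr fab rvK'.
Qed.

Lemma reducedw_disjoint (D : eqType) (rv : D -> D) s :
  (forall x, x \in s -> rv x \notin s) -> reducedw rv s.
Proof.
elim: s => // x s IH h; rewrite reducedw_cons IH ?andbT => [|y ys]; last first.
  by have := h y; rewrite !inE ys orbT => /(_ isT)/norP[].
have := h x; rewrite !inE eqxx => /(_ isT)/norP[_]; case: s {IH h} => // y s.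
by rewrite inE => /norP[]; rewrite eq_sym.
Qed.

(** * Walks and cycles in graphs of valency two *)

Section Base.
Local Open Scope ring_scope.
Variables (V D : finType) (rv : D -> D) (tg : D -> V) (inR : pred V).
Hypotheses (rvK : involutive rv) (rvN : forall d, rv d != d).
Hypothesis inR_rev : forall d, inR (tg (rv d)) = inR (tg d).
Hypothesis deg2 : forall d d' d'', inR (tg d) -> tg d' = tg d -> tg d'' = tg d ->
  d' != d -> d'' != d -> d' = d''.

(* A reduced walk in a graph of valency 2 is determined by its last dart; comparing
   it with its reverse from both ends meets either a fixed dart or a backtrack. *)
Lemma no_return u x t v : inR u -> reducedw rv (x :: t) -> walk_from_to rv tg u (x :: t) v ->
  rv x \notin t.
Proof.
suff h n : forall u x t v, (size t < n)%N -> inR u -> reducedw rv (rcons (x :: t) (rv x)) ->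
    walk_from_to rv tg u (rcons (x :: t) (rv x)) v -> False.
  move=> uR rx wx; apply/negP => xt; case/splitPr: xt rx wx => t1 t2.
  rewrite -cat_rcons -cat_cons -rcons_cons => /reducedw_cat[rr _] /walk_catP[w ww _].
  exact: (h _ u x t1 w (ltnSn _) uR rr ww).
elim: n => // n IH {}u {}x {}t {}v lt uR.
rewrite -[rcons (x :: t) _]/(x :: rcons t (rv x)) reducedw_cons walk_cons.
move=> /andP[hx rt] /andP[/eqP eu wt].
have txR : inR (tg x) by rewrite -inR_rev eu.
case: t lt hx rt wt => [|z t] lt hx rt wt; first by rewrite /= eqxx in hx.
have ezx : tg (rv z) = tg x by move: wt; rewrite walk_cons => /andP[/eqP].
have nzx : rv z != x by apply: contraNneq hx => <- /=; rewrite rvK.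
case/lastP: t lt hx rt wt => [|t w] lt hx rt wt.
  move: rt wt; rewrite /= !walk_cons => /andP[n1 _] /andP[_ /andP[/eqP e1 _]].
  have e : rv z = z.
    apply: (deg2 (d := x)) => //; first by rewrite -e1 rvK.
    by apply: contraNneq n1 => ->.
  by have := rvN z; rewrite e eqxx.
have es : rcons (z :: rcons t w) (rv x) = (z :: t) ++ [:: w; rv x].
  by rewrite /= -cats1 -cats1 -catA.
rewrite es in rt wt; have ew : w = rv z.
  apply: (deg2 (d := x)) => //.
    by case/walk_catP: wt => y _; rewrite !walk_cons rvK => /and3P[_ /eqP].
  by apply/negP => /eqP ewx; case/reducedw_cat: rt => _; rewrite ewx /= eqxx.
rewrite ew -[[:: _; _]]/([:: rv z] ++ [:: rv x]) catA [_ ++ [:: rv z]]cats1 in rt wt.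
case/reducedw_cat: rt => rz _; case/walk_catP: wt => y wz _.
apply: (IH (tg x) z t y) => //; by move: lt; rewrite /= size_rcons; lia.
Qed.

Lemma no_both u t v x : inR u -> reducedw rv t -> walk_from_to rv tg u t v ->
  x \in t -> rv x \notin t.
Proof.
elim: t u => // y t IH u uR rt wt; have nr := no_return uR rt wt.
move: rt wt; rewrite reducedw_cons walk_cons => /andP[_ rt] /andP[/eqP eu wt].
have h := IH _ (etrans (esym (inR_rev y)) (etrans (congr1 inR eu) uR)) rt wt.
rewrite !inE => /orP[/eqP->|xt]; first by rewrite (negPf (rvN y)).
rewrite negb_or h // andbT; apply: contraNneq nr => <-; by rewrite rvK.
Qed.

(** At a vertex of valency two the boundary condition equates the coefficients of consecutive
    darts. *)
Lemma cycle_const u x t v (z : D -> rat) : inR u -> reducedw rv (x :: t) ->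
  walk_from_to rv tg u (x :: t) v -> anti rv z -> push tg z =1 (fun _ => 0) ->
  forall y, y \in x :: t -> z y = z x.
Proof.
move=> uR rt wt az z0; elim: t u x uR rt wt => [|w t IH] u x uR rt wt y.
  by rewrite inE => /eqP->.
rewrite inE => /orP[/eqP->//|yt].
move: rt wt; rewrite reducedw_cons [walk_from_to _ _ _ _ _]walk_cons => /andP[ne rt] /andP[/eqP eu wt].
have txR : inR (tg x) by rewrite -inR_rev eu.
rewrite (IH _ _ txR rt wt y yt).
have ew : tg (rv w) = tg x by move: wt; rewrite walk_cons => /andP[/eqP].
have nw : rv w != x by apply: contraNneq ne => <-; rewrite rvK.
have := z0 (tg x); rewrite /push (bigD1 x) //= (bigD1 (rv w)) /=; last by rewrite ew eqxx.
rewrite big1 => [|d /andP[/andP[/eqP ed nx] nd]]; last first.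
  by have := deg2 txR ew ed nw nx => e; rewrite e eqxx in nd.
rewrite addr0 az => /eqP; rewrite subr_eq0 => /eqP->; by [].
Qed.

End Base.

(** * Pages over the circles *)

Section Fibre.
Local Open Scope ring_scope.
Variables (VG DG : finType) (rG : DG -> DG) (tG : DG -> VG) (inR : pred VG).
Hypotheses (rGK : involutive rG) (rGN : forall d, rG d != d).
Hypothesis inR_rev : forall d, inR (tG (rG d)) = inR (tG d).
Hypothesis deg2 : forall d d' d'', inR (tG d) -> tG d' = tG d -> tG d'' = tG d ->
  d' != d -> d'' != d -> d' = d''.
Variables (VP DP : finType) (rP : DP -> DP) (tP : DP -> VP).
Hypothesis rPK : involutive rP.
Variables (bV : VP -> VG) (bD : DP -> DG).
Hypothesis bDr : {morph bD : f / rP f >-> rG f}.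
Hypothesis bDt : forall f, tG (bD f) = bV (tP f).
Hypothesis bV_in : forall p, inR (bV p).
Hypothesis bD_loc : forall f f', tP f = tP f' -> bD f = bD f' -> f = f'.

Lemma reduced_bD p t q : walk_from_to rP tP p t q -> reducedw rP t -> reducedw rG (map bD t).
Proof. exact: map_reduced. Qed.

Lemma walk_b p t q : walk_from_to rP tP p t q ->
  walk_from_to rG tG (bV p) (map bD t) (bV q).
Proof. exact: walk_map. Qed.

Lemma chain_bD p f t q : walk_from_to rP tP p (f :: t) q -> reducedw rP (f :: t) ->
  chain rG (map bD (f :: t)) (bD f) != 0.
Proof.
move=> w r; have h := no_both rGK rGN inR_rev deg2 (bV_in p) (reduced_bD w r) (walk_b w).
rewrite /chain (count_memPn (h _ (map_f bD (mem_head _ _)))) subr0 pnatr_eq0.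
by rewrite /= eqxx.
Qed.

Section Fill.
Variables (I : eqType) (comp : VP -> I) (p0 : I -> VP) (g : I -> seq DP).
Hypothesis walk_g : forall i, walk_from_to rP tP (p0 i) (g i) (p0 i).
Hypothesis path_p : forall p, exists s, walk_from_to rP tP (p0 (comp p)) s p.
Hypothesis comp_rev : forall f, comp (tP (rP f)) = comp (tP f).
Hypothesis g_n0 : forall i, g i != [::].
Hypothesis g_rvN : forall i f, f \in g i -> rP f \notin g i.
Hypothesis g_tot : forall f, f \in g (comp (tP f)) \/ rP f \in g (comp (tP f)).
Hypothesis comp_g : forall i f, f \in g i -> comp (tP f) = i.
Hypothesis comp_b : forall p q, bV p = bV q -> comp p = comp q.

Lemma walk_comp p t q f : walk_from_to rP tP p t q -> f \in t -> comp (tP f) = comp p.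
Proof.
elim: t p => // y t IH p; rewrite walk_cons inE => /andP[/eqP<- w] /orP[/eqP->|ft].
  by rewrite comp_rev.
by rewrite (IH _ w ft) comp_rev.
Qed.

(** A path [t] from [q] to [p] has the right boundary, and its image is a cycle on one circle of the
    base, hence proportional to the image of the generator [g i]. Subtracting a multiple of the
    generator kills the image and keeps the boundary. *)
Lemma fill_pair p q : bV p = bV q -> exists w, [/\ anti rP w,
  push tP w =1 (fun x => delta p x - delta q x) & push bD w =1 (fun _ => 0)].
Proof.
move=> e; have ec := comp_b e; set i := comp p.
have [a wa] := path_p p; have [a' wa'] := path_p q; rewrite -ec -/i in wa wa'.
set t := inv_walk rP a' ++ a.
have wt : walk_from_to rP tP q t p by apply: (walk_catI (walk_inv rPK wa')).
have rg : reducedw rP (g i) by apply: reducedw_disjoint; apply: g_rvN.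
case eg : (g i) (g_n0 i) => [//|f0 t0] _; have wg := walk_g i; rewrite eg in rg wg.
have nz := chain_bD wg rg.
(* The ratio of winding numbers; it need not be an integer, which is why chains have rational
   coefficients. *)
pose c := chain rG (map bD t) (bD f0) / chain rG (map bD (f0 :: t0)) (bD f0).
pose w f := chain rP t f - c * chain rP (f0 :: t0) f.
have aw : anti rP w by apply: antiB; [|apply: antiZ]; apply: chain_anti.
have bw : push bD w =1 (fun d => chain rG (map bD t) d - c * chain rG (map bD (f0 :: t0)) d).
  by move=> d; rewrite pushD pushN pushZ !(push_chain _ rPK rGK).
exists w; split=> //.
  by move=> x; rewrite pushD pushN pushZ (bd_chain _ _ wt) // (bd_chain _ _ wg) // subrr mulr0 subr0.
have az : anti rG (push bD w) by apply: anti_push.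
have z0 : push tG (push bD w) =1 (fun _ => 0).
  move=> v; rewrite (push_ext _ bw) pushD pushN pushZ.
  by rewrite (bd_chain _ _ (walk_b wt)) // (bd_chain _ _ (walk_b wg)) // e !subrr mulr0 subrr.
have zg f : f \in g i -> push bD w (bD f) = 0.
  move=> fg; rewrite (cycle_const rGK inR_rev deg2 (bV_in _) (reduced_bD wg rg) (walk_b wg) az z0).
    by rewrite bw /c divfK ?subrr.
  by rewrite eg in fg; apply: (map_f bD fg).
move=> d; case: (classic (exists2 f, bD f = d & comp (tP f) = i)) => [[f <- cf]|no].
  have [h|h] := g_tot f; rewrite cf in h; first exact: zg.
  by rewrite -[f]rPK bDr az zg ?oppr0.
apply: push0 => f ef; rewrite /w /chain !(count_memPn _) ?subrr ?mulr0 ?subrr //.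
- by rewrite -eg; apply/negP => /comp_g cf; apply: no; exists f; rewrite // -comp_rev.
- by rewrite -eg; apply/negP => /comp_g cf; apply: no; exists f.
- by apply/negP => h; apply: no; exists f; rewrite // -comp_rev (walk_comp wt h) -ec.
- by apply/negP => h; apply: no; exists f; rewrite // (walk_comp wt h) -ec.
Qed.

(** Move each vertex to a chosen one in its fibre of [bV] and add the chains of [fill_pair]; the
    chosen vertices end up with total weight zero. *)
Lemma fibres_fill z : push bV z =1 (fun _ => 0) ->
  exists w, [/\ anti rP w, push tP w =1 z & push bD w =1 (fun _ => 0)].
Proof.
move=> z0; pose rep v := [pick q | bV q == v]; pose r p := odflt p (rep (bV p)).
have br p : bV p = bV (r p).
  by rewrite /r /rep; case: pickP => [q /eqP->|].
have rr p q : bV p = bV q -> r p = r q.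
  by move=> e; rewrite /r e /rep; case: pickP => // /(_ q); rewrite eqxx.
have /fin_all_exists[w hw] p := fill_pair (br p).
exists (fun f => \sum_p z p * w p f); split.
- by apply: anti_sum => p; case: (hw p).
- move=> x; rewrite push_sum (eq_bigr (fun p => z p * delta p x - z p * delta (r p) x)).
    rewrite sumrB sum_coords [X in _ - X](_ : _ = 0) ?subr0 //.
    rewrite (partition_big bV xpredT) //; apply: big1 => v _.
    case: (pickP (fun p => bV p == v)) => [q /eqP eq|no]; last first.
      by apply: big1 => p; rewrite andTb no.
    rewrite (eq_bigr (fun p => z p * delta (r q) x)) => [|p /eqP ep].
      by rewrite -mulr_suml -/(push bV z v) z0 mul0r.
    by rewrite (rr p q) // ep eq.
  by move=> p _; case: (hw p) => _ -> _; rewrite mulrBr.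
- by move=> d; rewrite push_sum big1 // => p _; case: (hw p) => _ _ ->; rewrite mulr0.
Qed.

End Fill.

Section Glob.
Variables (DU : finType) (rU : DU -> DU) (lG : DG -> DU) (aV : VP -> VG) (aD : DP -> DG).
Hypothesis rUK : involutive rU.
Hypothesis lGr : {morph lG : d / rG d >-> rU d}.
Hypothesis aDr : {morph aD : f / rP f >-> rG f}.
Hypothesis aDt : forall f, tG (aD f) = aV (tP f).
Hypothesis ab_label : forall f, lG (aD f) = lG (bD f).
Hypothesis cover : forall p h, tG h = bV p -> exists2 f, tP f = p & bD f = h.
Hypothesis aD_loc : forall f f', tP f = tP f' -> aD f = aD f' -> f = f'.
Hypothesis pi1 : forall p t, walk_from_to rG tG (aV p) t (aV p) ->
  weq rU (map lG t) [::] -> weq rG t [::].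
Let lP f := lG (aD f).

(** [aD] is locally injective, so a reduced page loop has a reduced image, which is empty by
    [pi1]. *)
Lemma pi1_pages p t : walk_from_to rP tP p t p -> weq rU (map lP t) [::] -> weq rP t [::].
Proof.
move=> w l; set t' := wreduce rP t.
have w' : walk_from_to rP tP p t' p by apply: walk_red.
have et : weq rP t' t by apply: weq_red.
have wa : walk_from_to rG tG (aV p) (map aD t') (aV p) by apply: walk_map w'.
have lPr : {morph lP : f / rP f >-> rU f} by move=> f; rewrite /lP aDr lGr.
have la : weq rU (map lG (map aD t')) [::].
  by rewrite -map_comp; apply: weq_trans l; apply: (weq_map rPK rUK lPr).
have ra := map_reduced rPK rGK aDr aD_loc w' (wreduce_reduced rP t).
have := pi1 wa la; rewrite /weq (wreduce_id ra) /= => /(congr1 size)/eqP.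
by rewrite size_map size_eq0 => /eqP.
Qed.

(* If [f] and [f'] lay over the same dart with [tP f != tP f'], lifting the projection of
   a null-labelled walk between them over and over closes up to a loop of pages which is
   null-homotopic although its projection winds around the base. *)
Lemma bD_glob f f' : bD f = bD f' -> triv rU rP tP lP (tP f) (tP f') -> f = f'.
Proof.
move=> ef [s [ws ls]]; set t := wreduce rP s.
have wt : walk_from_to rP tP (tP f) t (tP f') by apply: walk_red.
have rt : reducedw rP t by apply: wreduce_reduced.
have lPr : {morph lP : f / rP f >-> rU f} by move=> y; rewrite /lP aDr lGr.
have lt : weq rU (map lP t) [::] by apply: weq_trans ls; apply: (weq_map rPK rUK lPr); apply: weq_red.
have lb u : map lP u = map lG (map bD u) by rewrite -map_comp; apply: eq_map => y; apply: ab_label.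
case et : t => [|y u].
  by apply: bD_loc => //; move: wt; rewrite et walk0 => /eqP.
have eb : bV (tP f) = bV (tP f') by rewrite -!bDt ef.
have wb := walk_b wt; rewrite -eb in wb.
have /fin_all_exists[F hF] : forall q, exists q', bV q = bV (tP f) ->
    bV q' = bV (tP f) /\ exists2 r, walk_from_to rP tP q r q' & map bD r = map bD t.
  move=> q; case: (eqVneq (bV q) (bV (tP f))) => [e|ne]; last by exists q => e; rewrite e eqxx in ne.
  rewrite -e in wb; have [r [q' [wr mr bq]]] := bD_lift rGK rPK bDr bDt cover wb.
  by exists q'; split; [rewrite bq e | exists r].
have iterF n q : bV q = bV (tP f) -> bV (iter n F q) = bV (tP f) /\
    exists2 r, walk_from_to rP tP q r (iter n F q) & map bD r = wpow (map bD t) n.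
  move=> eq; elim: n => [|n [e [r wr mr]]]; first by split=> //; exists [::]; rewrite ?walk0.
  have [e' [r' wr' mr']] := hF _ e; split; first by rewrite iterS.
  exists (r ++ r'); first by rewrite iterS; apply: (walk_catI wr).
  by rewrite map_cat mr mr' wpowSr.
have [j lj /= ej] : exists2 j, (j < order F (tP f))%N & iter (order F (tP f)) F (tP f) = iter j F (tP f).
  by have /trajectP := looping_order F (tP f).
set n := (order F (tP f) - j)%N; set q := iter j F (tP f).
have n0 : (0 < n)%N by rewrite subn_gt0.
have [bq _] := iterF j (tP f) erefl; have [_ [r wr mr]] := iterF n q bq.
rewrite /q -iterD subnK in wr; last exact: ltnW.
rewrite ej -/q in wr.
have lr : weq rU (map lP r) [::].
  rewrite lb mr wpow_map -lb; apply: weq_trans (weq_pow rUK n lt) _.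
  by rewrite /wpow; elim: (n).
have := pi1_pages wr lr => /(chain_weq rPK) c0.
have := chain_bD (p := tP f) (f := y) (t := u) (q := tP f').
rewrite -et => /(_ wt rt) /eqP[].
have /eqP : n%:R * chain rG (map bD t) (bD y) = 0.
  rewrite -chain_wpow -mr -(push_chain _ rPK rGK bDr).
  by rewrite push0 // => x _; rewrite c0 chain_nil.
by rewrite mulf_eq0 pnatr_eq0 eqn0Ngt n0 => /eqP.
Qed.

End Glob.
End Fibre.

(** * Rational injectivity into the underlying graph *)

Lemma surj_lift (A B : finType) (f : A -> B) (w : B -> rat) :
  (forall b, w b != 0%R -> exists a, f a = b) -> exists w', push f w' =1 w.
Proof.
move=> h; pose r b := [pick a | f a == b].
exists (fun a => if r (f a) == Some a then w (f a) else 0%R) => b.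
case: (classic (exists a, f a = b)) => [[a0 ea0]|no]; last first.
  rewrite push0 => [|a ea]; last by case: no; exists a.
  by apply/esym/eqP/negPn/negP => /h.
have [a ra ea] : exists2 a, r b = Some a & f a = b.
  by rewrite /r; case: pickP => [a /eqP ea|/(_ a0)]; [exists a | rewrite ea0 eqxx].
rewrite -{1}ea push_single ea ?ra ?eqxx // => a' e.
by rewrite e ra; case: (eqVneq (Some a) (Some a')) => [[->]|_] //; rewrite eqxx.
Qed.

Lemma anti_surj_lift (A B : finType) (rA : A -> A) (rB : B -> B) (f : A -> B) (w : B -> rat) :
  involutive rA -> involutive rB -> {morph f : a / rA a >-> rB a} -> anti rB w ->
  (forall b, w b != 0%R -> exists a, f a = b) -> exists2 w', anti rA w' & push f w' =1 w.
Proof.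
move=> rAK rBK fr aw /surj_lift[w0 h0].
exists (fun a => 2^-1 * (w0 a - w0 (rA a)))%R => [a|b].
  by rewrite rAK -mulrN opprB.
rewrite pushZ pushD pushN.
have -> : push f (w0 \o rA) b = push f w0 (rB b).
  rewrite [RHS]/push (reindex_inj (can_inj rAK)) /=; apply: eq_bigl => a.
  by rewrite fr (inj_eq (can_inj rBK)).
by rewrite !h0 aw; field.
Qed.

Section Exact.
Local Open Scope ring_scope.
Variables (VU DU : finType) (rU : DU -> DU) (tU : DU -> VU).
Hypotheses (rUK : involutive rU) (rUN : forall d, rU d != d).
Variables (VG DG : finType) (rG : DG -> DG) (tG : DG -> VG) (lG : DG -> DU) (qG : VG -> VU).
Hypotheses (rGK : involutive rG) (lGr : {morph lG : d / rG d >-> rU d}).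
Hypothesis lGt : forall d, qG (tG d) = tU (lG d).
Hypothesis lG_surj : forall e, exists d, lG d = e.
Variable inR : pred VG.
Hypothesis inR_rev : forall d, inR (tG (rG d)) = inR (tG d).
Variables (VP DP : finType) (rP : DP -> DP) (tP : DP -> VP).
Hypothesis rPK : involutive rP.
Variables (aV bV : VP -> VG) (aD bD : DP -> DG).
Hypotheses (aDr : {morph aD : f / rP f >-> rG f}) (bDr : {morph bD : f / rP f >-> rG f}).
Hypotheses (aDt : forall f, tG (aD f) = aV (tP f)) (bDt : forall f, tG (bD f) = bV (tP f)).
Hypothesis ab_label : forall f, lG (aD f) = lG (bD f).
Hypotheses (aV_out : forall p, ~~ inR (aV p)) (bV_in : forall p, inR (bV p)).
Hypothesis bD_surj : forall d, inR (tG d) -> exists f, bD f = d.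
Hypothesis fillP : forall z, push bV z =1 (fun _ => 0) ->
  exists w, [/\ anti rP w, push tP w =1 z & push bD w =1 (fun _ => 0)].
Hypothesis conn : forall b, push qG b =1 (fun _ => 0) ->
  exists v, b =1 (fun x => push aV v x - push bV v x).

(** Lift [c] to a horizontal chain [w0]. The defect of its boundary is filled by a vertical chain
    [v], because vertex spaces are connected. The part [wR] of [w0] in the circles is lifted to the
    pages with boundary exactly [v], and replaced by its image in Gamma_oo: the labels are the same,
    and the boundary is corrected by [v]. *)
Lemma exact_lift a (c : DU -> rat) : (forall x, inR x -> a x = 0) -> anti rU c ->
  push qG a =1 push tU c -> exists w, [/\ anti rG w, forall d, inR (tG d) -> w d = 0,
    push tG w =1 a & push lG w =1 c].
Proof.
move=> sa ac eac.
have [|w0 aw0 lw0] := anti_surj_lift rGK rUK lGr ac; first by move=> e _; apply: lG_surj.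
have [|v hv] := conn (b := fun x => a x - push tG w0 x).
  move=> u; rewrite pushD pushN push_comp (push_fun (g := tU \o lG) _ lGt) -push_comp (push_ext _ lw0).
  by rewrite eac subrr.
pose wR d := if inR (tG d) then w0 d else 0; pose wG d := if inR (tG d) then 0 else w0 d.
have awR : anti rG wR by move=> d; rewrite /wR inR_rev; case: ifP; rewrite ?oppr0.
have awG : anti rG wG by move=> d; rewrite /wG inR_rev; case: ifP; rewrite ?oppr0.
have [|om aom bom] := anti_surj_lift rPK rGK bDr awR.
  by move=> d; rewrite /wR; case: ifP => [/bD_surj|]; rewrite ?eqxx.
have tR x : push tG wR x = if inR x then push tG w0 x else 0.
  case: ifP => xR; last by apply: push0 => d ed; rewrite /wR ed xR.
  by apply: eq_bigr => d /eqP ed; rewrite /wR ed xR.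
have tGG x : push tG wG x = if inR x then 0 else push tG w0 x.
  case: ifP => xR; first by apply: push0 => d ed; rewrite /wG ed xR.
  by apply: eq_bigr => d /eqP ed; rewrite /wG ed xR.
have [|om' [aom' tom' bom']] := fillP (z := fun p => v p - push tP om p).
  move=> x; rewrite pushD pushN push_comp -(push_fun (f := tG \o bD) _ bDt) -push_comp (push_ext _ bom) tR.
  case: ifP => xR; last first.
    by rewrite push0 ?subrr // => p ep; have := bV_in p; rewrite ep xR.
  have := hv x; rewrite sa // sub0r [push aV v x]push0 ?sub0r => [/oppr_inj->|p ep].
    by rewrite subrr.
  by have := aV_out p; rewrite ep xR.
(* [om] projects to [wR]; [om'] projects to zero and corrects the boundary to [v]. *)
pose th f := om f + om' f.
have tth : push tP th =1 v by move=> p; rewrite pushD tom'; ring.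
have bth : push bD th =1 wR by move=> d; rewrite pushD bom' addr0 bom.
exists (fun d => wG d + push aD th d); split.
- by apply: antiD => //; apply: anti_push => //; apply: antiD.
- move=> d dR; rewrite /wG dR add0r; apply: push0 => f ef.
  by have := aV_out (tP f); rewrite -aDt ef dR.
- move=> x; rewrite pushD tGG push_comp (push_fun (g := aV \o tP) _ aDt) -push_comp (push_ext _ tth).
  case: ifP => xR.
    by rewrite sa // add0r push0 // => p ep; have := aV_out p; rewrite ep xR.
  have := hv x; rewrite [push bV v x]push0 ?subr0 => [<-|p ep]; first by ring.
  by have := bV_in p; rewrite ep xR.
- move=> e; rewrite pushD push_comp (push_fun (g := lG \o bD) _ ab_label) -push_comp (push_ext _ bth).
  rewrite -pushD -[RHS]lw0; apply: push_ext => d; rewrite /wG /wR.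
  by case: ifP; rewrite ?addr0 ?add0r.
Qed.

(** The inequality is the extreme case of [cone_count], whose exactness hypothesis is
    [exact_lift]. *)
Lemma h1_count : (#|[set d | ~~ inR (tG d)]| + 2 * #|VU| <= 2 * #|[set v | ~~ inR v]| + #|DU|)%N ->
  forall w, anti rG w -> (forall d, inR (tG d) -> w d = 0) ->
  push tG w =1 (fun _ => 0) -> push lG w =1 (fun _ => 0) -> w =1 (fun _ => 0).
Proof.
move=> le; have rGN d : rG d != d by apply: contraNneq (rUN (lG d)) => e; rewrite -lGr e.
have [|||||_ h] := @cone_count _ _ _ _ rG rU tG tU rGK rGN rUK rUN lG qG
  [set d | ~~ inR (tG d)] [set v | ~~ inR v] setT setT.
- by move=> d; rewrite !inE inR_rev.
- by [].
- by [].
- by [].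
- move=> a c sa ac _ eac; have [|w [aw sw tw lw]] := exact_lift _ ac eac.
    by move=> x xR; apply: sa; rewrite inE xR.
  by exists w; split=> // d; rewrite inE negbK; apply: sw.
move=> w aw sw; apply: h => //; first by rewrite !cardsT.
by move=> d; rewrite inE negbK; apply: sw.
Qed.

End Exact.

Section Fibres.
Local Open Scope ring_scope.
Variables (V D W : finType) (rv : D -> D) (tg : D -> V) (q : V -> W).
Hypothesis rvK : involutive rv.
Hypothesis conn : forall x y, q x = q y -> exists s, walk_from_to rv tg x s y.

Lemma fibre_fill b : push q b =1 (fun _ => 0) ->
  exists2 u, anti rv u & push tg u =1 b.
Proof.
move=> b0.
pose rep v := [pick y | q y == v]; pose r x := odflt x (rep (q x)).
have qr x : q (r x) = q x by rewrite /r /rep; case: pickP => [y /eqP|].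
have rr x y : q x = q y -> r x = r y.
  by move=> e; rewrite /r e /rep; case: pickP => // /(_ y); rewrite eqxx.
have /fin_all_exists[s hs] x := conn (qr x).
exists (fun d => \sum_x b x * chain rv (s x) d).
  by apply: anti_sum => x; apply: chain_anti.
move=> x; rewrite push_sum (eq_bigr (fun p => b p * delta p x - b p * delta (r p) x)).
  rewrite sumrB sum_coords [X in _ - X](_ : _ = 0) ?subr0 //.
  rewrite (partition_big q xpredT) //; apply: big1 => v _.
  case: (pickP (fun p => q p == v)) => [y /eqP ey|no]; last first.
    by apply: big1 => p; rewrite andTb no.
  rewrite (eq_bigr (fun p => b p * delta (r y) x)) => [|p /eqP ep].
    by rewrite -mulr_suml -/(push q b v) b0 mul0r.
  by rewrite (rr p y) // ep ey.
by move=> p _; rewrite (bd_chain _ _ (hs p)) // mulrBr.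
Qed.

End Fibres.

Section Conjugates.
Variables (D : eqType) (rv : D -> D).
Hypothesis rvK : involutive rv.

Lemma weq_reduced_eq s t : reducedw rv s -> reducedw rv t -> weq rv s t -> s = t.
Proof. by move=> rs rt; rewrite /weq !wreduce_id. Qed.

Lemma reducedw_inv s : reducedw rv s -> reducedw rv (inv_walk rv s).
Proof.
rewrite /reducedw /inv_walk rev_sorted sorted_map; apply: sub_sorted => a b /=.
by rewrite rvK eq_sym.
Qed.

Definition cj (p t : seq D) := p ++ t ++ inv_walk rv p.

Lemma cj_cat p q t : cj p (cj q t) = cj (p ++ q) t.
Proof. by rewrite /cj inv_walk_cat -!catA. Qed.

Lemma weq_cj p p' t t' : weq rv p p' -> weq rv t t' -> weq rv (cj p t) (cj p' t').
Proof.
by move=> hp ht; apply: (weq_cat rvK hp); apply: (weq_cat rvK ht); apply: (weq_inv rvK hp).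
Qed.

End Conjugates.

Lemma cards2_eq (T : finType) (A : {set T}) d d' d'' : #|A| = 2 ->
  d \in A -> d' \in A -> d'' \in A -> d' != d -> d'' != d -> d' = d''.
Proof.
move=> /eqP/cards2P[a [b [_ ->]]]; rewrite !inE.
by do 3!case/orP=> /eqP->; rewrite ?eqxx.
Qed.

Lemma sum_sig (T : finType) (P Q : pred T) (F : T -> rat) :
  (\sum_(p : {x | P x} | Q (val p)) F (val p) = \sum_(x | P x && Q x) F x)%R.
Proof.
rewrite [RHS](reindex_omap (val : {x | P x} -> T) insub) => [|x /andP[Px _]]; last first.
  by rewrite insubT.
by apply: eq_bigl => p; rewrite valK eqxx andbT (valP p).
Qed.

(** * The page graph of X and the conclusion for edge spaces *)

Section Gos.
Variables (X : gos) (HX : is_2cgos X) (m : nat) (c : VV X -> option 'I_m).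
Hypothesis Hdec : horiz_decomp X m c.
Variables (k : 'I_m -> nat) (s : 'I_m -> seq (ED X)).
Hypothesis Hcyl : mcyl_struct X m c k s.

Definition inR : pred (VV X) := fun x => c x != None.

Lemma flipV_neq x : flipV X x != x.
Proof.
by apply: contraNneq ((u_serre X HX).2 (pE X x)) => e; rewrite -(flip_p X HX) e.
Qed.

Lemma inR_flip x : inR (tauV X (flipV X x)) = inR (tauV X x).
Proof. by rewrite /inR (hd_closed _ _ _ Hdec). Qed.

Lemma srcE_flip y : srcE X (flipD X y) = flipV X (srcE X y).
Proof. by rewrite /srcE (flip_rev X HX) (flip_tgt X HX). Qed.

Lemma srcE_rev y : srcE X (revE X y) = tgtE X y.
Proof. by rewrite /srcE (e_serre X HX).1. Qed.

(** Every 2-cell occurs, up to reversal and flip, in some mapping cylinder, whose cells run from a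
    circle to Gamma_oo; flipping keeps sides and reversal exchanges them. *)
Lemma side y : inR (tauV X (srcE X y)) = ~~ inR (tauV X (tgtE X y)).
Proof.
have [i [z [zi zy]]] : exists i z, z \in s i /\ z \in cell X y.
  apply: NNPP => no; have := mc_cells _ _ _ _ _ Hcyl y.
  rewrite big1 // => i _; apply/eqP; rewrite -leqn0 leqNgt -has_count.
  by apply/hasPn => z zi; apply/negP => zy; apply: no; exists i, z.
have [h1 h2] := mc_side _ _ _ _ _ Hcyl _ _ zi.
have {h1}h1 : inR (tauV X (srcE X z)) by rewrite /inR h1.
have {h2}h2 : inR (tauV X (tgtE X z)) = false by rewrite /inR h2.
move: zy h1 h2; rewrite !inE => /or4P[]/eqP->.
- by move=> -> ->.
- by rewrite srcE_rev -/(srcE X y) => -> ->.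
- by rewrite srcE_flip (flip_tgt X HX) !inR_flip => -> ->.
- by rewrite srcE_flip (flip_tgt X HX) !inR_flip srcE_rev -/(srcE X y) => -> ->.
Qed.

(** Edges of vertex spaces and 2-cells, each directed towards Gamma_oo, which by [side] selects one
    of two directions. With [flipD] as reversal they form the page graph. *)
Definition VP : finType := {d : DV X | ~~ inR (tgtV X d)}.
Definition DP : finType := {y : ED X | ~~ inR (tauV X (tgtE X y))}.

Lemma tP_sub (f : DP) : ~~ inR (tgtV X (tauD X (val f))).
Proof. by rewrite (tau_tgt X HX); apply: (valP f). Qed.
Lemma rP_sub (f : DP) : ~~ inR (tauV X (tgtE X (flipD X (val f)))).
Proof. by rewrite (flip_tgt X HX) inR_flip; apply: (valP f). Qed.

Definition tP (f : DP) : VP := Sub (tauD X (val f)) (tP_sub f).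
Definition rP (f : DP) : DP := Sub (flipD X (val f)) (rP_sub f).
Definition aV (p : VP) := tgtV X (val p).
Definition bV (p : VP) := tgtV X (revV X (val p)).
Definition aD (f : DP) := tgtE X (val f).
Definition bD (f : DP) := srcE X (val f).
Definition pages i : seq DP := pmap insub (s i).

Lemma rPK : involutive rP.
Proof. by move=> f; apply: val_inj; rewrite /= (flipD_inv X HX). Qed.
Lemma aDr : {morph aD : f / rP f >-> flipV X f}.
Proof. by move=> f; rewrite /aD /= (flip_tgt X HX). Qed.
Lemma bDr : {morph bD : f / rP f >-> flipV X f}.
Proof. by move=> f; rewrite /bD /= srcE_flip. Qed.
Lemma aDt f : tauV X (aD f) = aV (tP f).
Proof. by rewrite /aD /aV /= (tau_tgt X HX). Qed.
Lemma bDt f : tauV X (bD f) = bV (tP f).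
Proof. by rewrite /bD /bV /= (tau_rev X HX) (tau_tgt X HX). Qed.
Lemma rP_neq f : rP f != f.
Proof. by apply: contraNneq (flipV_neq (aD f)) => e; rewrite -aDr e. Qed.
Lemma ab_label f : pE X (aD f) = pE X (bD f).
Proof. exact: (e_fiber X HX). Qed.
Lemma aV_out p : ~~ inR (aV p). Proof. exact: (valP p). Qed.

Lemma dside d : inR (tgtV X (revV X d)) = ~~ inR (tgtV X d).
Proof.
have [y] : exists y, y \in [set y | tauD X y == d].
  by apply/card_gt0P; rewrite (two_cover X HX).
rewrite inE => /eqP<-; rewrite (tau_rev X HX) !(tau_tgt X HX); exact: side.
Qed.

Lemma bV_in p : inR (bV p). Proof. by rewrite /bV dside aV_out. Qed.

Lemma aD_loc f f' : tP f = tP f' -> aD f = aD f' -> f = f'.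
Proof. by move=> [e] ea; apply: val_inj; apply: (tau_imm X HX). Qed.

Lemma bD_loc f f' : tP f = tP f' -> bD f = bD f' -> f = f'.
Proof.
move=> [e] eb; apply: val_inj; apply: (can_inj (e_serre X HX).1).
by apply: (tau_imm X HX) eb _; rewrite -!(tau_rev X HX) e.
Qed.

Lemma hdegR x : inR x -> #|[set h | tauV X h == x]| = 2.
Proof.
rewrite /inR; case ex : (c x) => [i|] // _.
by have [_ _] := hd_circ _ _ _ Hdec i; apply.
Qed.

Lemma deg2 d d' d'' : inR (tauV X d) -> tauV X d' = tauV X d -> tauV X d'' = tauV X d ->
  d' != d -> d'' != d -> d' = d''.
Proof. by move=> /hdegR/cards2_eq h e e'; apply: h; rewrite inE ?e ?e'. Qed.

Lemma val2 p : #|[set f | tP f == p]| = 2.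
Proof.
rewrite -(two_cover X HX (val p)) -(card_imset _ val_inj); apply: eq_card => y.
rewrite inE; apply/imsetP/eqP => [[f]|e]; first by rewrite inE => /eqP<- ->.
have yA : ~~ inR (tauV X (tgtE X y)) by rewrite -(tau_tgt X HX) e (valP p).
by exists (Sub y yA) => //; rewrite inE; apply/eqP/val_inj.
Qed.

(** [bD] is locally injective between graphs of valency two, hence locally bijective. *)
Lemma cover p h : tauV X h = bV p -> exists2 f, tP f = p & bD f = h.
Proof.
move=> eh; have /eqP/cards2P[f [f' [ne ef]]] := val2 p.
have h1 : tP f = p by apply/eqP; have := set21 f f'; rewrite -ef inE.
have h2 : tP f' = p by apply/eqP; have := set22 f f'; rewrite -ef inE.
case: (eqVneq (bD f) h) => [e|nh]; first by exists f.
exists f' => //; apply: (deg2 (d := bD f)); rewrite ?bDt ?h1 ?bV_in ?h2 //.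
  by apply: contraNneq ne => /(bD_loc (etrans h2 (esym h1)))->.
by rewrite eq_sym.
Qed.

Lemma val_pages i : map val (pages i) = s i.
Proof.
rewrite /pages (pmap_filter (insubK _)); apply/all_filterP/allP => y yi.
rewrite isSome_insub /inR; by have [_ ->] := mc_side _ _ _ _ _ Hcyl _ _ yi.
Qed.

Lemma mem_pages i f : (f \in pages i) = (val f \in s i).
Proof. by rewrite -val_pages (mem_map val_inj). Qed.

Lemma aD_pages i : map aD (pages i) = map (tgtE X) (s i).
Proof. by rewrite -val_pages -map_comp. Qed.

Lemma pages_n0 i : pages i != [::].
Proof. by apply: contraNneq (mc_nonempty _ _ _ _ _ Hcyl i) => e; rewrite -val_pages e. Qed.

Lemma pages_cycle i : cycle (fun y y' => tP y == tP (rP y')) (pages i).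
Proof.
have := mc_cycle _ _ _ _ _ Hcyl i; rewrite -val_pages cycle_map.
by congr is_true; apply: eq_cycle => y y'.
Qed.

Lemma pages_cells y : \sum_i count (fun z => (z == y) || (z == rP y)) (pages i) = 1.
Proof.
rewrite -[RHS](mc_cells _ _ _ _ _ Hcyl (val y)); apply: eq_bigr => i _.
rewrite -[s i]val_pages count_map; apply: eq_count => z /=; rewrite !inE -!(inj_eq val_inj) /=.
have yA : inR (tauV X (tgtE X (revE X (val y)))) by rewrite -/(srcE X _) side (valP y).
have -> : (val z == revE X (val y)) = false.
  by apply/eqP => e; have := valP z; rewrite /= e yA.
have -> : (val z == flipD X (revE X (val y))) = false.
  by apply/eqP => e; have := valP z; rewrite /= e (flip_tgt X HX) inR_flip yA.
by rewrite orbF.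
Qed.

Lemma bD_surj d : inR (tauV X d) -> exists f, bD f = d.
Proof.
rewrite /inR; case ed : (c _) => [i|] // _.
have := mc_cover_deg _ _ _ _ _ Hcyl _ _ ed; have := mc_k _ _ _ _ _ Hcyl i.
rewrite -val_pages -map_comp count_map => k2 ck.
have /hasP[f _ /=] : has (preim (srcE X \o val) (fun h => (h == d) || (h == flipV X d))) (pages i).
  by rewrite has_count ck; lia.
case/orP => /eqP e; first by exists f.
by exists (rP f); rewrite bDr /bD e (flipV_inv X HX).
Qed.

Lemma card_R : #|[set d | inR (tauV X d)]| = (2 * #|[set v | inR v]|)%N.
Proof.
rewrite -sum1_card (partition_big (tauV X) (mem [set v | inR v])) => [|d]; last by rewrite !inE.
rewrite mulnC -sum_nat_const; apply: eq_bigr => v vR0; have vR : inR v by move: vR0; rewrite /= inE.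
rewrite -(hdegR vR) -sum1_card; apply: eq_bigl => d; rewrite !inE andbC.
by case: eqP => // ->; rewrite vR.
Qed.

(** Connected vertex spaces give a vertical 1-chain with boundary [b]; with all edges directed
    towards Gamma_oo the boundary reads aV - bV. *)
Lemma conn_fill b : push (pV X) b =1 (fun _ => 0%R) ->
  exists v, b =1 (fun x => push aV v x - push bV v x)%R.
Proof.
have cn x y : pV X x = pV X y -> exists w, walk_from_to (revV X) (tgtV X) x w y.
  by move=> e; apply: (v_conn X HX (pV X x)).
case/(fibre_fill (v_serre X HX).1 cn) => u au hu.
exists (fun p => u (val p)) => x; rewrite -hu /push.
rewrite (sum_sig (fun d => ~~ inR (tgtV X d)) (fun d => tgtV X d == x)).
rewrite (sum_sig (fun d => ~~ inR (tgtV X d)) (fun d => tgtV X (revV X d) == x)).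
rewrite (bigID (fun d => inR (tgtV X d))) /= addrC; congr (_ + _)%R.
  by apply: eq_bigl => d; rewrite andbC.
rewrite (reindex_inj (can_inj (v_serre X HX).1)) /= -sumrN.
by apply: eq_big => d; [rewrite dside andbC | rewrite au].
Qed.

Lemma circle_color comp p : (forall i f, f \in pages i -> comp (tP f) = i) ->
  c (bV p) = Some (comp p).
Proof.
move=> cE; have [[f i] /= [fi <-]] := g_in rPK rP_neq val2 pages_cycle pages_cells p.
rewrite (cE _ _ fi) -bDt; rewrite mem_pages in fi.
by have [] := mc_side _ _ _ _ _ Hcyl _ _ fi.
Qed.

Definition cell_dart (z : DP * bool) := if z.2 then val z.1 else revE X (val z.1).

Lemma cell_dart_inj : injective cell_dart.
Proof.
have h (f f' : DP) : val f <> revE X (val f').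
  move=> e; have := valP f; rewrite /= e -/(srcE X _) side.
  by rewrite (valP f').
move=> [f []] [f' []]; rewrite /cell_dart /=.
- by move=> /val_inj->.
- by move=> /h.
- by move=> e; case: (h f' f).
- by move=> /(can_inj (e_serre X HX).1)/val_inj->.
Qed.

Lemma cell_dart_surj y : exists z, cell_dart z = y.
Proof.
case: (boolP (inR (tauV X (tgtE X y)))) => h; last by exists (Sub y h : DP, true).
have h' : ~~ inR (tauV X (tgtE X (revE X y))) by rewrite -/(srcE X y) side h.
by exists (Sub (revE X y) h' : DP, false); rewrite /cell_dart /= (e_serre X HX).1.
Qed.

Lemma edge_acyclic : (forall u t, reducedw (@cell_rev DP) t ->
    walk_from_to (@cell_rev DP) (cell_tgt aD bD) u t u -> t = [::]) ->
  forall x t, t != [::] -> reducedw (revE X) t -> ~~ walk_from_to (revE X) (tgtE X) x t x.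
Proof.
move=> H x t t0 rt; apply/negP => wt.
have /fin_all_exists[phi hphi] := cell_dart_surj.
have phir : {morph phi : y / revE X y >-> cell_rev y}.
  move=> y; apply: cell_dart_inj; rewrite hphi -{1}[y]hphi.
  by case: (phi y) => f []; rewrite /cell_dart //= (e_serre X HX).1.
have phit y : cell_tgt aD bD (phi y) = tgtE X y.
  by rewrite -{2}[y]hphi; case: (phi y) => f [].
have e := H x (map phi t) _ (walk_map (tg := tgtE X) (g := id) phir phit wt).
case/negP: t0; rewrite -size_eq0 -(size_map phi) e //.
rewrite /reducedw sorted_map; apply: sub_sorted rt => a b /=.
by rewrite -phir (inj_eq (can_inj hphi)).
Qed.

Hypothesis Hchi : euler_char (VV X) (EV X) = euler_char (VU X) (DU X).

(** By [card_R] the circles contribute nothing to the Euler characteristic. *)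
Lemma chi_count : (#|[set d | ~~ inR (tauV X d)]| + 2 * #|VU X| <=
  2 * #|[set v | ~~ inR v]| + #|DU X|)%N.
Proof.
have rGK := flipV_inv X HX; have [rUK rUN] := u_serre X HX.
have eE := card_ori rGK flipV_neq (A := setT) (fun d _ => in_setT _).
have eU := card_ori rUK rUN (A := setT) (fun d _ => in_setT _).
have cD := cardsID [set d | inR (tauV X d)] setT.
have cV := cardsID [set v | inR v] setT.
rewrite !setTI !setTD in cD cV.
have n1 : ~: [set d | inR (tauV X d)] = [set d | ~~ inR (tauV X d)].
  by apply/setP => d; rewrite !inE.
have n2 : ~: [set v | inR v] = [set v | ~~ inR v] by apply/setP => d; rewrite !inE.
rewrite n1 in cD; rewrite n2 in cV; move: Hchi card_R; rewrite /euler_char.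
by rewrite !cardsT in eE eU cD cV; lia.
Qed.

Variables (v0 : VV X) (gam : 'I_m -> seq (EV X)).
Hypothesis Hv0 : c v0 = None.
Hypothesis Hrep : forall i, represents X v0 (map (tgtE X) (s i)) (gam i).
Hypothesis Hindiv : forall i, pi_indivisible (flipV X) (tauV X) v0 (gam i).
Hypothesis Hnconj : forall i j, i != j ->
  ~ pi_conj (flipV X) (tauV X) v0 (gam i) (gam j).
Hypothesis Hninv : forall i j, i != j ->
  ~ pi_conj (flipV X) (tauV X) v0 (gam i) (inv_walk (flipV X) (gam j)).

Local Notation rG := (flipV X).
Local Notation tG := (tauV X).
Local Notation walk := (walk_from_to rG tG).

Lemma rep_path i q : walk_from_to rP tP q (pages i) q ->
  exists p, walk v0 p (aV q) /\ gam i = wreduce rG (cj rG p (map aD (pages i))).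
Proof.
move=> wq; have [p [wp eg]] := Hrep i; rewrite -aD_pages in wp eg; exists p; split=> //.
have : walk v0 (p ++ map aD (pages i) ++ inv_walk rG p)
    (wend tG v0 (p ++ map aD (pages i) ++ inv_walk rG p)) by rewrite /walk_from_to wp eqxx.
case/walk_catP => y w1 w2; suff -> : aV q = y by [].
have := walk_map aDr aDt wq; move: w2; have := pages_n0 i.
case: (pages i) => // f t _; rewrite /= !walk_cons => /andP[/eqP<- _] /andP[/eqP<- _].
by [].
Qed.

Let rGK := flipV_inv X HX.

Lemma pages_indiv i q z j : walk_from_to rP tP q (pages i) q -> walk (aV q) z (aV q) ->
  weq rG (wpow z j) (map aD (pages i)) -> j = 1%N.
Proof.
move=> wq wz ez; have [p [wp eg]] := rep_path wq.
pose h := wreduce rG (cj rG p z).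
have lh : loop_at rG tG v0 h.
  rewrite /loop_at wreduce_reduced; apply: (walk_red rGK).
  by apply: (walk_catI wp); apply: (walk_catI wz); apply: (walk_inv rGK wp).
have [|e|e] := @Hindiv i h (Posz j) lh; last 2 first.
- by case: e.
- by [].
apply: (weq_reduced_eq (rv := rG)); rewrite ?eg ?wreduce_reduced ?pi_pow_reduced //.
apply: weq_trans (weq_pi_pow rGK h (Posz j)) _; rewrite /wzpow.
apply: weq_trans (weq_pow rGK j (weq_red rG _)) _.
apply: weq_trans (weq_conj_pow rGK p z j) _.
apply: weq_trans _ (weq_sym (weq_red rG _)).
by apply: (weq_catl rGK); apply: (weq_catr rGK).
Qed.

(** The conjugating loop is p' w^-1 p^-1. Here [a] stands for the second page loop or its inverse,
    and [t] for the corresponding element at [v0]. *)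
Lemma pages_conj i i' q q' w t : walk_from_to rP tP q (pages i) q ->
  walk_from_to rP tP q' (pages i') q' -> walk (aV q) w (aV q') ->
  forall p p', walk v0 p (aV q) -> walk v0 p' (aV q') ->
  reducedw rG t -> gam i = wreduce rG (cj rG p (map aD (pages i))) -> 
  forall a, t = wreduce rG (cj rG p' a) ->
  weq rG (map aD (pages i)) (w ++ a ++ inv_walk rG w) ->
  pi_conj rG tG v0 (gam i) t.
Proof.
move=> wq wq' ww p p' wp wp' rt eg a et e.
pose d := wreduce rG (p' ++ inv_walk rG w ++ inv_walk rG p); exists d; split.
  rewrite /loop_at wreduce_reduced; apply: (walk_red rGK); apply: (walk_catI wp').
  by apply: (walk_catI (walk_inv rGK ww)); apply: (walk_inv rGK wp).
apply: (weq_reduced_eq (rv := rG)) => //; first exact: wreduce_reduced.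
apply: weq_sym; apply: weq_trans (weq_red rG _) _.
pose D := p' ++ inv_walk rG w ++ inv_walk rG p.
apply: weq_trans (weq_cj rGK (weq_red rG D) (weq_refl rG _)) _; rewrite eg et.
apply: weq_trans (weq_cj rGK (weq_refl rG D) (weq_red rG _)) _.
apply: weq_trans _ (weq_sym (weq_red rG _)).
apply: weq_trans (weq_cj rGK (weq_refl rG D) (weq_cj rGK (weq_refl rG p) e)) _.
rewrite -[w ++ a ++ _]/(cj rG w a) !cj_cat; apply: (weq_cj rGK) (weq_refl rG a).
rewrite /D -!catA -[X in weq _ _ X]cats0; apply: (weq_catl rGK).
apply: weq_trans (weq_catl rGK _ _) (weq_invl rGK w).
by rewrite catA; apply: (@weq_catr _ _ rGK _ [::]); apply: weq_invl.
Qed.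

Lemma pages_nonconj i i' q q' w : i != i' -> walk_from_to rP tP q (pages i) q ->
  walk_from_to rP tP q' (pages i') q' -> walk (aV q) w (aV q') ->
  ~ weq rG (map aD (pages i)) (w ++ map aD (pages i') ++ inv_walk rG w) /\
  ~ weq rG (map aD (pages i)) (w ++ inv_walk rG (map aD (pages i')) ++ inv_walk rG w).
Proof.
move=> ne wq wq' ww; have [p [wp eg]] := rep_path wq; have [p' [wp' eg']] := rep_path wq'.
split=> h; [apply: (Hnconj ne) | apply: (Hninv ne)].
  apply: (pages_conj wq wq' ww wp wp' _ eg eg' h).
  by rewrite eg' wreduce_reduced.
apply: (pages_conj wq wq' ww wp wp' _ eg _ h).
  by rewrite reducedw_inv // eg' wreduce_reduced.
apply: (weq_reduced_eq (rv := rG)); rewrite ?wreduce_reduced //.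
  by rewrite reducedw_inv // eg' wreduce_reduced.
rewrite eg'; apply: weq_trans (weq_inv rGK (weq_red rG _)) _.
apply: weq_trans _ (weq_sym (weq_red rG _)).
by rewrite /cj !inv_walk_cat (inv_walkK rGK) catA.
Qed.

Lemma edge_forest u t : reducedw (@cell_rev DP) t ->
  walk_from_to (@cell_rev DP) (cell_tgt aD bD) u t u -> t = [::].
Proof.
have [rUK rUN] := u_serre X HX; have lGr := flip_p X HX.
have [comp [p0 [walk_g path_p cyc compE comp_rev]]] :=
  circles rPK rP_neq val2 pages_n0 pages_cycle pages_cells.
have g_tot f : f \in pages (comp (tP f)) \/ rP f \in pages (comp (tP f)).
  have [i [h|h]] := g_total rP_neq pages_cells f; first by left; rewrite (compE _ _ h).
  by right; rewrite -comp_rev (compE _ _ h).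
have comp_b p q : bV p = bV q -> comp p = comp q.
  by move=> e; have := circle_color p compE; rewrite e (circle_color q compE) => -[].
have g_rv i f : f \in pages i -> rP f \notin pages i.
  exact: (g_rvN rP_neq pages_cells).
have fillP := fibres_fill rGK flipV_neq inR_flip deg2 rPK bDr bDt bV_in bD_loc walk_g path_p comp_rev
  pages_n0 g_rv g_tot compE comp_b.
have h1 := h1_count rUK rUN rGK lGr (tau_p X HX) (e_nonempty X HX) inR_flip rPK aDr bDr
  aDt bDt ab_label aV_out bV_in bD_surj fillP conn_fill chi_count.
have pi1 p z (wz : walk (aV p) z (aV p)) := pi1_G rUK rUN rGK lGr inR_flip h1 (aV_out p) wz.
have glob := bD_glob rGK flipV_neq inR_flip deg2 rPK bDr bDt bV_in bD_loc rUK lGr aDr aDt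
  ab_label cover aD_loc pi1.
have indiv i z j wz ez := @pages_indiv i (p0 i) z j (walk_g i) wz ez.
(* Project the page circle through [v]. Its label is also that of its image in Gamma_oo; if it were
   trivial, so would be that image, which would then be a 0-th power, against [indiv]. *)
have loopR v : inR v -> exists z, walk v z v /\ ~ weq (revU X) (map (pE X) z) [::].
  move=> vR; have [d] : exists d, d \in [set h | tG h == v] by apply/card_gt0P; rewrite hdegR.
  rewrite inE => /eqP ed; have [f ef] : exists f, bD f = d by apply: bD_surj; rewrite ed.
  have bp : bV (tP f) = v by rewrite -bDt ef.
  have [r wr] := path_p (tP f); set i := comp (tP f) in wr.
  pose z := inv_walk rP r ++ pages i ++ r.
  have wz : walk_from_to rP tP (tP f) z (tP f).
    by apply: (walk_catI (walk_inv rPK wr)); apply: (walk_catI (walk_g i) wr).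
  exists (map bD z); split; first by rewrite -bp; apply: walk_map wz; [exact: bDr | exact: bDt].
  rewrite -map_comp -(eq_map (f := pE X \o aD)) => [|y]; last exact: ab_label.
  rewrite map_comp => /(pi1 _ _ (walk_map aDr aDt wz)).
  rewrite /z !map_cat (inv_walk_map _ aDr) => e.
  suff : 0%N = 1%N by [].
  apply: (indiv i [::] 0%N); rewrite ?walk0 //.
  have h : weq rG (map aD (pages i) ++ map aD r) (map aD r).
    apply: (@weq_catIl _ _ rGK (inv_walk rG (map aD r))); apply: weq_trans e _.
    by apply: weq_sym; apply: weq_invl.
  by apply: weq_sym; apply: (@weq_catIr _ _ rGK (map aD r)).
have [eqG eqGP] := prop_rel (triv (revU X) rG tG (pE X)).
have [eqP' eqPP] := prop_rel (triv (revU X) rP tP (fun f => pE X (aD f))).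
apply: (cell_forest rUK rUN rGK lGr inR_flip rPK aDr bDr aDt bDt ab_label aV_out bV_in cover
  aD_loc fillP h1 _ loopR walk_g path_p cyc indiv _ glob eqGP eqPP).
  by rewrite card_R.
by move=> i i' w ne ww; apply: (pages_nonconj ne (walk_g i) (walk_g i') ww).
Qed.

Lemma edge_tree e : tree_on (revE X) (tgtE X) (fun x => pE X x = e).
Proof.
split; [exact: (e_nonempty X HX) | exact: (e_conn X HX) |].
by move=> x t _; apply: edge_acyclic; apply: edge_forest.
Qed.

End Gos.

Theorem theorem2p1 (X : gos) (HX : is_2cgos X)
  (m : nat) (c : VV X -> option 'I_m) (Hdec : horiz_decomp X m c)
  (k : 'I_m -> nat) (s : 'I_m -> seq (ED X)) (Hcyl : mcyl_struct X m c k s)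
  (v0 : VV X) (Hv0 : c v0 = None) (gam : 'I_m -> seq (EV X))
  (Hrep : forall i, represents X v0 (map (tgtE X) (s i)) (gam i))
  (Hindiv : forall i, pi_indivisible (flipV X) (tauV X) v0 (gam i))
  (Hnconj : forall i j, i != j -> ~ pi_conj (flipV X) (tauV X) v0 (gam i) (gam j))
  (Hninv : forall i j, i != j ->
     ~ pi_conj (flipV X) (tauV X) v0 (gam i) (inv_walk (flipV X) (gam j)))
  (Hchi : euler_char (VV X) (EV X) = euler_char (VU X) (DU X)) :
  forall e : DU X, tree_on (revE X) (tgtE X) (fun x => pE X x = e).
Proof.
exact: (edge_tree HX Hdec Hcyl Hchi Hrep Hindiv Hnconj Hninv).
Qed.
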